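(* The following two statements are equivalent. (i) For every even positive integer $n$ and every pair $f,g$ of generic quadratic forms in $E_n$, the Hilbert series of $E_n/(f,g)$ is equal to $1+a(n,1)t+a(n,2)t^2+\cdots+a(n,\lceil \frac n2\rceil)t^{\lceil \frac n2\rceil}$. (ii) For every positive integer $n$ and every pair $\ell_1,\ell_2$ of generic linear forms in $S_n$, the Hilbert series of $S_n/(x_1^2,\ldots,x_n^2,\ell_1^2,\ell_2^2)$ is equal to $1+a(n,1)t+a(n,2)t^2+\cdots$ (that is, $\sum_{s\ge 0}a(n,s)t^s$).
   Context: $S_n=\mathbb{C}[x_1,\ldots,x_n]$ is the polynomial ring with its standard grading, and $E_n$ is the exterior algebra over $\mathbb{C}$ on $n$ generators $x_1,\ldots,x_n$ of degree one. Forms are called generic if all their coefficients (the coefficients of all the forms under consideration, taken together) are mutually algebraically independent over $\mathbb{Q}$. The Hilbert series of a graded algebra $A=\bigoplus_s A_s$ is $\sum_s \dim_{\mathbb{C}}(A_s)t^s$. For integers $n,s$ with $s\ge 0$, $a(n,s)$ denotes the number of lattice paths inside the rectangle $(n+2-2s)\times(n+2)$ (width $n+2-2s$, height $n+2$, boundary included) from the bottom left corner $(0,0)$ to the top right corner $(n+2-2s,n+2)$ with moves of two types: $(x,y)\to(x+1,y+1)$ or $(x,y)\to(x-1,y+1)$. If $n+2-2s<0$ then $a(n,s)=0$. *)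

(* Defs.v *)
From HB Require Import structures.
From mathcomp Require Import all_boot all_order all_algebra.
From mathcomp Require Import mpoly.

Set Implicit Arguments.
Unset Strict Implicit.
Unset Printing Implicit Defensive.

Import GRing.Theory.
Local Open Scope ring_scope.

(* The exterior algebra on n generators x_i of degree one.  The value of f at
   A = {i_1 < ... < i_k} is the coefficient of x_A := x_{i_1} ... x_{i_k}. *)
Definition extalg (K : fieldType) (n : nat) : Type := {ffun {set 'I_n} -> K^o}.

HB.instance Definition _ (K : fieldType) (n : nat) :=
  GRing.Lmodule.copy (extalg K n) {ffun {set 'I_n} -> K^o}.

Section ExteriorAlgebra.

Variables (K : fieldType) (n : nat).

Implicit Types (A B C S : {set 'I_n}) (f g h : extalg K n) (i j : 'I_n).

Definition ext_coef f A : K := f A.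

(* The number of transpositions needed to sort the concatenation of A and B. *)
Definition ext_inv A B : nat := (\sum_(i in A) \sum_(j in B) (j < i))%N.

(* x_A x_B = ext_sign A B *: x_(A :|: B) *)
Definition ext_sign A B : K :=
  if [disjoint A & B] then (-1) ^+ ext_inv A B else 0.

Definition ext_monom A : extalg K n := [ffun B => (B == A)%:R].

Definition ext_gen i : extalg K n := ext_monom [set i].

Definition ext_mul f g : extalg K n :=
  [ffun S => \sum_A \sum_(B | A :|: B == S)
               ext_sign A B * (ext_coef f A * ext_coef g B)].

Lemma ext_coefP f g : (forall A, ext_coef f A = ext_coef g A) -> f = g.
Proof. by move=> fg; apply/ffunP. Qed.

Lemma ext_coefD f g A : ext_coef (f + g) A = ext_coef f A + ext_coef g A.
Proof. by rewrite /ext_coef ffunE. Qed.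

Lemma ext_coefZ a f A : ext_coef (a *: f) A = a * ext_coef f A.
Proof. by rewrite /ext_coef ffunE. Qed.

Lemma ext_coef_monom A B : ext_coef (ext_monom A) B = (B == A)%:R.
Proof. by rewrite /ext_coef ffunE. Qed.

Lemma ext_coef_mul f g S :
  ext_coef (ext_mul f g) S =
  \sum_A \sum_(B | A :|: B == S) ext_sign A B * (ext_coef f A * ext_coef g B).
Proof. by rewrite /ext_coef ffunE. Qed.

Lemma ext_sum_coef_mul f g (F : {set 'I_n} -> K) :
  \sum_S F S * ext_coef (ext_mul f g) S =
  \sum_A \sum_B F (A :|: B) * (ext_sign A B * (ext_coef f A * ext_coef g B)).
Proof.
under eq_bigr => S _ do rewrite ext_coef_mul mulr_sumr.
rewrite exchange_big /=; apply: eq_bigr => A _.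
under eq_bigr => S _ do rewrite mulr_sumr big_mkcond /=.
rewrite exchange_big /=; apply: eq_bigr => B _.
by rewrite -big_mkcond /= (big_pred1 (A :|: B)).
Qed.

Lemma ext_signA A B C :
  ext_sign A B * ext_sign (A :|: B) C = ext_sign A (B :|: C) * ext_sign B C.
Proof.
rewrite /ext_sign -!setI_eq0 setIUl setIUr !setU_eq0 !setI_eq0.
case: (boolP [disjoint A & B]) => dAB; last by rewrite /= !mul0r.
case: (boolP [disjoint A & C]) => dAC /=; last by rewrite mulr0 mul0r.
case: (boolP [disjoint B & C]) => dBC; last by rewrite !mulr0.
rewrite -!exprD /ext_inv; congr (_ ^+ _).
have sumU (F : 'I_n -> nat) (X Y : {set 'I_n}) : [disjoint X & Y] ->
    (\sum_(i in X :|: Y) F i = \sum_(i in X) F i + \sum_(i in Y) F i)%N.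
  by move=> dXY; rewrite -bigU //=; apply: eq_bigl => i; rewrite !inE.
rewrite (sumU _ _ _ dAB) addnA; congr (_ + _)%N.
by rewrite -big_split /=; apply: eq_bigr => i _; rewrite sumU.
Qed.

Lemma ext_mulA : associative ext_mul.
Proof.
move=> f g h; apply: ext_coefP => S.
transitivity (\sum_A \sum_B \sum_C (A :|: (B :|: C) == S)%:R *
    (ext_sign A (B :|: C) * ext_sign B C *
     (ext_coef f A * ext_coef g B * ext_coef h C))).
  rewrite ext_coef_mul; apply: eq_bigr => A _.
  pose F X := (A :|: X == S)%:R * ext_sign A X * ext_coef f A.
  transitivity (\sum_X F X * ext_coef (ext_mul g h) X).
    rewrite big_mkcond /=; apply: eq_bigr => X _; rewrite /F.
    by case: eqP => _; rewrite ?mul0r // mul1r mulrA.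
  rewrite ext_sum_coef_mul; apply: eq_bigr => B _; apply: eq_bigr => C _.
  rewrite /F -!mulrA; congr (_ * (_ * _)).
  by rewrite mulrCA; congr (_ * _); rewrite !mulrA.
apply: esym; rewrite ext_coef_mul.
pose G X C := (X :|: C == S)%:R * ext_sign X C * ext_coef h C.
transitivity (\sum_C \sum_X G X C * ext_coef (ext_mul f g) X).
  rewrite exchange_big /=; apply: eq_bigr => X _.
  rewrite big_mkcond /=; apply: eq_bigr => C _; rewrite /G.
  case: eqP => _; rewrite ?mul0r // mul1r -!mulrA.
  by congr (_ * _); rewrite mulrC.
under eq_bigr => C _ do rewrite ext_sum_coef_mul.
rewrite exchange_big /=; apply: eq_bigr => A _.
rewrite exchange_big /=; apply: eq_bigr => B _; apply: eq_bigr => C _.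
rewrite /G setUA -ext_signA -!mulrA; congr (_ * _).
by rewrite (mulrC (ext_coef h C)) -!mulrA mulrCA.
Qed.

Lemma ext_mulDl : left_distributive ext_mul +%R.
Proof.
move=> f g h; apply: ext_coefP => S; rewrite ext_coefD !ext_coef_mul.
rewrite -big_split; apply: eq_bigr => A _ /=.
rewrite -big_split; apply: eq_bigr => B _ /=.
by rewrite ext_coefD mulrDl mulrDr.
Qed.

Lemma ext_mulDr : right_distributive ext_mul +%R.
Proof.
move=> f g h; apply: ext_coefP => S; rewrite ext_coefD !ext_coef_mul.
rewrite -big_split; apply: eq_bigr => A _ /=.
rewrite -big_split; apply: eq_bigr => B _ /=.
by rewrite ext_coefD !mulrDr.
Qed.

Lemma ext_scaleAl a f g : a *: ext_mul f g = ext_mul (a *: f) g.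
Proof.
apply: ext_coefP => S; rewrite ext_coefZ !ext_coef_mul mulr_sumr.
apply: eq_bigr => A _; rewrite mulr_sumr; apply: eq_bigr => B _.
by rewrite ext_coefZ mulrCA !mulrA.
Qed.

Lemma ext_scaleAr a f g : a *: ext_mul f g = ext_mul f (a *: g).
Proof.
apply: ext_coefP => S; rewrite ext_coefZ !ext_coef_mul mulr_sumr.
apply: eq_bigr => A _; rewrite mulr_sumr; apply: eq_bigr => B _.
by rewrite ext_coefZ mulrCA; congr (_ * _); rewrite mulrCA.
Qed.

Lemma ext_mul_monom A B :
  ext_mul (ext_monom A) (ext_monom B) = ext_sign A B *: ext_monom (A :|: B).
Proof.
apply: ext_coefP => S; rewrite ext_coefZ ext_coef_mul ext_coef_monom.
rewrite (bigD1 A) //= [X in _ + X]big1 ?addr0; last first.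
  move=> C /negPf CA; apply: big1 => D _.
  by rewrite ext_coef_monom CA mul0r mulr0.
rewrite big_mkcond (bigD1 B) //= [X in _ + X]big1 ?addr0; last first.
  move=> D /negPf DB; case: ifP => // _.
  by rewrite !ext_coef_monom DB mulr0 mulr0.
rewrite !ext_coef_monom !eqxx mulr1 eq_sym.
by case: eqP => _; rewrite ?mulr1 ?mulr0.
Qed.

Lemma ext_sign0l A : ext_sign set0 A = 1.
Proof. by rewrite /ext_sign -setI_eq0 set0I eqxx /ext_inv big_set0. Qed.

Lemma ext_sign0r A : ext_sign A set0 = 1.
Proof.
rewrite /ext_sign -setI_eq0 setI0 eqxx /ext_inv big1 // => i _.
exact: big_set0.
Qed.

Lemma ext_mul1r : left_id (ext_monom set0) ext_mul.
Proof.
move=> f; apply: ext_coefP => S; rewrite ext_coef_mul (bigD1 set0) //=.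
rewrite [X in _ + X]big1 ?addr0; last first.
  move=> C /negPf C0; apply: big1 => D _.
  by rewrite ext_coef_monom C0 mul0r mulr0.
rewrite (big_pred1 S) => [|B]; last by rewrite /= set0U.
by rewrite ext_coef_monom eqxx ext_sign0l !mul1r.
Qed.

Lemma ext_mulr1 : right_id (ext_monom set0) ext_mul.
Proof.
move=> f; apply: ext_coefP => S; rewrite ext_coef_mul (bigD1 S) //=.
rewrite [X in _ + X]big1 ?addr0; last first.
  move=> C /negPf CS; apply: big1 => D /eqP CD; rewrite ext_coef_monom.
  by case: eqP CD => [->|_ _]; rewrite ?mulr0 // setU0 => /eqP; rewrite CS.
rewrite big_mkcond (bigD1 set0) //= [X in _ + X]big1 ?addr0; last first.
  move=> D /negPf D0; case: ifP => // _.
  by rewrite ext_coef_monom D0 !mulr0.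
by rewrite setU0 eqxx ext_coef_monom eqxx ext_sign0r mul1r mulr1.
Qed.

Lemma ext_monom0_neq0 : ext_monom set0 != 0.
Proof.
apply/eqP => /ffunP /(_ set0) /eqP.
by rewrite !ffunE eqxx (negPf (oner_neq0 _)).
Qed.

HB.instance Definition _ :=
  GRing.Zmodule_isNzRing.Build (extalg K n)
    ext_mulA ext_mul1r ext_mulr1 ext_mulDl ext_mulDr ext_monom0_neq0.

HB.instance Definition _ :=
  GRing.Lmodule_isLalgebra.Build K (extalg K n) ext_scaleAl.

HB.instance Definition _ :=
  GRing.Lalgebra_isAlgebra.Build K (extalg K n) ext_scaleAr.

Lemma ext_gen_sqr i : ext_gen i * ext_gen i = 0.
Proof.
by rewrite [LHS]ext_mul_monom /ext_sign disjoints1 inE eqxx scale0r.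
Qed.

Lemma ext_gen_mul i j :
  (i < j)%N -> ext_gen i * ext_gen j = ext_monom [set i; j].
Proof.
move=> ij; rewrite [LHS]ext_mul_monom /ext_sign disjoints1 inE.
rewrite -val_eqE (ltn_eqF ij) /= /ext_inv !big_set1.
by rewrite ltnNge (ltnW ij) scale1r.
Qed.

Lemma ext_gen_mulN i j : ext_gen j * ext_gen i = - (ext_gen i * ext_gen j).
Proof.
have mulN (k l : 'I_n) : (k < l)%N ->
    ext_gen l * ext_gen k = - ext_monom [set k; l].
  move=> kl; rewrite [LHS]ext_mul_monom /ext_sign disjoints1 inE.
  rewrite -val_eqE (gtn_eqF kl) /= /ext_inv !big_set1.
  by rewrite kl expr1 scaleN1r setUC.
have [ij|ji|/val_inj ->] := ltngtP i j; last by rewrite ext_gen_sqr oppr0.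
  by rewrite mulN // ext_gen_mul.
by rewrite (mulN j i) // opprK ext_gen_mul.
Qed.

Definition ext_homog (s : nat) (f : extalg K n) : bool :=
  [forall A, (ext_coef f A != 0) ==> (#|A| == s)].

End ExteriorAlgebra.

Definition in_ideal (A : pzRingType) (G : seq A) (x : A) : Prop :=
  exists (N : nat) (l g r : 'I_N -> A),
    (forall k, g k \in G) /\ x = \sum_k l k * g k * r k.

(* The image of the subspace W in V / J has dimension d: the classes of the
   b i form a basis of it. *)
Definition quotient_dim (K : fieldType) (V : lmodType K) (W : pred V)
    (J : V -> Prop) (d : nat) : Prop :=
  exists2 b : 'I_d -> V, (forall i, W (b i)) &
    forall v, W v -> exists! c : 'rV[K]_d, J (v - \sum_i c ord0 i *: b i).

(* For an algebra A graded by the subspaces gr s, and homogeneous generators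
   G: the Hilbert series of A / (G) is \sum_s (h s) t^s. *)
Definition quotient_hilbert_series (K : fieldType) (A : algType K)
    (gr : nat -> pred A) (G : seq A) (h : nat -> nat) : Prop :=
  forall s, quotient_dim (gr s) (in_ideal G) (h s).

Definition alg_indep_rat (K : fieldType) (I : Type) (c : I -> K) : Prop :=
  forall (N : nat) (e : 'I_N -> I), injective e ->
  forall p : {mpoly rat[N]}, (map_mpoly ratr p).@[fun k => c (e k)] = 0 -> p = 0.

Definition generic_quadratic_pair (K : fieldType) (n : nat)
    (f g : extalg K n) : Prop :=
  [/\ ext_homog 2 f, ext_homog 2 g &
    alg_indep_rat (fun k : bool * {A : {set 'I_n} | #|A| == 2} =>
      ext_coef (if k.1 then f else g) (val k.2))].

Definition generic_linear_pair (K : fieldType) (n : nat)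
    (l1 l2 : {mpoly K[n]}) : Prop :=
  [/\ l1 \is 1.-homog, l2 \is 1.-homog &
    alg_indep_rat (fun k : bool * 'I_n => (if k.1 then l1 else l2)@_U_(k.2))].

(* Every move raises the ordinate by one, so a path from (0, 0) to (w, h) is
   given by its abscissas at the heights 0, ..., h; it stays in the rectangle
   when they all lie in {0, ..., w}. *)
Definition lattice_path (w h : nat) (p : {ffun 'I_h.+1 -> 'I_w.+1}) : bool :=
  [&& p ord0 == ord0, p ord_max == ord_max &
    [forall y : 'I_h,
      let x := p (widen_ord (leqnSn h) y) : nat in
      let x' := p (lift ord0 y) : nat in
      (x' == x.+1) || (x == x'.+1)]].

Definition path_number (n s : nat) : nat :=
  if (s.*2 <= n.+2)%N then #|@lattice_path (n.+2 - s.*2) n.+2| else 0%N.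

(* Main.v *)
From HB Require Import structures.
Require Import Defs.
From mathcomp Require Import all_boot all_order all_algebra.
From mathcomp Require classical_sets.
From mathcomp Require Import boolp reals.
From mathcomp.real_closed Require Import complex.
From mathcomp Require Import mpoly zify ring lra.

(** Both Hilbert series are computed from the numbers h_k(d) = [generic_dim k d],
   the dimension of the degree d part of A_k / (two generic linear forms), where
   A_k = C[y_1, ..., y_k] / (y_1^2, ..., y_k^2).

   Generic values are minimal values.  A graded piece of a quotient is dual to
   the space of functionals on the piece that vanish on the ideal
   ([quotient_dim_dual]); these are the solutions of a linear system whose matrix
   is polynomial, over Q, in the coefficients of the generators.  A minor that is
   nonzero at some point is a nonzero polynomial, hence is nonzero at generic
   points, so a generic point minimizes the dimension ([generic_sol_space_le]).
   In particular all generic pairs give the same series.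

   Squares of linear forms.  In A_(n+2), two generic linear forms can be combined
   into y_(n+1) - l1 and y_(n+2) - l2; eliminating the last two variables turns
   their squares into l1^2 and l2^2.  So the degree s part of
   S_n / (x_1^2, ..., x_n^2, l1^2, l2^2) has dimension h_(n+2)(s)
   ([dim_sqfree_graph], [dim_square_dual], [quotient_dim_sqfree]).

   Quadratic forms in E_n, n = 2m.  Suppose first that the forms are combinations
   of the products y_i = x_(2i) x_(2i+1) (block form).  These products commute and
   have square zero, and they kill x_(2i) and x_(2i+1); so E_n splits according to
   the set of generators that occur without their partner.  For each of the
   C(m, j) 2^j such sets with j elements there remains A_(m-j) modulo two linear
   forms, with degrees doubled and shifted by j, and the degree s part of the
   quotient has dimension
     sum_j C(m, j) 2^j h_(m-j)((s - j)/2)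
   ([dim_ext_dual_block]; terms with s - j odd or negative are zero).  By
   minimality this bounds the dimension for a generic pair from above.  It is also
   a lower bound, because a generic pair is equivalent to a pair in block form:
   the pencil of the two alternating matrices has m distinct eigenvalues, this
   being the nonvanishing of a nonzero polynomial ([hankel_eigenvalues],
   [pencil_disc_block]), and every eigenspace contains a plane, as a singular
   alternating matrix of even size has corank at least two ([skew_even_corank]);
   these m planes are orthogonal for both forms ([skew_pair_block]).

   Lattice paths.  The numbers a(k - 2, d) = [walk_dim k d] satisfy the same
   relation: a(2m, s) = sum_j C(m, j) 2^j a(m - j - 2, (s - j)/2), by reading a
   walk of length 2m + 2 two steps at a time ([walk_dim_double]).

   Conclusion.  Statement (ii) says that h_k = a(k - 2, .) for k > 2, which is
   elementary for k <= 2, and statement (i) says that the binomial sums of the two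
   families agree.  As h_m enters the sum for m with coefficient one, the two are
   equivalent by induction ([binomial_dim_inj]).  Passing from (i) or (ii) to the
   numbers h_k needs at least one generic pair; it exists because C, being
   uncountable, is not algebraic over a finitely generated extension of Q
   ([complex_exists_alg_indep]). *)

Set Implicit Arguments.
Unset Strict Implicit.
Unset Printing Implicit Defensive.

Import Order.TTheory GRing.Theory Num.Theory.
Local Open Scope ring_scope.

(** * Solution spaces of linear systems *)

Section SolutionSpaces.
Variable K : fieldType.

Lemma dim_le_inj (V V' : vectType K) (U : {vspace V}) (U' : {vspace V'})
    (f : {linear V -> V'}) :
  (forall u, u \in U -> f u \in U') -> (forall u, u \in U -> f u = 0 -> u = 0) ->
  (\dim U <= \dim U')%N.
Proof.
move=> fU f0; have <- : \dim (linfun f @: U) = \dim U.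
  apply: limg_dim_eq; apply/eqP; rewrite -subv0; apply/subvP=> u.
  by rewrite memv_cap memv_ker lfunE /= memv0 => /andP[uU /eqP/(f0 _ uU)->].
apply: dimvS; apply/subvP=> _ /memv_imgP[u uU ->]; rewrite lfunE; exact: fU.
Qed.

Section SolutionSpace.
Variables (Q T : finType) (P : pred T) (M : Q -> T -> K).

(** The support condition is encoded as further equations, so that the solutions
   form the kernel of a single linear map. *)
Definition sol_eqns (phi : {ffun T -> K^o}) : {ffun T + Q -> K^o} :=
  [ffun x => match x with
             | inl t => (~~ P t)%:R * phi t
             | inr q => \sum_t M q t * phi t
             end].

Lemma sol_eqns_linear : linear sol_eqns.
Proof.
move=> a u v; apply/ffunP=> -[t|q]; rewrite !ffunE /=.
  by rewrite mulrDr; congr (_ + _); exact: mulrCA.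
rewrite scaler_sumr -big_split /=; apply: eq_bigr => t _.
by rewrite !ffunE mulrDr; congr (_ + _); exact: mulrCA.
Qed.
HB.instance Definition _ :=
  GRing.isLinear.Build K {ffun T -> K^o} {ffun T + Q -> K^o} _ sol_eqns
    sol_eqns_linear.

Definition sol_space : {vspace {ffun T -> K^o}} := lker (linfun sol_eqns).

Lemma sol_spaceP (phi : {ffun T -> K^o}) :
  reflect ((forall t, ~~ P t -> phi t = 0) /\
           (forall q, \sum_t M q t * phi t = 0)) (phi \in sol_space).
Proof.
rewrite memv_ker lfunE /=; apply: (iffP eqP) => [/ffunP E | [Ps Ms]].
  split=> [t Pt|q]; last by have := E (inr q); rewrite !ffunE.
  by have := E (inl t); rewrite !ffunE Pt mul1r.
apply/ffunP=> -[t|q]; rewrite !ffunE //.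
by case: (boolP (P t)) => [_|/Ps->]; rewrite ?mul0r ?mulr0.
Qed.
End SolutionSpace.

Lemma eq_sol_space (Q T : finType) (P : pred T) (M M' : Q -> T -> K) :
  (forall q t, M q t = M' q t) -> sol_space P M = sol_space P M'.
Proof.
move=> MM'; apply/vspaceP=> phi; apply/sol_spaceP/sol_spaceP => -[sup sol]; split=> // q;
  by rewrite -[RHS](sol q); apply: eq_bigr => t _; rewrite MM'.
Qed.

Lemma dim_sol_space_empty (Q T : finType) (P : pred T) (M : Q -> T -> K) :
  (forall t, ~~ P t) -> \dim (sol_space P M) = 0%N.
Proof.
move=> P0; apply/eqP; rewrite dimv_eq0 -subv0; apply/subvP=> phi /sol_spaceP[sup _].
by rewrite memv0; apply/eqP/ffunP=> t; rewrite sup ?ffunE.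
Qed.

(** When no equation involves unknowns with different labels, a solution may be
   cut into its restrictions to the label classes, which are again solutions. *)
Lemma dim_sol_space_fibers (Q T X : finType) (P : pred T) (M : Q -> T -> K)
    (lab : T -> X) (labq : Q -> X) :
  (forall q t, M q t != 0 -> lab t = labq q) ->
  (\dim (sol_space P M) = \sum_x \dim (sol_space [pred t | P t && (lab t == x)] M))%N.
Proof.
move=> labM; pose U x := sol_space [pred t | P t && (lab t == x)] M.
have supU x phi t : phi \in U x -> lab t != x -> phi t = 0.
  by move=> /sol_spaceP[+ _] /negPf tx; apply; rewrite inE tx andbF.
have dU : directv (\sum_x U x).
  apply/directv_sum_independent => us Uus us0 x _; apply/ffunP=> t.
  have [tx|tx] := eqVneq (lab t) x; last by rewrite (supU x) ?Uus ?ffunE.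
  have /ffunP/(_ t) := us0; rewrite sum_ffunE (bigD1 x) //= big1 ?addr0 //.
  by move=> y yx; rewrite (supU y) ?Uus // tx eq_sym.
suff -> : sol_space P M = (\sum_x U x)%VS by exact/eqP.
apply/eqP; rewrite eqEsubv; apply/andP; split; apply/subvP=> phi; last first.
  case/memv_sumP=> us Uus ->; apply: memv_suml => x _.
  have /sol_spaceP[sup sol] := Uus x isT; apply/sol_spaceP; split=> // t Pt.
  by apply: sup; rewrite inE (negPf Pt).
case/sol_spaceP=> sup sol.
pose part x : {ffun T -> K^o} := [ffun t => (lab t == x)%:R * phi t].
have -> : phi = \sum_x part x.
  apply/ffunP=> t; rewrite sum_ffunE (bigD1 (lab t)) //= ffunE eqxx mul1r.
  by rewrite big1 ?addr0 // => x tx; rewrite ffunE eq_sym (negPf tx) mul0r.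
apply: memv_sumr => x _; apply/sol_spaceP; split=> [t|q].
  rewrite inE negb_and ffunE => /orP[/sup->|/negPf->]; first exact: mulr0.
  by rewrite mul0r.
have [qx|qx] := eqVneq (labq q) x.
  rewrite -[RHS](sol q); apply: eq_bigr => t _; rewrite ffunE.
  have [->|/labM tq] := eqVneq (M q t) 0; first by rewrite !mul0r.
  by rewrite tq qx eqxx mul1r.
apply: big1 => t _; rewrite ffunE.
have [->|/labM tq] := eqVneq (M q t) 0; first by rewrite !mul0r.
by rewrite tq (negPf qx) mul0r mulr0.
Qed.

Lemma sum_supp_reindex (T T' : finType) (P : pred T) (P' : pred T')
    (h : T' -> T) (h' : T -> T') (F : T -> K) :
  (forall t', P' t' -> P (h t') /\ h' (h t') = t') ->
  (forall t, P t -> P' (h' t) /\ h (h' t) = t) ->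
  (forall t, ~~ P t -> F t = 0) ->
  \sum_t F t = \sum_(t' | P' t') F (h t').
Proof.
move=> Ph Ph' F0; rewrite (bigID P) /= [X in _ + X]big1 ?addr0 //.
rewrite (reindex_onto h h') => [|t /Ph'[]//]; apply: eq_bigl => t'.
apply/andP/idP => [[/Ph'[+ _] /eqP hh]|/Ph[-> ->]//].
by rewrite hh.
Qed.

(** Transport along a bijection of the supports; an equation of the target
   system has to be either trivial on the support or an equation of the source. *)
Lemma dim_sol_space_reindex_le (Q Q' T T' : finType) (P : pred T) (P' : pred T')
    (M : Q -> T -> K) (M' : Q' -> T' -> K) (h : T' -> T) (h' : T -> T') :
  (forall t', P' t' -> P (h t') /\ h' (h t') = t') ->
  (forall t, P t -> P' (h' t) /\ h (h' t) = t) ->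
  (forall q', (forall t', P' t' -> M' q' t' = 0) \/
     exists q, forall t', P' t' -> M' q' t' = M q (h t')) ->
  (\dim (sol_space P M) <= \dim (sol_space P' M'))%N.
Proof.
move=> Ph Ph' MM.
pose f (phi : {ffun T -> K^o}) : {ffun T' -> K^o} :=
  [ffun t' => (P' t')%:R * phi (h t')].
have f_lin : linear f.
  move=> a u v; apply/ffunP=> t'; rewrite !ffunE mulrDr.
  by congr (_ + _); exact: mulrCA.
pose fL := HB.pack f (GRing.isLinear.Build K _ _ _ f f_lin)
  : {linear {ffun T -> K^o} -> {ffun T' -> K^o}}.
apply: (dim_le_inj (f := fL)) => phi /sol_spaceP[sup sol] /=.
  apply/sol_spaceP; split=> [t' /negPf Pt'|q']; first by rewrite ffunE Pt' mul0r.
  have [M0|[q Mq]] := MM q'.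
    apply: big1 => t' _; rewrite ffunE.
    by case: (boolP (P' t')) => [/M0->|_]; rewrite !(mul0r, mulr0).
  rewrite -[RHS](sol q) (sum_supp_reindex Ph Ph'); last first.
    by move=> t /sup ->; rewrite mulr0.
  rewrite (bigID P') /= [X in _ + X]big1 ?addr0 => [|t' /negPf Pt']; last first.
    by rewrite ffunE Pt' mul0r mulr0.
  by apply: eq_bigr => t' Pt'; rewrite ffunE Pt' mul1r Mq.
move=> /ffunP f0; apply/ffunP=> t; rewrite ffunE.
have [Pt|/sup//] := boolP (P t); have [Pt' ht] := Ph' t Pt.
by have := f0 (h' t); rewrite !ffunE Pt' mul1r ht.
Qed.

Lemma dim_sol_space_reindex (Q Q' T T' : finType) (P : pred T) (P' : pred T')
    (M : Q -> T -> K) (M' : Q' -> T' -> K) (h : T' -> T) (h' : T -> T') :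
  (forall t', P' t' -> P (h t') /\ h' (h t') = t') ->
  (forall t, P t -> P' (h' t) /\ h (h' t) = t) ->
  (forall q, (forall t', P' t' -> M q (h t') = 0) \/
     exists q', forall t', P' t' -> M q (h t') = M' q' t') ->
  (forall q', (forall t', P' t' -> M' q' t' = 0) \/
     exists q, forall t', P' t' -> M' q' t' = M q (h t')) ->
  \dim (sol_space P M) = \dim (sol_space P' M').
Proof.
move=> Ph Ph' MM MM'; apply/eqP; rewrite eqn_leq; apply/andP; split.
  exact: dim_sol_space_reindex_le Ph Ph' MM'.
apply: (dim_sol_space_reindex_le Ph' Ph) => q.
have [M0|[q' Mq]] := MM q; [left | right; exists q'] => t /Ph'[Pt' ht].
  by rewrite -{1}ht M0.
by rewrite -{1}ht Mq.
Qed.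

(** Semicontinuity is a statement about minors, hence about the rank of a matrix. *)
Lemma dim_sol_space_rank (Q T : finType) (P : pred T) (M : Q -> T -> K) :
  \dim (sol_space P M) = (#|T| - \rank (\matrix_(t < #|T|, x < #|{: T + Q}|)
     match enum_val x with
     | inl t' => (~~ P t' && (enum_val t == t'))%:R
     | inr q => M q (enum_val t)
     end))%N.
Proof.
set A := \matrix_(t, x) _; rewrite -mxrank_ker.
have solA (v : 'rV[K]_#|T|) (phi : {ffun T -> K^o}) :
    (forall t, phi t = v ord0 (enum_rank t)) -> phi \in sol_space P M <-> v *m A = 0.
  move=> phiE; split=> [/sol_spaceP[sup sol]|vA].
    apply/rowP=> x; rewrite !mxE; under eq_bigr => t _ do rewrite mxE.
    case: (enum_val x) => [t'|q].
      rewrite (bigD1 (enum_rank t')) //= enum_rankK eqxx andbT big1 ?addr0.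
        by rewrite -phiE; case: (boolP (P t')) => [_|/sup->]; rewrite ?mul0r ?mulr0.
      move=> i it; case: eqP => [E|_]; last by rewrite andbF mulr0.
      by move: it; rewrite -E enum_valK eqxx.
    rewrite -[RHS](sol q) (reindex enum_rank) /=; last exact/onW_bij/enum_rank_bij.
    by apply: eq_bigr => t _; rewrite phiE enum_rankK mulrC.
  have vA0 x : \sum_t v ord0 (enum_rank t) * A (enum_rank t) (enum_rank x) = 0.
    have /rowP/(_ (enum_rank x)) := vA; rewrite mxE [RHS]mxE => E; rewrite -[RHS]E.
    rewrite [RHS](reindex enum_rank) //=; exact/onW_bij/enum_rank_bij.
  apply/sol_spaceP; split=> [t Pt|q].
    have := vA0 (inl t); rewrite (bigD1 t) //= big1 ?addr0 => [|t' t't].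
      by rewrite mxE !enum_rankK Pt eqxx mulr1 -phiE.
    by rewrite mxE !enum_rankK (negPf t't) andbF mulr0.
  rewrite -[RHS](vA0 (inr q)); apply: eq_bigr => t _.
  by rewrite mxE !enum_rankK phiE mulrC.
set B := row_base (kermx A).
apply/eqP; rewrite eqn_leq; apply/andP; split.
  pose f (phi : {ffun T -> K^o}) : 'rV_(\rank (kermx A)) :=
    \row_t phi (enum_val t) *m pinvmx B.
  have f_lin : linear f.
    move=> a u v; rewrite /f scalemxAl -mulmxDl; congr (_ *m _).
    by apply/rowP=> i; rewrite !mxE !ffunE.
  pose fL := HB.pack f (GRing.isLinear.Build K _ _ _ f f_lin)
    : {linear {ffun T -> K^o} -> 'rV_(\rank (kermx A))}.
  have -> : \rank (kermx A) = \dim {:'rV[K]_(\rank (kermx A))}.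
    by rewrite dimvf; exact/esym/mul1n.
  apply: (dim_le_inj (f := fL)) => phi phiS; first exact: memvf.
  pose v : 'rV[K]_#|T| := \row_t phi (enum_val t).
  have phiE t : phi t = v ord0 (enum_rank t) by rewrite mxE enum_rankK.
  have /sub_kermxP vA := (solA v phi phiE).1 phiS.
  move=> f0; have {}f0 : v *m pinvmx B = 0 := f0.
  have vB : (v <= B)%MS by rewrite /B eq_row_base; exact: vA.
  have v0 : v = 0 by rewrite -(mulmxKpV vB) f0 mul0mx.
  by apply/ffunP=> t; rewrite phiE v0 !mxE ffunE.
pose f (v : 'rV_(\rank (kermx A))) : {ffun T -> K^o} :=
  [ffun t => (v *m B) ord0 (enum_rank t)].
have f_lin : linear f.
  by move=> a u v; apply/ffunP=> t; rewrite !ffunE mulmxDl -scalemxAl !mxE.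
pose fL := HB.pack f (GRing.isLinear.Build K _ _ _ f f_lin)
  : {linear 'rV_(\rank (kermx A)) -> {ffun T -> K^o}}.
have {1}-> : \rank (kermx A) = \dim {:'rV[K]_(\rank (kermx A))}.
  by rewrite dimvf; exact/esym/mul1n.
apply: (dim_le_inj (f := fL)) => v _ /=.
  apply/(solA (v *m B)) => [t|]; first by rewrite ffunE.
  apply/sub_kermxP; rewrite -(eq_row_base (kermx A)); exact: submxMl.
move=> /ffunP f0; apply: (row_free_inj (row_base_free (kermx A))).
rewrite mul0mx; apply/rowP=> i; rewrite [RHS]mxE; have := f0 (enum_val i).
by rewrite !ffunE enum_valK.
Qed.

(** The double annihilator: whatever all solutions kill is a combination of the
   equations, up to values outside of the support. *)
Lemma sol_space_annihilator (Q T : finType) (P : pred T) (M : Q -> T -> K) (x : T -> K) :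
  (forall phi, phi \in sol_space P M -> \sum_t x t * phi t = 0) ->
  exists y : Q -> K, forall t, P t -> x t = \sum_q y q * M q t.
Proof.
move=> x0; pose M' : 'M[K]_(#|Q|, #|T|) := \matrix_(q, t)
  ((P (enum_val t))%:R * M (enum_val q) (enum_val t)).
pose x' : 'rV[K]_#|T| := \row_t ((P (enum_val t))%:R * x (enum_val t)).
have /submxP[y yM] : (x' <= M')%MS.
  rewrite submxE; apply/eqP/rowP=> j; rewrite [RHS]mxE.
  pose phi : {ffun T -> K^o} := [ffun t => (P t)%:R * cokermx M' (enum_rank t) j].
  have sum_rank (F : 'I_#|T| -> K) : \sum_i F i = \sum_t F (enum_rank t).
    by rewrite (reindex enum_rank) //=; exact/onW_bij/enum_rank_bij.
  rewrite mxE sum_rank -[RHS](x0 phi).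
    by apply: eq_bigr => t _; rewrite mxE enum_rankK ffunE mulrCA mulrA.
  apply/sol_spaceP; split=> [t /negPf Pt|q]; first by rewrite ffunE Pt mul0r.
  have /matrixP/(_ (enum_rank q) j) := mulmx_coker M'; rewrite mxE [RHS]mxE sum_rank => E.
  rewrite -[RHS]E; apply: eq_bigr => t _.
  by rewrite ffunE [M' _ _]mxE !enum_rankK mulrCA mulrA.
exists (fun q => y ord0 (enum_rank q)) => t Pt.
have /rowP/(_ (enum_rank t)) := yM; rewrite mxE enum_rankK Pt mul1r => ->.
rewrite mxE (reindex enum_rank) /=; last exact/onW_bij/enum_rank_bij.
by apply: eq_bigr => q _; rewrite mxE !enum_rankK Pt mul1r.
Qed.

End SolutionSpaces.

(** * Generic points *)

Section Genericity.
Variable K : numFieldType.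

Section Eval.
Variable I : finType.

(** Polynomial functions over Q of a family of scalars, with one variable for each
   index. *)
Definition rat_eval (c : I -> K) (p : {mpoly rat[#|I|]}) : K :=
  (map_mpoly ratr p).@[fun k => c (enum_val k)].

HB.instance Definition _ c := GRing.RMorphism.copy (rat_eval c)
  (meval (fun k => c (enum_val k)) \o map_mpoly (@ratr K)).

Lemma rat_evalX c i : rat_eval c 'X_(enum_rank i) = c i.
Proof. by rewrite /rat_eval map_mpolyX mevalXU enum_rankK. Qed.

Lemma rat_evalC c a : rat_eval c a%:MP = ratr a.
Proof. by rewrite /rat_eval map_mpolyC mevalC. Qed.

Lemma generic_neq0 (c c' : I -> K) p :
  alg_indep_rat c -> rat_eval c' p != 0 -> rat_eval c p != 0.
Proof.
move=> indep; apply: contra => /eqP/(indep _ _ enum_val_inj) ->.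
by rewrite rmorph0.
Qed.

(** A maximal nonzero minor at c' is a nonzero polynomial, so the same minor is
   nonzero at the generic point c. *)
Lemma generic_rank_ge (c c' : I -> K) m n (A : 'M[{mpoly rat[#|I|]}]_(m, n)) :
  alg_indep_rat c ->
  (\rank (map_mx (rat_eval c') A) <= \rank (map_mx (rat_eval c) A))%N.
Proof.
move=> indep; set A' := map_mx _ A; set r := \rank A'.
pose f := maxrankfun A'; pose B := rowsub f A'.
have rB : \rank B^T = r by rewrite mxrank_tr; exact/eqP/maxrowsub_free.
have fullB : row_full B^T by rewrite /row_full rB.
pose g := fullrankfun fullB.
have det_sub d : \det (rowsub g (rowsub f (map_mx (rat_eval d) A))^T) =
    rat_eval d (\det (rowsub g (rowsub f A)^T)).
  by rewrite -det_map_mx; congr (\det _); apply/matrixP=> i j; rewrite !mxE.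
have : rat_eval c (\det (rowsub g (rowsub f A)^T)) != 0.
  apply: (generic_neq0 (c' := c') indep); rewrite -det_sub -unitfE.
  by have := fullrowsub_unit fullB; rewrite unitmxE.
rewrite -det_sub -unitfE -unitmxE => /mxrank_unit rk.
rewrite -[r in (r <= _)%N]rk (leq_trans (mxrankS (rowsub_sub _ _))) //.
by rewrite mxrank_tr mxrankS // rowsub_sub.
Qed.

(** Solution spaces are smallest at generic points. *)
Lemma generic_sol_space_le (c c' : I -> K) (Q T : finType) (P : pred T)
    (M : Q -> T -> {mpoly rat[#|I|]}) :
  alg_indep_rat c ->
  (\dim (sol_space P (fun q t => rat_eval c (M q t))) <=
   \dim (sol_space P (fun q t => rat_eval c' (M q t))))%N.
Proof.
move=> indep; rewrite !dim_sol_space_rank leq_sub2l //.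
pose A : 'M[{mpoly rat[#|I|]}]_(_, _) := \matrix_(t < #|T|, x < #|{: T + Q}|)
     match enum_val x with
     | inl t' => (~~ P t' && (enum_val t == t'))%:R
     | inr q => M q (enum_val t)
     end.
have E d : \matrix_(t < #|T|, x < #|{: T + Q}|)
     match enum_val x with
     | inl t' => (~~ P t' && (enum_val t == t'))%:R
     | inr q => rat_eval d (M q (enum_val t))
     end = map_mx (rat_eval d) A.
  by apply/matrixP=> t x; rewrite !mxE; case: enum_val => // t'; rewrite rmorph_nat.
by rewrite !E generic_rank_ge.
Qed.

Lemma generic_affine_sol_space_le (c c' : I -> K) (Q T : finType) (P : pred T)
    (u : Q -> T -> rat) (w : Q -> T -> I -> rat) :
  let M d q t := ratr (u q t) + \sum_i ratr (w q t i) * d i : K in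
  alg_indep_rat c ->
  (\dim (sol_space P (M c)) <= \dim (sol_space P (M c')))%N.
Proof.
move=> M indep; pose Mp q t : {mpoly rat[#|I|]} :=
  (u q t)%:MP + \sum_i (w q t i)%:MP * 'X_(enum_rank i).
have E d : sol_space P (M d) = sol_space P (fun q t => rat_eval d (Mp q t)).
  apply/vspaceP=> phi; apply/sol_spaceP/sol_spaceP => -[sup sol];
    split=> // q; rewrite -[RHS](sol q); apply: eq_bigr => t _; congr (_ * _);
    rewrite rmorphD rmorph_sum /= rat_evalC; congr (_ + _); apply: eq_bigr => i _;
    by rewrite rmorphM /= rat_evalC rat_evalX.
rewrite !E; exact: generic_sol_space_le.
Qed.

End Eval.

Lemma alg_indep_comp (I J : Type) (c : I -> K) (h : J -> I) :
  injective h -> alg_indep_rat c -> alg_indep_rat (c \o h).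
Proof.
by move=> h_inj indep N e e_inj p; apply: (indep _ (h \o e)); exact: inj_comp.
Qed.

Lemma eq_alg_indep (I : Type) (c d : I -> K) :
  c =1 d -> alg_indep_rat c -> alg_indep_rat d.
Proof.
move=> cd indep N e e_inj p pd; apply: (indep _ e e_inj).
by rewrite -[RHS]pd; apply: meval_eq => k; rewrite cd.
Qed.

End Genericity.

(** * Dimensions of graded pieces of a quotient *)

Section QuotientDim.
Variables (K : fieldType) (V : lmodType K) (W : pred V) (J : V -> Prop).

(** Functionals on W that vanish on J and detect membership in J form the dual of
   W / J; a basis of the quotient is dual to a basis of the solution space. *)
Lemma quotient_dim_dual (Q T : finType) (P : pred T) (M : Q -> T -> K)
    (e : T -> V) (c : T -> {linear V -> K^o}) :
  (forall a u v, W u -> W v -> W (a *: u + v)) -> W 0 ->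
  (forall t, P t -> W (e t)) ->
  (forall t t', P t' -> c t (e t') = (t == t')%:R) ->
  (forall v, W v -> J v <->
     forall phi, phi \in sol_space P M -> \sum_t c t v * phi t = 0) ->
  quotient_dim W J (\dim (sol_space P M)).
Proof.
move=> Wlin W0 We ce JE; set U := sol_space P M; set d := \dim U.
pose X := vbasis U.
pose pair (v : V) : 'rV[K]_d := \row_j \sum_t c t v * (X`_j : {ffun T -> K^o}) t.
have pair_lin a u v : pair (a *: u + v) = a *: pair u + pair v.
  apply/rowP=> j; rewrite !mxE mulr_sumr -big_split /=; apply: eq_bigr => t _.
  by rewrite linearP mulrDl -mulrA.
have JE' v : W v -> J v <-> pair v = 0.
  move=> Wv; rewrite JE //; split=> [v0|/rowP v0 phi phiU].
    apply/rowP=> j; rewrite !mxE; apply: v0; apply: vbasis_mem.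
    by rewrite mem_nth // size_tuple.
  rewrite (coord_vbasis phiU) /=.
  under eq_bigr => t _ do rewrite sum_ffunE mulr_sumr.
  rewrite exchange_big big1 //= => j _; have := v0 j; rewrite !mxE => E.
  under eq_bigr => t _ do rewrite ffunE mulrCA.
  by rewrite -mulr_sumr E mulr0.
pose Phi : 'M[K]_(#|T|, d) := \matrix_(t, j) (X`_j : {ffun T -> K^o}) (enum_val t).
have Phi_full : row_full Phi.
  rewrite -col_leq_rank -mxrank_tr [(d <= _)%N]row_leq_rank.
  rewrite -kermx_eq0; apply/eqP/row_matrixP => i; rewrite row0.
  set y := row i _; have yPhi : y *m Phi^T = 0.
    by apply/sub_kermxP; exact: row_sub.
  have y0 : \sum_j y ord0 j *: X`_j = 0 :> {ffun T -> K^o}.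
    apply/ffunP=> t; rewrite sum_ffunE ffunE.
    have /rowP/(_ (enum_rank t)) := yPhi; rewrite mxE [RHS]mxE => E.
    rewrite -[RHS]E; apply: eq_bigr => j _; by rewrite ffunE [Phi^T _ _]mxE [Phi _ _]mxE enum_rankK.
  apply/rowP=> j; rewrite [RHS]mxE.
  have /freeP fr : free X := basis_free (vbasisP U).
  exact: fr (y ord0) y0 j.
have /row_fullP[B BPhi] := Phi_full.
pose b (j : 'I_d) : V := \sum_(t | P t) B j (enum_rank t) *: e t.
have Wsum (S : finType) (R : pred S) (F : S -> V) (a : S -> K) :
    (forall s, R s -> W (F s)) -> W (\sum_(s | R s) a s *: F s).
  move=> WF; elim/big_ind: _ => // [x y Wx Wy|s Rs].
    by rewrite -[x]scale1r; exact: Wlin.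
  by rewrite -[_ *: _]addr0; apply: Wlin => //; exact: WF.
have Wb j : W (b j) by exact: Wsum.
pose pairL := HB.pack pair (GRing.isLinear.Build K V 'rV[K]_d _ pair pair_lin)
  : {linear V -> 'rV[K]_d}.
have pair_b j : pair (b j) = delta_mx ord0 j.
  have -> : pair (b j) = \sum_(t | P t) B j (enum_rank t) *: pair (e t).
    by rewrite -[pair]/(pairL : V -> 'rV_d) linear_sum; apply: eq_bigr => t _;
      rewrite linearZ.
  have <- : row j (B *m Phi) = delta_mx ord0 j by rewrite BPhi row1.
  apply/rowP=> k; rewrite summxE !mxE.
  rewrite [RHS](reindex enum_rank) /=; last exact/onW_bij/enum_rank_bij.
  rewrite [RHS](bigID P) /= [X in _ + X]big1 ?addr0 => [|t Pt]; last first.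
    rewrite !mxE enum_rankK; have /sol_spaceP[sup _] : X`_k \in U.
      by apply: vbasis_mem; rewrite mem_nth // size_tuple.
    by rewrite sup // mulr0.
  apply: eq_bigr => t Pt; rewrite !mxE enum_rankK (bigD1 t) //= ce // eqxx mul1r.
  by rewrite big1 ?addr0 // => t' /negPf t't; rewrite ce // t't mul0r.
exists b => // v Wv.
have pair_diff (a : 'rV[K]_d) : pair (v - \sum_i a ord0 i *: b i) = pair v - a.
  rewrite -[pair]/(pairL : V -> 'rV_d) linearB linear_sum; congr (_ - _).
  rewrite [RHS]row_sum_delta; apply: eq_bigr => j _; rewrite linearZ /=.
  by rewrite pair_b.
have Wdiff (a : 'rV[K]_d) : W (v - \sum_i a ord0 i *: b i).
  by rewrite addrC -scaleN1r; apply: Wlin => //; exact: Wsum.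
exists (pair v); split=> [|a].
  by apply/JE'; rewrite // pair_diff subrr.
by move=> /(JE' _ (Wdiff a)); rewrite pair_diff => /subr0_eq.
Qed.

(** Two bases of one quotient are related by a matrix with independent rows. *)
Lemma quotient_dim_unique d d' :
  W 0 -> (forall a u v, J u -> J v -> J (a *: u + v)) -> J 0 ->
  quotient_dim W J d -> quotient_dim W J d' -> d = d'.
Proof.
move=> W0 Jlin J0.
suff le e e' : quotient_dim W J e -> quotient_dim W J e' -> (e <= e')%N.
  by move=> qd qd'; apply/eqP; rewrite eqn_leq !le.
move=> [b Wb bP] [b' Wb' bP'].
have Jsum (S : finType) (F : S -> V) (a : S -> K) :
    (forall s, J (F s)) -> J (\sum_s a s *: F s).
  move=> JF; elim/big_ind: _ => // [x y Jx Jy|s _].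
    by rewrite -[x]scale1r; exact: Jlin.
  by rewrite -[_ *: _]addr0; exact: Jlin.
have [C CP] : exists C : 'M[K]_(e, e'), forall i,
    J (b i - \sum_j C i j *: b' j).
  have /fin_all_exists[C CP] i : exists c : 'rV[K]_e',
      J (b i - \sum_j c ord0 j *: b' j) by have [c []] := bP' _ (Wb i); exists c.
  exists (\matrix_i C i) => i; have := CP i.
  by under eq_bigr => j _ do rewrite -[C i ord0 j](mxE matrix_key (fun i j => C i ord0 j)).
suff : row_free C by rewrite -row_leq_rank => /leq_trans; apply; exact: rank_leq_col.
rewrite -kermx_eq0; apply/eqP/row_matrixP => i; rewrite row0.
set y := row i _; have yC : y *m C = 0 by apply/sub_kermxP; exact: row_sub.
have Jy : J (\sum_i y ord0 i *: b i).
  have := Jsum _ (fun i => b i - \sum_j C i j *: b' j) (fun i => y ord0 i) CP.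
  under eq_bigr => k _ do rewrite scalerBr.
  rewrite sumrB [X in _ - X](_ : _ = 0) ?subr0 //.
  under eq_bigr => k _ do rewrite scaler_sumr.
  rewrite exchange_big big1 //= => j _.
  under eq_bigr => k _ do rewrite scalerA.
  rewrite -scaler_suml; have /rowP/(_ j) := yC; rewrite mxE [RHS]mxE => ->.
  exact: scale0r.
have [c [_ cP]] := bP 0 W0.
have c0 : c = 0 by apply: cP; rewrite sub0r big1 ?oppr0 // => k _; rewrite mxE scale0r.
have : c = - y.
  apply: cP; rewrite sub0r -sumrN.
  by under eq_bigr => k _ do rewrite mxE scaleNr opprK.
by rewrite c0 => /eqP; rewrite eq_sym oppr_eq0 => /eqP.
Qed.
End QuotientDim.

(** * Algebraically independent complex numbers *)

(** Nested intervals, the n-th of which leaves out f n. *)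
Lemma real_uncountable (R : realType) (f : nat -> R) : exists x, forall n, f n <> x.
Proof.
(* If f n is left of the middle m keep the right half, otherwise a part that lies
   strictly left of m. *)
pose step n (I : R * R) : R * R :=
  let m := (I.1 + I.2) / 2 in
  if f n < m then (m, I.2) else (I.1, I.1 + (I.2 - I.1) / 3).
pose I := fix I n := if n is n'.+1 then step n' (I n') else (0, 1).
have I_lt n : (I n).1 < (I n).2.
  elim: n => [|n IHn] /=; first exact: ltr01.
  by rewrite /step; case: ifP => _ /=; lra.
have I_step n : (I n).1 <= (I n.+1).1 /\ (I n.+1).2 <= (I n).2.
  by have := I_lt n; rewrite /= /step; case: ifP => _ /=; lra.
have I_mono n k : (I n).1 <= (I (n + k)%N).1 /\ (I (n + k)%N).2 <= (I n).2.
  elim: k => [|k [IH1 IH2]]; first by rewrite addn0.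
  have [S1 S2] := I_step (n + k)%N; rewrite addnS.
  by split; [exact: le_trans S1 | exact: le_trans IH2].
have I_cross n k : (I n).1 <= (I k).2.
  have [M1 _] := I_mono n k; have [_ M2] := I_mono k n.
  by apply: (le_trans M1); apply: ltW; apply: (lt_le_trans (I_lt _)); rewrite addnC.
pose E : classical_sets.set R := fun y => exists n, y = (I n).1.
have E_sup : classical_sets.has_sup E.
  by split; [exists (I 0).1, 0%N | exists (I 0).2 => _ [n ->]].
exists (sup E) => n fx.
have lo : (I n.+1).1 <= sup E by apply: sup_upper_bound => //; exists n.+1.
have hi : sup E <= (I n.+1).2.
  by apply: ge_sup => [|_ [k ->]]; [case: E_sup | exact: I_cross].
move: lo hi (I_lt n); rewrite -fx /= /step.
by case: ltP => /= fm; lra.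
Qed.

Section AlgebraicIndependence.
Variable K : numClosedFieldType.
Hypothesis K_uncountable : forall f : nat -> K, exists x, forall n, f n <> x.

Local Notation widen := (widen_ord (leqnSn _)).

(** The coefficient of a monomial survives when the last variable is singled
   out. *)
Lemma muni_neq0 n (p : {mpoly rat[n.+1]}) : p != 0 -> muni p != 0.
Proof.
rewrite -msupp_eq0; case Ep: (msupp p) => [//|m s] _.
have mp : m \in msupp p by rewrite Ep mem_head.
pose rest (u : 'X_{1..n.+1}) : 'X_{1..n} := [multinom u (widen i) | i < n].
apply/eqP => /(congr1 (fun q : {poly {mpoly rat[n]}} => q`_(m ord_max)@_(rest m))).
rewrite muniE coef_sum raddf_sum coef0 mcoeff0 /=.
rewrite (bigD1_seq m) ?msupp_uniq //= big1 ?addr0 => [|u um].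
  rewrite !coefZ coefXn eqxx mulr1 mcoeffZ mcoeffX eqxx mulr1 => /eqP.
  by rewrite mcoeff_eq0 mp.
rewrite !coefZ coefXn eq_sym; case: eqP => [uM|_]; last by rewrite !mulr0 mcoeff0.
rewrite mulr1 mcoeffZ mcoeffX; case: eqP => [uR|_]; last by rewrite mulr0.
case/negP: um; apply/eqP/mnmP => i; case: (unliftP ord_max i) => [j ->|->//].
have := congr1 (fun w : 'X_{1..n} => w j) uR; rewrite !mnmE.
by rewrite (_ : widen j = lift ord_max j) //; apply/val_inj; rewrite /= /bump leqNgt ltn_ord.
Qed.

Lemma rat_mevalE n (c : 'I_n -> K) (p : {mpoly rat[n]}) :
  (map_mpoly ratr p).@[c] = \sum_(m <- msupp p) ratr p@_m * \prod_i c i ^+ m i.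
Proof.
pose ev : {rmorphism {mpoly rat[n]} -> K} := (meval c \o map_mpoly (@ratr K)).
rewrite -[LHS]/(ev p) {1}[p]mpolyE rmorph_sum; apply: eq_bigr => m _ /=.
by rewrite map_mpolyZ map_mpolyX mevalZ mevalX.
Qed.

Lemma horner_muni n (p : {mpoly rat[n.+1]}) (c : 'I_n.+1 -> K) :
  (map_poly (fun q => (map_mpoly ratr q).@[fun i => c (widen i)]) (muni p)).[c ord_max]
  = (map_mpoly ratr p).@[c].
Proof.
pose ev : {rmorphism {mpoly rat[n]} -> K} :=
  (meval (fun i => c (widen i)) \o map_mpoly (@ratr K)).
rewrite -[fun q => _]/(ev : _ -> _) muniE rmorph_sum horner_sum rat_mevalE.
apply: eq_bigr => m _; rewrite big_ord_recr /=.
rewrite map_polyZ map_polyXn /= hornerZ hornerXn mulrA; congr (_ * _).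
rewrite map_mpolyZ map_mpolyX mevalZ mevalX; congr (_ * _).
by apply: eq_bigr => i _; rewrite mnmE.
Qed.

(** A code in a countable type, through which the polynomials over Q are
   enumerated. *)
Definition mpoly_code n (p : {mpoly rat[n]}) : seq ('X_{1..n} * rat) :=
  [seq (m, p@_m) | m <- msupp p].

Definition mpoly_decode n (s : seq ('X_{1..n} * rat)) : {mpoly rat[n]} :=
  \sum_(mc <- s) mc.2 *: 'X_[mc.1].

Lemma mpoly_codeK n : cancel (@mpoly_code n) (@mpoly_decode n).
Proof. by move=> p; rewrite /mpoly_decode big_map /= -mpolyE. Qed.

(** One more independent element exists at each step: only countably many elements
   of K are roots of nonzero polynomials over Q(c_0, ..., c_(n-1)). *)
Lemma exists_independent n : exists c : 'I_n -> K,
  forall p : {mpoly rat[n]}, (map_mpoly ratr p).@[c] = 0 -> p = 0.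
Proof.
elim: n => [|n [c cP]].
  exists (fun=> 0) => p.
  have -> : p = (p@_0)%:MP.
    apply/mpolyP=> m; rewrite mcoeffC (_ : m = 0%MM) ?eqxx ?mulr1 //.
    by apply/mnmP=> -[].
  by rewrite map_mpolyC mevalC => /eqP; rewrite fmorph_eq0 => /eqP ->; rewrite mpolyC0.
pose P (p : {mpoly rat[n.+1]}) : {poly K} :=
  map_poly (fun q => (map_mpoly ratr q).@[c]) (muni p).
(* The sequence f runs over the roots of all P p, as p runs over the decoded codes. *)
pose rs (p : {mpoly rat[n.+1]}) := sval (closed_field_poly_normal (P p)).
pose f k : K :=
  if unpickle k is Some (s, j) then (rs (mpoly_decode s))`_j else 0.
have [x xP] := K_uncountable f.
pose d (i : 'I_n.+1) := if unlift ord_max i is Some j then c j else x.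
have dW i : d (widen i) = c i.
  rewrite /d (_ : widen i = lift ord_max i) ?liftK //.
  by apply/val_inj; rewrite /= /bump leqNgt ltn_ord.
have dM : d ord_max = x by rewrite /d unlift_none.
exists d => p; rewrite -horner_muni dM.
have -> : map_poly (fun q => (map_mpoly ratr q).@[fun i => d (widen i)]) (muni p) = P p.
  by apply: eq_map_poly => q; apply: meval_eq.
move=> Px; apply/eqP; apply/negPn/negP => /muni_neq0 up.
have P0 : P p != 0.
  apply: contra up => /eqP/polyP P0; apply/eqP/polyP => i; rewrite coef0.
  apply: cP; have := P0 i; rewrite coef0 coef_map_id0 //.
  by rewrite !rmorph0.
have := svalP (closed_field_poly_normal (P p)); rewrite -/(rs p) => PE.
have : root (P p) x by rewrite rootE Px.
rewrite PE rootZ ?lead_coef_eq0 // root_prod_XsubC => xr.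
apply: (xP (pickle (mpoly_code p, index x (rs p)))).
by rewrite /f pickleK mpoly_codeK nth_index.
Qed.

(** Independence is required of every injective enumeration of some of the c_i; a
   relation between these is renamed into a relation between all of the c_i. *)
Lemma exists_alg_indep (I : finType) : exists c : I -> K, alg_indep_rat c.
Proof.
have [c cP] := exists_independent #|I|.
exists (c \o enum_rank) => N e e_inj p p0.
pose up : {mpoly rat[#|I|]} := p \mPo [tuple 'X_(enum_rank (e k)) | k < N].
have up0 : up = 0.
  pose ev : {rmorphism {mpoly rat[#|I|]} -> K} := (meval c \o map_mpoly (@ratr K)).
  apply: cP; rewrite -[RHS]p0 [RHS]rat_mevalE -[LHS]/(ev up) /up comp_mpolyEX rmorph_sum.
  apply: eq_bigr => m _ /=; rewrite map_mpolyZ mevalZ; congr (_ * _).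
  rewrite comp_mpolyX !rmorph_prod /=; apply: eq_bigr => k _.
  by rewrite !rmorphXn /= tnth_mktuple map_mpolyX mevalXU.
pose h i : {mpoly rat[N]} := if [pick k | enum_rank (e k) == i] is Some k then 'X_k else 0.
(* Renaming back is possible since e is injective; the other variables are sent to 0.
   *)
pose down : {mpoly rat[#|I|]} -> {mpoly rat[N]} := mmap (@mpolyC N rat) h.
have hE k : h (enum_rank (e k)) = 'X_k.
  by rewrite /h; case: pickP => [l /eqP/enum_rank_inj/e_inj ->|/(_ k)]; rewrite ?eqxx.
transitivity (down up); last by rewrite up0 /down rmorph0.
rewrite /up comp_mpolyEX {1}(mpolyE p) /down rmorph_sum /=; apply: eq_bigr => m _.
rewrite mmapZ mul_mpolyC; congr (_ *: _).
rewrite comp_mpolyX rmorph_prod mpolyXE_id; apply: eq_bigr => k _.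
by rewrite rmorphXn /= tnth_mktuple mmapX mmap1U hE.
Qed.
End AlgebraicIndependence.

Lemma complex_uncountable (R : realType) (f : nat -> R[i]) : exists x, forall n, f n <> x.
Proof.
have [x xP] := real_uncountable (fun n => complex.Re (f n)).
by exists x%:C%C => n fx; apply: (xP n); rewrite fx.
Qed.

Lemma complex_exists_alg_indep (R : realType) (I : finType) :
  exists c : I -> R[i], alg_indep_rat c.
Proof. exact/exists_alg_indep/complex_uncountable. Qed.

(** * Squarefree algebras modulo two linear forms *)

Section SquarefreeDual.
Variable K : fieldType.

Section Contraction.
Variable I : finType.
Implicit Types (a b : I -> K) (phi : {ffun {set I} -> K^o}) (B D Z : {set I}).

(** The action of the derivation sum_i a_i d/dx_i on squarefree polynomials, the
   value of phi at D being the coefficient of the product of the x_i, i in D.  It is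
   dual to multiplication by the linear form sum_i a_i x_i. *)
Definition contract a phi : {ffun {set I} -> K^o} :=
  [ffun B : {set I} => \sum_(i | i \notin B) a i * phi (i |: B)].

Lemma contract_linear a : linear (contract a).
Proof.
move=> x u v; apply/ffunP=> B; rewrite !ffunE scaler_sumr -big_split /=.
apply: eq_bigr => i _; rewrite !ffunE mulrDr; congr (_ + _); exact: mulrCA.
Qed.
HB.instance Definition _ a :=
  GRing.isLinear.Build K {ffun {set I} -> K^o} {ffun {set I} -> K^o} _ (contract a)
    (contract_linear a).

Lemma contractC a b phi : contract a (contract b phi) = contract b (contract a phi).
Proof.
have E c e : contract c (contract e phi) = [ffun B : {set I} => \sum_i \sum_j
    ([&& i \notin B, j \notin B & i != j])%:R * (c i * e j * phi (i |: (j |: B)))].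
  apply/ffunP=> B; rewrite !ffunE [LHS]big_mkcond; apply: eq_bigr => i _.
  case: ifP => iB /=; last by rewrite big1 // => j _; rewrite mul0r.
  rewrite ffunE mulr_sumr big_mkcond; apply: eq_bigr => j _.
  rewrite !inE negb_or eq_sym andbC; case: andP => _; last by rewrite mul0r.
  by rewrite mul1r mulrA setUCA.
rewrite !E; apply/ffunP=> B; rewrite !ffunE exchange_big; apply: eq_bigr => j _.
apply: eq_bigr => i _; rewrite andbCA eq_sym setUCA.
by rewrite [a i * _]mulrC.
Qed.

Definition sqfree_mx a b (q : bool * {set I}) D : K :=
  \sum_(i | (i \notin q.2) && (i |: q.2 == D)) (if q.1 then a i else b i).

(** The functionals on the degree d part of the squarefree algebra on the variables
   in Z that vanish on the ideal of the linear forms a and b. *)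
Definition sqfree_dual a b Z (d : nat) : {vspace {ffun {set I} -> K^o}} :=
  sol_space [pred D : {set I} | (D \subset Z) && (#|D| == d)] (sqfree_mx a b).

Lemma sum_sqfree_mx a b q phi :
  \sum_D sqfree_mx a b q D * phi D = contract (if q.1 then a else b) phi q.2.
Proof.
rewrite ffunE; under eq_bigr => D _ do rewrite mulr_suml big_mkcondr /=.
rewrite exchange_big; apply: eq_bigr => i _.
rewrite (bigD1 (i |: q.2)) //= eqxx big1 ?addr0 => [|D /negPf iD].
  by case: q.1.
by rewrite eq_sym iD.
Qed.

Lemma sqfree_dualP a b Z d phi :
  reflect [/\ forall D, ~~ ((D \subset Z) && (#|D| == d)) -> phi D = 0,
              contract a phi = 0 & contract b phi = 0]
          (phi \in sqfree_dual a b Z d).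
Proof.
apply: (iffP (sol_spaceP _ _ _)) => [[sup sol]|[sup a0 b0]].
  split=> //; apply/ffunP=> B; rewrite [RHS]ffunE.
    by rewrite -(sum_sqfree_mx a b (true, B)) sol.
  by rewrite -(sum_sqfree_mx a b (false, B)) sol.
split=> // -[[] B]; rewrite sum_sqfree_mx /=; first by rewrite a0 ffunE.
by rewrite b0 ffunE.
Qed.

Definition coef_pair a b (k : bool * I) : K := if k.1 then a k.2 else b k.2.

Definition square_mx a b (q : bool * {set I}) D : K :=
  let c := if q.1 then a else b in
  \sum_(i | i \notin q.2) \sum_(j | (j \notin i |: q.2) && (j |: (i |: q.2) == D))
    c i * c j.

(** The same for the ideal of the squares of the linear forms a and b. *)
Definition square_dual a b (d : nat) : {vspace {ffun {set I} -> K^o}} :=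
  sol_space [pred D : {set I} | #|D| == d] (square_mx a b).

Lemma sum_square_mx a b q phi : let c := if q.1 then a else b in
  \sum_D square_mx a b q D * phi D = contract c (contract c phi) q.2.
Proof.
move=> c; rewrite ffunE; under eq_bigr => D _ do rewrite mulr_suml.
rewrite exchange_big; apply: eq_bigr => i _ /=; rewrite -/c.
rewrite ffunE mulr_sumr.
under eq_bigr => D _ do rewrite mulr_suml big_mkcondr /=.
rewrite exchange_big; apply: eq_bigr => j _.
rewrite (bigD1 (j |: (i |: q.2))) //= eqxx big1 ?addr0 ?mulrA //.
by move=> D /negPf iD; rewrite eq_sym iD.
Qed.

Lemma square_dualP a b d phi :
  reflect [/\ forall D, #|D| != d -> phi D = 0,
              contract a (contract a phi) = 0 & contract b (contract b phi) = 0]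
          (phi \in square_dual a b d).
Proof.
apply: (iffP (sol_spaceP _ _ _)) => [[sup sol]|[sup a0 b0]].
  split=> //; apply/ffunP=> B; rewrite [RHS]ffunE.
    by have := sol (true, B); rewrite sum_square_mx.
  by have := sol (false, B); rewrite sum_square_mx.
split=> // -[[] B]; rewrite sum_square_mx /=; first by rewrite a0 ffunE.
by rewrite b0 ffunE.
Qed.

Lemma contract_supp a phi k (d : nat) :
  (forall D, (#|D| + k)%N != d -> phi D = 0) ->
  forall D, (#|D| + k.+1)%N != d -> contract a phi D = 0.
Proof.
move=> sup D Dd; rewrite ffunE big1 // => i iD.
by rewrite sup ?mulr0 // cardsU1 iD add1n addSnnS.
Qed.

End Contraction.

(** Only the span of the two linear forms matters. *)
Lemma sqfree_dual_lincomb (I : finType) (a b a' b' : I -> K) Z d (x y z t : K) :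
  (forall i, a' i = x * a i + y * b i) -> (forall i, b' i = z * a i + t * b i) ->
  x * t - y * z != 0 -> sqfree_dual a' b' Z d = sqfree_dual a b Z d.
Proof.
move=> a'E b'E det0.
have lin (u v : K) (c : I -> K) phi : (forall i, c i = u * a i + v * b i) ->
    contract c phi = u *: contract a phi + v *: contract b phi.
  move=> cE; apply/ffunP=> B; rewrite !ffunE !scaler_sumr -big_split /=.
  by apply: eq_bigr => i _; rewrite cE mulrDl -!mulrA.
apply/vspaceP=> phi; apply/sqfree_dualP/sqfree_dualP => -[sup a0 b0]; split=> //.
- apply/eqP; rewrite -(inj_eq (scalerI det0)) scaler0; apply/eqP.
  rewrite scalerBl.
  transitivity (t *: contract a' phi - y *: contract b' phi).
    rewrite (lin _ _ _ _ a'E) (lin _ _ _ _ b'E) !scalerDr !scalerA opprD addrACA.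
    by rewrite [t * y]mulrC subrr addr0 [t * x]mulrC.
  by rewrite a0 b0 !scaler0 subrr.
- apply/eqP; rewrite -(inj_eq (scalerI det0)) scaler0; apply/eqP.
  rewrite scalerBl.
  transitivity (x *: contract b' phi - z *: contract a' phi).
    rewrite (lin _ _ _ _ a'E) (lin _ _ _ _ b'E) !scalerDr !scalerA opprD addrACA.
    by rewrite [z * x]mulrC subrr add0r [z * y]mulrC.
  by rewrite a0 b0 !scaler0 subrr.
- by rewrite (lin _ _ _ _ a'E) a0 b0 !scaler0 addr0.
- by rewrite (lin _ _ _ _ b'E) a0 b0 !scaler0 addr0.
Qed.

Lemma dim_sqfree_reindex (I J : finType) (h : J -> I) (a b : I -> K) (d : nat) :
  injective h ->
  \dim (sqfree_dual (a \o h) (b \o h) setT d) = \dim (sqfree_dual a b (h @: setT) d).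
Proof.
move=> h_inj.
have hpre (D : {set I}) : D \subset h @: setT -> h @: (h @^-1: D) = D.
  move=> /subsetP DZ; apply/setP=> i; apply/imsetP/idP => [[j + ->]|iD].
    by rewrite inE.
  by have /imsetP[j _ ij] := DZ i iD; exists j; rewrite // inE -ij.
have preh (D : {set J}) : h @^-1: (h @: D) = D.
  by apply/setP=> j; rewrite inE mem_imset.
have hU j (B : {set J}) : h @: (j |: B) = h j |: h @: B by rewrite imsetU1.
have mxE' (q : bool * {set J}) (D : {set J}) :
    sqfree_mx a b (q.1, h @: q.2) (h @: D) = sqfree_mx (a \o h) (b \o h) q D.
  rewrite /sqfree_mx /= (eq_bigl (fun i => (i \in h @: setT) &&
    ((i \notin h @: q.2) && (i |: h @: q.2 == h @: D)))); last first.
    move=> i; rewrite /=; have [/andP[_ /eqP iD]|_] := boolP (_ && _);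
      rewrite ?andbF ?andbT //; apply/esym.
    have : i \in h @: D by rewrite -iD !inE eqxx.
    by case/imsetP=> j _ ->; rewrite imset_f.
  rewrite big_imset_cond /=; last by move=> ? ? _ _; exact: h_inj.
  apply: eq_big => [j|j _] //; rewrite in_setT /= mem_imset // -hU.
  by rewrite (inj_eq (imset_inj h_inj)).
apply/esym/(@dim_sol_space_reindex _ _ _ _ _ _ _ _ _
  (fun D : {set J} => h @: D) (fun D : {set I} => h @^-1: D)).
- move=> D /=; rewrite subsetT /= => /eqP <-.
  by rewrite imsetS ?subsetT // card_imset // eqxx preh.
- move=> D /= /andP[/hpre hD /eqP <-]; rewrite subsetT /= hD; split=> //.
  by rewrite -{2}hD card_imset.
- move=> [c B]; have [BZ|BZ] := boolP (B \subset h @: setT); last first.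
    left=> D _; apply: big1 => i /andP[_ /eqP iD]; case/negP: BZ.
    rewrite /= in iD; apply: (subset_trans (subsetUr [set i] B)).
    by rewrite iD imsetS // subsetT.
  right; exists (c, h @^-1: B) => D _.
  by rewrite -mxE' /= hpre.
- by move=> [c B]; right; exists (c, h @: B) => D _; rewrite -mxE'.
Qed.

Section Elimination.
Variable I : finType.
Implicit Types (a b : I -> K).

(** The linear form a - x_t, where the bool summand of the index type provides one
   new variable x_t for each of the two forms. *)
Definition graph_form a (t : bool) (x : I + bool) : K :=
  match x with inl i => a i | inr t' => if t' == t then -1 else 0 end.

Definition join_set (B : {set I}) (t f : bool) : {set I + bool} :=
  [set x | match x with inl i => i \in B | inr c => if c then t else f end].

Lemma join_setE (C : {set I + bool}) :
  C = join_set (inl @^-1: C) (inr true \in C) (inr false \in C).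
Proof. by apply/setP=> -[i|[]]; rewrite !inE. Qed.

Lemma card_join_set B t f : #|join_set B t f| = (#|B| + t + f)%N.
Proof.
rewrite -!sum1_card big_mkcond /= big_sumType /= big_bool /= [in RHS]big_mkcond /=.
rewrite !inE -addnA; congr (_ + _)%N.
by apply: eq_bigr => i _; rewrite inE.
Qed.

Lemma setU1_join_inl i B t f : inl i |: join_set B t f = join_set (i |: B) t f.
Proof. by apply/setP=> -[j|[]]; rewrite !inE. Qed.

Lemma setU1_join_true B t f : inr true |: join_set B t f = join_set B true f.
Proof. by apply/setP=> -[j|[]]; rewrite !inE. Qed.

Lemma setU1_join_false B t f : inr false |: join_set B t f = join_set B t true.
Proof. by apply/setP=> -[j|[]]; rewrite !inE. Qed.

Definition slice (chi : {ffun {set I + bool} -> K^o}) t f : {ffun {set I} -> K^o} :=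
  [ffun B => chi (join_set B t f)].

Lemma contract_graph_true a chi B t f :
  contract (graph_form a true) chi (join_set B t f) =
    contract a (slice chi t f) B - (~~ t)%:R * slice chi true f B.
Proof.
rewrite !ffunE big_sumType /=; congr (_ + _).
  by apply: eq_big => [i|i _]; rewrite ?inE // setU1_join_inl ffunE.
rewrite big_mkcond big_bool /= !inE setU1_join_true.
by case: t => /=; case: f; rewrite !(mul0r, mulN1r, addr0, oppr0, mul1r).
Qed.

Lemma contract_graph_false a chi B t f :
  contract (graph_form a false) chi (join_set B t f) =
    contract a (slice chi t f) B - (~~ f)%:R * slice chi t true B.
Proof.
rewrite !ffunE big_sumType /=; congr (_ + _).
  by apply: eq_big => [i|i _]; rewrite ?inE // setU1_join_inl ffunE.
rewrite big_mkcond big_bool /= !inE setU1_join_false.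
by case: t => /=; case: f; rewrite !(mul0r, mulN1r, addr0, add0r, oppr0, mul1r).
Qed.

(** Elimination: a functional killed by a - x_t is determined by its values on the
   monomials without x_t, the other ones being obtained by contraction with a, and
   the relation x_t^2 = 0 becomes the vanishing of the double contraction. *)
Lemma dim_sqfree_graph a b (d : nat) :
  \dim (sqfree_dual (graph_form a true) (graph_form b false) setT d) =
  \dim (square_dual a b d).
Proof.
apply/eqP; rewrite eqn_leq; apply/andP; split.
  pose f chi := slice chi false false.
  have f_lin : linear f by move=> u v w; apply/ffunP=> B; rewrite !ffunE.
  pose fL := HB.pack f (GRing.isLinear.Build K _ _ _ f f_lin)
    : {linear {ffun {set I + bool} -> K^o} -> {ffun {set I} -> K^o}}.
  have chiE chi : chi \in sqfree_dual (graph_form a true) (graph_form b false) setT d ->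
      [/\ forall t, slice chi true t = contract a (slice chi false t),
         forall t, contract a (slice chi true t) = 0,
         forall t, slice chi t true = contract b (slice chi t false) &
         forall t, contract b (slice chi t true) = 0].
    case/sqfree_dualP=> _ /ffunP a0 /ffunP b0.
    split=> t; apply/ffunP=> B.
    - have := a0 (join_set B false t); rewrite contract_graph_true [RHS]ffunE mul1r.
      by move/subr0_eq ->.
    - have := a0 (join_set B true t); rewrite contract_graph_true mul0r subr0 => ->.
      by rewrite !ffunE.
    - have := b0 (join_set B t false); rewrite contract_graph_false [RHS]ffunE mul1r.
      by move/subr0_eq ->.
    - have := b0 (join_set B t true); rewrite contract_graph_false mul0r subr0 => ->.
      by rewrite !ffunE.
  apply: (dim_le_inj (f := fL)) => chi /[dup] chiS /chiE[a1 a0 b1 b0]; rewrite /= /f.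
    have /sqfree_dualP[sup _ _] := chiS.
    apply/square_dualP; split; last 2 first.
    - by rewrite -a1 a0.
    - by rewrite -b1 b0.
    by move=> D Dd; rewrite ffunE sup // card_join_set !addn0 negb_and Dd orbT.
  move=> s0; apply/ffunP=> C; rewrite (join_setE C) ffunE.
  have {s0} s0 : slice chi false false = 0 := s0.
  suff s t u : slice chi t u = 0.
    by have /ffunP/(_ (inl @^-1: C)) := s (inr true \in C) (inr false \in C);
       rewrite !ffunE.
  by case: t; case: u; rewrite ?b1 ?a1 ?s0 ?linear0.
pose f psi : {ffun {set I + bool} -> K^o} := [ffun C : {set I + bool} =>
  ((if inr true \in C then contract a else id)
    ((if inr false \in C then contract b else id) psi)) (inl @^-1: C)].
have f_lin : linear f.
  move=> u v w; apply/ffunP=> C; rewrite !ffunE.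
  by case: (inr true \in C); case: (inr false \in C); rewrite ?linearP ?ffunE.
pose fL := HB.pack f (GRing.isLinear.Build K _ _ _ f f_lin)
  : {linear {ffun {set I} -> K^o} -> {ffun {set I + bool} -> K^o}}.
have sliceE psi t u : slice (f psi) t u =
    (if t then contract a else id) ((if u then contract b else id) psi).
  apply/ffunP=> B; rewrite !ffunE !inE.
  have -> : inl @^-1: join_set B t u = B by apply/setP=> i; rewrite !inE.
  by [].
apply: (dim_le_inj (f := fL)) => psi; last first.
  move=> _ f0; have {}f0 : f psi = 0 := f0.
  rewrite -(sliceE psi false false) f0; apply/ffunP=> B; by rewrite !ffunE.
case/square_dualP=> sup a0 b0; apply/sqfree_dualP; split=> [D||].
- rewrite subsetT /= (join_setE D).
  rewrite -[fL psi _]/(f psi _).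
  have := sliceE psi (inr true \in D) (inr false \in D).
  move=> /ffunP/(_ (inl @^-1: D)); rewrite ffunE => ->.
  rewrite card_join_set -addnA.
  have {}sup (D' : {set I}) : (#|D'| + 0)%N != d -> psi D' = 0 by rewrite addn0; exact: sup.
  case: (inr true \in D); case: (inr false \in D) => /=.
  - by do 2![apply: contract_supp].
  - exact: contract_supp.
  - exact: contract_supp.
  - exact: sup.
- apply/ffunP=> C; rewrite (join_setE C) contract_graph_true !sliceE [RHS]ffunE.
  set u := inr false \in C.
  case: (inr true \in C) => /=; last by rewrite mul1r subrr.
  rewrite mul0r subr0; case: u => /=; last by rewrite a0 ffunE.
  by rewrite [contract a (contract b _)]contractC contractC a0 linear0 ffunE.
- apply/ffunP=> C; rewrite (join_setE C) contract_graph_false !sliceE [RHS]ffunE.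
  set u := inr true \in C.
  case: (inr false \in C) => /=; last first.
    by rewrite mul1r; case: u => /=; rewrite 1?contractC subrr.
  rewrite mul0r subr0; case: u => /=; last by rewrite b0 ffunE.
  by rewrite contractC b0 linear0 ffunE.
Qed.

End Elimination.
End SquarefreeDual.

Section GenericSquarefree.
Variable K : numFieldType.

Lemma generic_sqfree_le (I : finType) (a b a' b' : I -> K) Z d :
  alg_indep_rat (coef_pair a b) ->
  (\dim (sqfree_dual a b Z d) <= \dim (sqfree_dual a' b' Z d))%N.
Proof.
move=> indep.
pose w (q : bool * {set I}) (D : {set I}) (k : bool * I) : rat :=
  [&& k.1 == q.1, k.2 \notin q.2 & k.2 |: q.2 == D]%:R.
have E c e q D : sqfree_mx c e q D =
    ratr 0 + \sum_k ratr (w q D k) * coef_pair c e k :> K.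
  rewrite rmorph0 add0r.
  rewrite -(pair_bigA _ (fun x y => ratr (w q D (x, y)) * coef_pair c e (x, y))).
  rewrite /= big_bool /= /sqfree_mx /w /coef_pair [LHS]big_mkcond.
  case: q => -[] B /=; [rewrite [X in _ + X]big1 ?addr0 | rewrite [X in X + _]big1 ?add0r];
    try (by move=> i _; rewrite rmorph0 mul0r); apply: eq_bigr => i _;
    by rewrite rmorph_nat; case: andP => _; rewrite ?mul1r ?mul0r.
rewrite /sqfree_dual (eq_sol_space _ (E a b)) (eq_sol_space _ (E a' b')).
exact: (generic_affine_sol_space_le _ _ (fun _ _ => 0) w indep).
Qed.

(** Forms in graph form are not generic, since their coefficients at the new variables
   are fixed; but they depend affinely on the others, and among all graph forms
   those with generic a and b give the smallest space. *)
Lemma generic_graph_le (I : finType) (a b a' b' : I -> K) d :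
  alg_indep_rat (coef_pair a b) ->
  (\dim (sqfree_dual (graph_form a true) (graph_form b false) setT d) <=
   \dim (sqfree_dual (graph_form a' true) (graph_form b' false) setT d))%N.
Proof.
move=> indep.
pose w (q : bool * {set I + bool}) (D : {set I + bool}) (k : bool * I) : rat :=
  [&& k.1 == q.1, inl k.2 \notin q.2 & inl k.2 |: q.2 == D]%:R.
pose u (q : bool * {set I + bool}) (D : {set I + bool}) : rat :=
  - ((inr q.1 \notin q.2) && (inr q.1 |: q.2 == D))%:R.
have E c e q D : sqfree_mx (graph_form c true) (graph_form e false) q D =
    ratr (u q D) + \sum_k ratr (w q D k) * coef_pair c e k :> K.
  rewrite -(pair_bigA _ (fun x y => ratr (w q D (x, y)) * coef_pair c e (x, y))).
  rewrite /= big_bool /= /sqfree_mx /w /u /coef_pair [LHS]big_mkcond big_sumType /=.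
  rewrite addrC big_bool /=.
  case: q => -[] B /=.
    rewrite [X in _ = _ + (_ + X)]big1 ?addr0; last by move=> i _; rewrite rmorph0 mul0r.
    congr (_ + _).
      rewrite rmorphN rmorph_nat; case: andP => _; case: andP => _;
        by rewrite ?addr0 ?oppr0.
    apply: eq_bigr => i _.
    by rewrite rmorph_nat; case: andP => _; rewrite ?mul1r ?mul0r.
  rewrite [X in _ = _ + (X + _)]big1 ?add0r; last by move=> i _; rewrite rmorph0 mul0r.
  congr (_ + _).
    rewrite rmorphN rmorph_nat; case: andP => _; case: andP => _;
      by rewrite ?addr0 ?add0r ?oppr0.
  apply: eq_bigr => i _.
  by rewrite rmorph_nat; case: andP => _; rewrite ?mul1r ?mul0r.
rewrite /sqfree_dual (eq_sol_space _ (E a b)) (eq_sol_space _ (E a' b')).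
exact: (generic_affine_sol_space_le _ _ u w indep).
Qed.

Section GenericDimension.
Variables (ga gb : forall k, 'I_k -> K).
Hypothesis gen_indep : forall k, alg_indep_rat (coef_pair (@ga k) (@gb k)).

(** By minimality the choice of the generic forms is irrelevant, see
   [generic_dimE]. *)
Definition generic_dim k d := \dim (sqfree_dual (@ga k) (@gb k) setT d).

Lemma generic_dim_enum (I : finType) (a b : I -> K) (Z : {set I}) d :
  \dim (sqfree_dual a b Z d) =
  \dim (sqfree_dual (a \o @enum_val I (mem Z)) (b \o @enum_val I (mem Z)) setT d).
Proof.
rewrite (dim_sqfree_reindex a b d (@enum_val_inj I (mem Z))).
congr (\dim (sqfree_dual a b _ d)); apply/setP=> i; apply/idP/imsetP => [iZ|[k _ ->]].
  by exists (enum_rank_in iZ i); rewrite // enum_rankK_in.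
exact: enum_valP.
Qed.

Lemma generic_dim_le (I : finType) (a b : I -> K) (Z : {set I}) d :
  (generic_dim #|Z| d <= \dim (sqfree_dual a b Z d))%N.
Proof. by rewrite generic_dim_enum; exact: generic_sqfree_le. Qed.

Lemma generic_dimE (I : finType) (a b : I -> K) (Z : {set I}) d :
  alg_indep_rat (coef_pair a b) ->
  \dim (sqfree_dual a b Z d) = generic_dim #|Z| d.
Proof.
move=> indep; apply/eqP; rewrite eqn_leq generic_dim_le andbT generic_dim_enum.
apply: generic_sqfree_le.
pose h (k : bool * 'I_#|Z|) := (k.1, @enum_val I (mem Z) k.2).
apply: (@eq_alg_indep _ _ (coef_pair a b \o h)) => //.
by apply: alg_indep_comp => // -[x i] [y j] [-> /enum_val_inj ->].
Qed.

Lemma exists_generic (I : finType) :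
  exists a b : I -> K, alg_indep_rat (coef_pair a b).
Proof.
exists (@ga #|I| \o enum_rank), (@gb #|I| \o enum_rank).
pose h (k : bool * I) := (k.1, enum_rank k.2).
apply: (@eq_alg_indep _ _ (coef_pair (@ga #|I|) (@gb #|I|) \o h)) => //.
by apply: alg_indep_comp => // -[x i] [y j] [-> /enum_rank_inj ->].
Qed.

Lemma generic_det_neq0 (I : finType) (a b : I -> K) i j : i != j ->
  alg_indep_rat (coef_pair a b) -> a i * b j - a j * b i != 0.
Proof.
move=> ij indep; pose X (k : bool * I) : {mpoly rat[#|{: bool * I}|]} := 'X_(enum_rank k).
pose p := X (true, i) * X (false, j) - X (true, j) * X (false, i).
have pE c : rat_eval c p = c (true, i) * c (false, j) - c (true, j) * c (false, i) :> K.
  by rewrite rmorphB !rmorphM /= !rat_evalX.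
rewrite -[X in X != 0](pE (coef_pair a b)).
apply: (generic_neq0 (c' := fun k => (k.2 == if k.1 then i else j)%:R) indep).
by rewrite pE /= !eqxx (negPf ij) mulr1 mulr0 subr0 oner_neq0.
Qed.

(** Row reduction puts two generic forms in n + 2 variables in graph form.  So graph
   forms attain the generic dimension, and those with generic a and b, being
   minimal among graph forms, attain it too. *)
Lemma dim_square_dual (I : finType) (a b : I -> K) d :
  alg_indep_rat (coef_pair a b) ->
  \dim (square_dual a b d) = generic_dim #|I|.+2 d.
Proof.
move=> indep; rewrite -dim_sqfree_graph.
have cardT : #|[set: I + bool]| = #|I|.+2 by rewrite cardsT card_sum card_bool addn2.
apply/eqP; rewrite eqn_leq -cardT generic_dim_le andbT.
have [p [q pq]] := exists_generic (I + bool)%type.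
pose t : I + bool := inr true; pose f : I + bool := inr false.
have det0 : p t * q f - p f * q t != 0 by exact: generic_det_neq0.
(* The combinations a' and b' solve for the coefficients (-1, 0) and (0, -1) at the
   two new variables. *)
pose del := p t * q f - p f * q t.
pose a' i := - (q f / del) * p (inl i) + p f / del * q (inl i).
pose b' i := q t / del * p (inl i) + - (p t / del) * q (inl i).
rewrite -(generic_dimE _ _ pq).
rewrite -(@sqfree_dual_lincomb _ _ p q (graph_form a' true) (graph_form b' false) _ d
  (- (q f / del)) (p f / del) (q t / del) (- (p t / del))).
- exact: generic_graph_le.
- case=> [i|[]] //=; rewrite -/t -/f /del; field; exact: det0.
- case=> [i|[]] //=; rewrite -/t -/f /del; field; exact: det0.
- rewrite (_ : _ - _ = del^-1); first by rewrite invr_eq0.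
  by rewrite /del; field; exact: det0.
Qed.

Lemma dim_sqfree_dual0 (I : finType) (a b : I -> K) Z : \dim (sqfree_dual a b Z 0) = 1%N.
Proof.
pose e : {ffun {set I} -> K^o} := [ffun D => (D == set0)%:R].
have e0 : e != 0.
  by apply/eqP => /ffunP/(_ set0)/eqP; rewrite !ffunE eqxx oner_eq0.
suff -> : sqfree_dual a b Z 0 = <[e]>%VS by rewrite dim_vline e0.
apply/vspaceP=> phi; apply/sqfree_dualP/vlineP => [[sup _ _]|[k ->]].
  exists (phi set0); apply/ffunP=> D; rewrite !ffunE.
  have [->|D0] := eqVneq D set0; first by rewrite [RHS]mulr1.
  by rewrite sup ?[RHS]mulr0 // cards_eq0 (negPf D0) andbF.
have c0 c : contract c (k *: e) = 0.
  apply/ffunP=> B; rewrite !ffunE big1 // => i _; rewrite !ffunE.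
  by rewrite setU_eq0 -cards_eq0 cards1 /= [k *: _]mulr0 mulr0.
split=> // D; rewrite cards_eq0 !ffunE; have [->|_ _] := eqVneq D set0.
  by rewrite sub0set.
by rewrite [LHS]mulr0.
Qed.

Lemma dim_sqfree_dual_gt (I : finType) (a b : I -> K) Z d :
  (#|I| < d)%N -> \dim (sqfree_dual a b Z d) = 0%N.
Proof.
move=> Id; apply/eqP; rewrite dimv_eq0 -subv0; apply/subvP=> phi /sqfree_dualP[sup _ _].
rewrite memv0; apply/eqP/ffunP=> D; rewrite [RHS]ffunE; apply: sup.
by rewrite negb_and orbC neq_ltn (leq_ltn_trans (max_card _) Id).
Qed.

(** For k <= 2, two generic forms generate all linear forms. *)
Lemma generic_dim_small k d : (k <= 2)%N -> generic_dim k d = (d == 0)%N.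
Proof.
case: d => [|d]; first by rewrite /generic_dim dim_sqfree_dual0.
case: k => [|[|[|//]]] _.
- by rewrite /generic_dim dim_sqfree_dual_gt // card_ord.
- case: d => [|d]; last by rewrite /generic_dim dim_sqfree_dual_gt // card_ord.
  apply/eqP; rewrite dimv_eq0 -subv0; apply/subvP=> phi /sqfree_dualP[sup a0 _].
  rewrite memv0; apply/eqP/ffunP=> D; rewrite [RHS]ffunE.
  have [D0|D0] := eqVneq D set0; first by rewrite sup // D0 cards0 andbF.
  have -> : D = ord0 |: set0.
    apply/setP=> i; rewrite !inE (ord1 i) eqxx; apply/negPn; apply: contra D0 => D0.
    by apply/eqP/setP=> j; rewrite (ord1 j) inE; exact: negbTE.
  have /ffunP/(_ set0) := a0; rewrite !ffunE (bigD1 ord0) ?inE //= big1 ?addr0.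
    move/eqP; rewrite mulf_eq0 => /orP[/eqP ga0|/eqP //].
    have := generic_neq0 (c' := fun=> 1) (p := 'X_(enum_rank (true, ord0)))
      (@gen_indep 1).
    by rewrite !rat_evalX /coef_pair /= ga0 eqxx oner_neq0 => /(_ isT).
  by move=> i; rewrite (ord1 i) eqxx andbF.
- have [a [b indep]] := exists_generic 'I_0.
  have := dim_square_dual d.+1 indep; rewrite card_ord => <-.
  apply/eqP; rewrite dimv_eq0 -subv0; apply/subvP=> phi /square_dualP[sup _ _].
  rewrite memv0; apply/eqP/ffunP=> D; rewrite [RHS]ffunE; apply: sup.
  by rewrite neq_ltn (leq_ltn_trans (max_card _)) // card_ord.
Qed.

End GenericDimension.
End GenericSquarefree.

(** * Polynomials modulo squares of linear forms *)

Section IdealClosure.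
Variable A : pzRingType.
Implicit Types (G : seq A) (x y : A).

Lemma in_ideal0 G : in_ideal G 0.
Proof. by exists 0%N, (fun=> 0), (fun=> 0), (fun=> 0); split; [case | rewrite big_ord0]. Qed.

Lemma in_idealD G x y : in_ideal G x -> in_ideal G y -> in_ideal G (x + y).
Proof.
move=> [N [l [g [r [gG ->]]]]] [N' [l' [g' [r' [gG' ->]]]]].
pose ext (u : 'I_N -> A) (u' : 'I_N' -> A) (k : 'I_(N + N')) :=
  match split k with inl i => u i | inr j => u' j end.
exists (N + N')%N, (ext l l'), (ext g g'), (ext r r'); split.
  by move=> k; rewrite /ext; case: split.
rewrite big_split_ord /=; congr (_ + _); apply: eq_bigr => i _; rewrite /ext.
  by rewrite (unsplitK (inl i)).
by rewrite (unsplitK (inr i)).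
Qed.

Lemma in_ideal_gen G l g r : g \in G -> in_ideal G (l * g * r).
Proof. by move=> gG; exists 1%N, (fun=> l), (fun=> g), (fun=> r); rewrite big_ord1. Qed.

Lemma in_ideal_sum G (I : Type) (s : seq I) (P : pred I) (F : I -> A) :
  (forall i, P i -> in_ideal G (F i)) -> in_ideal G (\sum_(i <- s | P i) F i).
Proof.
move=> FG; elim/big_ind: _ => //; [exact: in_ideal0 | exact: in_idealD].
Qed.
End IdealClosure.

Lemma in_idealP (K : fieldType) (A : algType K) (G : seq A) a x y :
  in_ideal G x -> in_ideal G y -> in_ideal G (a *: x + y).
Proof.
move=> [N [l [g [r [gG ->]]]]]; apply: in_idealD.
rewrite scaler_sumr; apply: in_ideal_sum => k _; rewrite !scalerAl.
exact: in_ideal_gen.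
Qed.

Section SquarefreeQuotient.
Variables (K : fieldType) (n : nat).
Implicit Types (A B D : {set 'I_n}) (p v : {mpoly K[n]}) (m : 'X_{1..n}).
Implicit Types (phi : {ffun {set 'I_n} -> K^o}).

(** A functional on squarefree monomials, extended by zero to the other monomials, so
   that it kills the ideal of the squares of the variables. *)
Definition sqfree_pair phi p : K := \sum_A p@_(mesym1 A) * phi A.

Lemma sqfree_pair_linear phi : linear (sqfree_pair phi : {mpoly K[n]} -> K^o).
Proof.
move=> a u v; rewrite /sqfree_pair scaler_sumr -big_split; apply: eq_bigr => A _.
by rewrite mcoeffD mcoeffZ mulrDl -mulrA.
Qed.
HB.instance Definition _ phi :=
  GRing.isLinear.Build K {mpoly K[n]} K^o _ (sqfree_pair phi) (sqfree_pair_linear phi).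

Lemma sqfree_pairX phi m :
  sqfree_pair phi 'X_[m] = if [pick A | m == mesym1 A] is Some A then phi A else 0.
Proof.
rewrite /sqfree_pair; case: pickP => [A /eqP ->|mA].
  rewrite (bigD1 A) //= big1 ?addr0 => [|B BA]; first by rewrite mcoeffX eqxx mul1r.
  by rewrite mcoeffX (inj_eq (@inj_mesym1 n)) eq_sym (negPf BA) mul0r.
by rewrite big1 // => A _; rewrite mcoeffX mA mul0r.
Qed.

Lemma sqfree_pairXA phi A : sqfree_pair phi 'X_[mesym1 A] = phi A.
Proof.
rewrite sqfree_pairX; case: pickP => [B /eqP/inj_mesym1 -> //|/(_ A)].
by rewrite eqxx.
Qed.

Lemma sqfree_pairX_gt1 phi m i : (1 < m i)%N -> sqfree_pair phi 'X_[m] = 0.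
Proof.
move=> mi; rewrite sqfree_pairX; case: pickP => // A /eqP mA.
by move: mi; rewrite mA mnmE; case: (i \in A).
Qed.

Lemma not_sqfree m : (forall A, m != mesym1 A) -> exists i, (1 < m i)%N.
Proof.
move=> mA; apply/existsP; rewrite -[[exists i, _]]negbK negb_exists; apply/negP => /forallP m1.
case/eqP: (mA [set i | m i != 0%N]); apply/mnmP => i; rewrite mnmE inE.
by have := m1 i; case: (m i) => [|[|]].
Qed.

Lemma mesym1U1 i A : i \notin A -> (mesym1 A + U_(i) = mesym1 (i |: A))%MM.
Proof.
move=> iA; apply/mnmP => j; rewrite mnmDE mnm1E !mnmE !inE eq_sym.
by have [->|] := eqVneq j i; rewrite ?(negPf iA) ?addn0.
Qed.

Lemma linear_formE p : p \is 1.-homog -> p = \sum_i p@_U_(i) *: 'X_i.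
Proof.
move=> p1; apply/mpolyP => m; rewrite raddf_sum /=.
under eq_bigr => i _ do rewrite mcoeffZ mcoeffX.
have [/mdeg1P[k /eqP ->]|m1] := boolP (mdeg m == 1%N).
  rewrite (bigD1 k) //= eqxx mulr1 big1 ?addr0 // => i ik.
  by rewrite eq_mnm1 (negPf ik) mulr0.
rewrite (dhomog_nemf_coeff p1 m1) big1 // => i _.
have [im|_] := eqVneq U_(i)%MM m; last exact: mulr0.
by rewrite -im mdeg1 eqxx in m1.
Qed.

Lemma sqfree_pair_lin phi p c m : p = \sum_i c i *: 'X_i ->
  sqfree_pair phi ('X_[m] * p) = \sum_i c i * sqfree_pair phi 'X_[m + U_(i)].
Proof.
move=> ->; rewrite mulr_sumr linear_sum; apply: eq_bigr => i _.
by rewrite -scalerAr linearZ -mpolyXD.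
Qed.

(** Multiplication by a linear form is dual to contraction. *)
Lemma sqfree_pair_square phi p c B : p = \sum_i c i *: 'X_i ->
  sqfree_pair phi ('X_[mesym1 B] * p ^+ 2) = contract c (contract c phi) B.
Proof.
move=> pE; rewrite expr2 {1}pE mulrCA mulr_suml linear_sum /= ffunE [RHS]big_mkcond.
apply: eq_bigr => i _; rewrite -scalerAl linearZ /= mulrA -mpolyXD addmC.
rewrite (sqfree_pair_lin _ _ pE); case: ifPn => [iB|/negPn iB]; last first.
  rewrite big1 ?scaler0 // => j _; rewrite (@sqfree_pairX_gt1 _ _ i) ?mulr0 //.
  by rewrite !mnmDE mnm1E eqxx mnmE iB; lia.
rewrite mesym1U1 // ffunE [in RHS]big_mkcond; congr (_ * _); apply: eq_bigr => j _.
case: ifPn => [jB|/negPn jB]; first by rewrite mesym1U1 // sqfree_pairXA.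
rewrite (@sqfree_pairX_gt1 _ _ j) ?mulr0 //.
by rewrite !mnmDE mnm1E eqxx mnmE jB; lia.
Qed.

Lemma sqfree_pair_square0 phi p c m : p = \sum_i c i *: 'X_i ->
  (forall A, m != mesym1 A) -> sqfree_pair phi ('X_[m] * p ^+ 2) = 0.
Proof.
move=> pE /not_sqfree[k mk]; rewrite expr2 {1}pE mulrCA mulr_suml linear_sum /=.
apply: big1 => i _; rewrite -scalerAl linearZ /= mulrA -mpolyXD addmC.
rewrite (sqfree_pair_lin _ _ pE) big1 ?scaler0 // => j _.
by rewrite (@sqfree_pairX_gt1 _ _ k) ?mulr0 // !mnmDE; lia.
Qed.

Lemma mcoeff_square (a b : 'I_n -> K) l1 l2 (q : bool * {set 'I_n}) A :
  l1 = \sum_i a i *: 'X_i -> l2 = \sum_i b i *: 'X_i ->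
  ('X_[mesym1 q.2] * (if q.1 then l1 else l2) ^+ 2)@_(mesym1 A) = square_mx a b q A.
Proof.
move=> l1E l2E; pose delta : {ffun {set 'I_n} -> K^o} := [ffun D => (D == A)%:R].
have pairE p : p@_(mesym1 A) = sqfree_pair delta p.
  rewrite /sqfree_pair (bigD1 A) //= big1 ?addr0 => [|D DA]; rewrite ffunE.
    by rewrite eqxx mulr1.
  by rewrite (negPf DA) mulr0.
have mxE : square_mx a b q A = \sum_D square_mx a b q D * delta D.
  rewrite (bigD1 A) //= big1 ?addr0 => [|D DA]; rewrite ffunE.
    by rewrite eqxx mulr1.
  by rewrite (negPf DA) mulr0.
rewrite pairE mxE sum_square_mx; case: q.1 (l1E) (l2E) => // ? ?; exact: sqfree_pair_square.
Qed.

(** A form killed by all functionals in [square_dual] is, up to monomials that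
   contain a square of a variable, a combination of the products of l1^2 and
   l2^2 by squarefree monomials. *)
Lemma quotient_dim_sqfree (l1 l2 : {mpoly K[n]}) (a b : 'I_n -> K) s :
  l1 \is 1.-homog -> l2 \is 1.-homog ->
  l1 = \sum_i a i *: 'X_i -> l2 = \sum_i b i *: 'X_i ->
  quotient_dim (fun p : {mpoly K[n]} => p \is s.-homog)
     (in_ideal ([seq 'X_i ^+ 2 | i : 'I_n] ++ [:: l1 ^+ 2; l2 ^+ 2]))
     (\dim (square_dual a b s)).
Proof.
move=> l1h l2h l1E l2E; set gens := _ ++ _.
have coef_lin A : linear (fun p : {mpoly K[n]} => p@_(mesym1 A) : K^o).
  by move=> x u v; rewrite mcoeffD mcoeffZ.
pose coefL A : {linear {mpoly K[n]} -> K^o} :=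
  HB.pack (fun p : {mpoly K[n]} => p@_(mesym1 A) : K^o)
    (GRing.isLinear.Build K {mpoly K[n]} K^o _ _ (coef_lin A)).
apply: (quotient_dim_dual (e := fun A => 'X_[mesym1 A]) (c := coefL)).
- by move=> x u v us vs; rewrite dhomogD // dhomogZ.
- exact: dhomog0.
- by move=> A /= /eqP As; rewrite dhomogX /= mdeg_mesym1 As.
- by move=> A B _; rewrite /= mcoeffX (inj_eq (@inj_mesym1 n)) eq_sym.
move=> v vs; split=> [[N [l [h [r [hG ->]]]]] phi /square_dualP[sup a0 b0]|v0].
  rewrite -[LHS]/(sqfree_pair phi _) linear_sum big1 // => k _ /=.
  rewrite mulrAC [l k * r k](mpolyE) mulr_suml linear_sum big1 // => m _ /=.
  rewrite -scalerAl linearZ /=; move: (hG k); rewrite mem_cat => /orP[/imageP[i _ ->]|].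
    rewrite mpolyXn -mpolyXD (@sqfree_pairX_gt1 _ _ i) ?scaler0 //.
    by rewrite mnmDE mulmnE mnm1E eqxx; lia.
  case: (pickP (fun A => m == mesym1 A)) => [A /eqP ->|mA]; last first.
    have {}mA A : m != mesym1 A by rewrite mA.
    rewrite !inE => /orP[]/eqP ->.
      by rewrite (sqfree_pair_square0 _ l1E mA) scaler0.
    by rewrite (sqfree_pair_square0 _ l2E mA) scaler0.
  rewrite !inE => /orP[]/eqP ->.
    by rewrite (sqfree_pair_square _ _ l1E) a0 ffunE scaler0.
  by rewrite (sqfree_pair_square _ _ l2E) b0 ffunE scaler0.
have [y yE] : exists y : bool * {set 'I_n} -> K, forall A, #|A| == s ->
    v@_(mesym1 A) = \sum_q y q * square_mx a b q A.
  exact: sol_space_annihilator v0.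
pose w q := (y q *: 'X_[mesym1 q.2]) * (if q.1 then l1 else l2) ^+ 2.
pose u := v - \sum_(q : bool * {set 'I_n} | (#|q.2| + 2)%N == s) w q.
have wh q : w q \is (#|q.2| + 2).-homog.
  rewrite /w -scalerAl dhomogZ // dhomogM //; first by rewrite dhomogX /= mdeg_mesym1.
  by case: q.1; [exact: (dhomogMn 2 l1h) | exact: (dhomogMn 2 l2h)].
have uh : u \is s.-homog.
  by rewrite rpredB ?rpred_sum // => q /eqP <-.
have u0 A : u@_(mesym1 A) = 0.
  have [As|As] := boolP (#|A| == s); last first.
    by rewrite (dhomog_nemf_coeff uh) //= mdeg_mesym1.
  rewrite mcoeffB yE // raddf_sum /= (bigID (fun q : bool * {set 'I_n} => (#|q.2| + 2)%N == s)) /=.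
  have wE q : (w q)@_(mesym1 A) = y q * square_mx a b q A.
    by rewrite /w -scalerAl mcoeffZ (mcoeff_square _ _ l1E l2E).
  under [X in _ - X]eq_bigr => q _ do rewrite wE.
  rewrite addrAC subrr add0r; apply: big1 => q qs.
  by rewrite -wE (dhomog_nemf_coeff (wh q)) //= mdeg_mesym1 (eqP As) eq_sym.
have -> : v = u + \sum_(q : bool * {set 'I_n} | (#|q.2| + 2)%N == s) w q * 1.
  by rewrite /u; under [X in _ + X]eq_bigr => q _ do rewrite mulr1; rewrite subrK.
apply: in_idealD; last first.
  apply: in_ideal_sum => q _; apply: in_ideal_gen; rewrite mem_cat !inE.
  by case: q.1; rewrite eqxx ?orbT.
rewrite [u]mpolyE; apply: in_ideal_sum => m _.
case: (pickP (fun A => m == mesym1 A)) => [A /eqP ->|mA].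
  by rewrite u0 scale0r; exact: in_ideal0.
have [|i mi] := @not_sqfree m; first by move=> A; rewrite mA.
have -> : u@_m *: 'X_[m] = (u@_m *: 'X_[m - U_(i) *+ 2]) * 'X_i ^+ 2 * 1.
  rewrite mulr1 mpolyXn -scalerAl -mpolyXD; congr (_ *: 'X_[_]).
  apply/esym/submK; apply/mnm_lepP => j; rewrite mulmnE mnm1E.
  by case: eqP => [<-|_]; lia.
by apply: in_ideal_gen; rewrite mem_cat image_f.
Qed.

End SquarefreeQuotient.

(** * Exterior algebras modulo two quadratic forms *)

Section Exterior.
Variables (K : fieldType) (n : nat).
Implicit Types (A B C S : {set 'I_n}) (f g h v : extalg K n).
Local Notation X := (@ext_monom K n).

Lemma ext_coef_linear A : linear (fun v : extalg K n => ext_coef v A : K^o).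
Proof. by move=> a u v; rewrite ext_coefD ext_coefZ. Qed.
Definition ext_coefL A : {linear extalg K n -> K^o} :=
  HB.pack (fun v : extalg K n => ext_coef v A : K^o)
    (GRing.isLinear.Build K (extalg K n) K^o _ _ (ext_coef_linear A)).

Lemma ext_coef_sum (I : Type) (r : seq I) (P : pred I) (F : I -> extalg K n) A :
  ext_coef (\sum_(i <- r | P i) F i) A = \sum_(i <- r | P i) ext_coef (F i) A.
Proof. exact: (linear_sum (ext_coefL A)). Qed.

Lemma ext_coef0 A : ext_coef (0 : extalg K n) A = 0.
Proof. exact: (linear0 (ext_coefL A)). Qed.

Lemma ext_expand v : v = \sum_A ext_coef v A *: X A.
Proof.
apply: ext_coefP => A; rewrite ext_coef_sum (bigD1 A) //= big1 ?addr0 => [|B BA].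
  by rewrite ext_coefZ ext_coef_monom eqxx mulr1.
by rewrite ext_coefZ ext_coef_monom eq_sym (negPf BA) mulr0.
Qed.

Lemma ext_monomM A B : X A * X B = ext_sign K A B *: X (A :|: B).
Proof. exact: ext_mul_monom. Qed.

Lemma ext_monom_expandl v h : v * h = \sum_A ext_coef v A *: (X A * h).
Proof.
by rewrite {1}(ext_expand v) mulr_suml; apply: eq_bigr => A _; rewrite scalerAl.
Qed.

Lemma ext_homogP s v : reflect (forall A, #|A| != s -> ext_coef v A = 0) (ext_homog s v).
Proof.
apply: (iffP forallP) => [hv A As|hv A]; last first.
  by apply/implyP; apply: contraNT => /hv ->.
by apply/eqP; apply: contraNT As; move/implyP: (hv A).
Qed.

Lemma ext_invC A B : [disjoint A & B] -> (ext_inv A B + ext_inv B A = #|A| * #|B|)%N.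
Proof.
move=> dAB; rewrite /ext_inv [X in (_ + X)%N]exchange_big -big_split /=.
rewrite -sum1_card big_distrl /=; apply: eq_bigr => i iA.
rewrite mul1n -big_split -sum1_card /=; apply: eq_bigr => j jB.
case: ltngtP => // /val_inj ij; move: dAB; rewrite disjoint_subset => /subsetP/(_ i iA).
by rewrite inE -ij jB.
Qed.

(** Moving A past B takes #|A| * #|B| transpositions. *)
Lemma ext_sign_comm A B : ~~ odd #|A| -> ext_sign K A B = ext_sign K B A.
Proof.
move=> eA; rewrite /ext_sign disjoint_sym; case: ifP => // dAB.
rewrite -signr_odd -[RHS]signr_odd; congr (_ ^+ (nat_of_bool _)).
rewrite disjoint_sym in dAB; have := congr1 odd (ext_invC dAB).
by rewrite oddM (negPf eA) oddD /=; case: (odd _); case: (odd _).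
Qed.

Lemma ext_quadratic_central f h : ext_homog 2 f -> f * h = h * f.
Proof.
move=> /ext_homogP f2; rewrite (ext_expand f) mulr_suml mulr_sumr.
apply: eq_bigr => A _.
have [A2|/f2 ->] := eqVneq #|A| 2; last by rewrite !scale0r !(mul0r, mulr0).
rewrite -scalerAl -scalerAr; congr (_ *: _).
rewrite (ext_expand h) mulr_suml mulr_sumr; apply: eq_bigr => B _.
by rewrite -scalerAl -scalerAr !ext_monomM setUC (@ext_sign_comm A) ?A2.
Qed.

Lemma ext_coef_monomM B f A :
  ext_coef (X B * f) A = \sum_(C | B :|: C == A) ext_sign K B C * ext_coef f C.
Proof.
rewrite ext_coef_mul (bigD1 B) //= [X in _ + X]big1 ?addr0 => [|C /negPf CB].
  by apply: eq_bigr => C _; rewrite ext_coef_monom eqxx mul1r.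
by apply: big1 => D _; rewrite ext_coef_monom CB mul0r mulr0.
Qed.

Lemma ext_homogM s B f : ext_homog s f -> ext_homog (#|B| + s) (X B * f).
Proof.
move=> /ext_homogP fs; apply/ext_homogP => A As; rewrite ext_coef_monomM.
apply: big1 => C /eqP CA; rewrite /ext_sign; case: ifP => [dBC|_]; last by rewrite mul0r.
rewrite fs ?mulr0 //; apply: contra As => /eqP Cs.
by rewrite -CA cardsU (disjoint_setI0 dBC) cards0 subn0 Cs.
Qed.

(** The functionals on the degree s part of E_n that vanish on the ideal (f, g).
   Multiplication on one side suffices, quadratic forms being central. *)
Definition ext_dual f g (s : nat) : {vspace {ffun {set 'I_n} -> K^o}} :=
  sol_space [pred A : {set 'I_n} | #|A| == s]
    (fun q A => ext_coef (X q.2 * (if q.1 then f else g : extalg K n)) A).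

Definition ext_pair (phi : {ffun {set 'I_n} -> K^o}) v : K := \sum_A ext_coef v A * phi A.

Lemma ext_pair_linear phi : linear (ext_pair phi : extalg K n -> K^o).
Proof.
move=> a u v; rewrite /ext_pair scaler_sumr -big_split; apply: eq_bigr => A _.
by rewrite ext_coefD ext_coefZ mulrDl -mulrA.
Qed.
HB.instance Definition _ phi :=
  GRing.isLinear.Build K (extalg K n) K^o _ (ext_pair phi) (ext_pair_linear phi).

Lemma ext_dualP f g (s : nat) (phi : {ffun {set 'I_n} -> K^o}) :
  reflect [/\ forall A, #|A| != s -> phi A = 0,
              forall h, ext_pair phi (h * f) = 0 & forall h, ext_pair phi (h * g) = 0]
          (phi \in ext_dual f g s).
Proof.
apply: (iffP (sol_spaceP _ _ _)) => -[sup].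
  move=> sol; split=> // h; rewrite ext_monom_expandl linear_sum /=; apply: big1 => B _;
    rewrite linearZ.
    by have := sol (true, B) => /= E; rewrite /ext_pair E scaler0.
  by have := sol (false, B) => /= E; rewrite /ext_pair E scaler0.
by move=> f0 g0; split=> // -[[] B]; [exact: f0 | exact: g0].
Qed.

Lemma quotient_dim_ext f g s : ext_homog 2 f -> ext_homog 2 g ->
  quotient_dim (@ext_homog K n s) (in_ideal [:: f; g]) (\dim (ext_dual f g s)).
Proof.
move=> f2 g2; apply: (quotient_dim_dual (e := X) (c := ext_coefL)).
- move=> a u v /ext_homogP us /ext_homogP vs; apply/ext_homogP => A As.
  by rewrite ext_coefD ext_coefZ us // vs // mulr0 addr0.
- by apply/ext_homogP => A _; exact: ext_coef0.
- move=> A /= /eqP As; apply/ext_homogP => B Bs; rewrite ext_coef_monom.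
  by have [BA|//] := eqVneq B A; rewrite BA As eqxx in Bs.
- by move=> A B _; rewrite /= ext_coef_monom.
move=> v vs; split=> [[N [l [h [r [hG ->]]]]] phi /ext_dualP[sup phif phig]|v0].
  rewrite -[LHS]/(ext_pair phi _) linear_sum big1 // => k _.
  have : (h k \in [:: f; g]) := hG k; rewrite !inE => /orP[]/eqP ->.
    by rewrite -mulrA (ext_quadratic_central (r k) f2) mulrA /= phif.
  by rewrite -mulrA (ext_quadratic_central (r k) g2) mulrA /= phig.
have [y yE] : exists y : bool * {set 'I_n} -> K, forall A, #|A| == s ->
    ext_coef v A = \sum_q y q * ext_coef (X q.2 * (if q.1 then f else g)) A.
  exact: sol_space_annihilator v0.
have -> : v = \sum_(q : bool * {set 'I_n} | (#|q.2| + 2)%N == s)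
    (y q *: X q.2) * (if q.1 then f else g) * 1.
  apply: ext_coefP => A; rewrite ext_coef_sum.
  have qh (q : bool * {set 'I_n}) : ext_homog (#|q.2| + 2) (X q.2 * (if q.1 then f else g)).
    by apply: ext_homogM; case: q.1.
  have [As|As] := boolP (#|A| == s); last first.
    rewrite (ext_homogP _ _ vs) // big1 // => q qs.
    rewrite mulr1 -scalerAl ext_coefZ (ext_homogP _ _ (qh q)) ?mulr0 //.
    by rewrite (eqP qs).
  rewrite yE // [LHS](bigID (fun q : bool * {set 'I_n} => (#|q.2| + 2)%N == s)) /=.
  rewrite [X in _ + X]big1 ?addr0.
    by apply: eq_bigr => q _; rewrite mulr1 -scalerAl ext_coefZ.
  move=> q qs; rewrite (ext_homogP _ _ (qh q)) ?mulr0 //.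
  by rewrite (eqP As) eq_sym.
by apply: in_ideal_sum => q _; apply: in_ideal_gen; case: q.1; rewrite !inE eqxx ?orbT.
Qed.

End Exterior.

(** * Linear substitutions in exterior algebras *)

Section Substitution.
Variables (K : fieldType) (n : nat).
Implicit Types (A B C S : {set 'I_n}).
Local Notation E := (extalg K n).
Local Notation X := (@ext_monom K n).

Lemma min_notin (i : 'I_n) A : (forall j, j \in A -> (i < j)%N) -> i \notin A.
Proof. by move=> iA; apply/negP => /iA; rewrite ltnn. Qed.

Lemma ext_sign_min (i : 'I_n) A : (forall j, j \in A -> (i < j)%N) -> ext_sign K [set i] A = 1.
Proof.
move=> iA; rewrite /ext_sign disjoints1 (min_notin iA) /ext_inv big_set1.
by rewrite big1 // => j /iA ij; rewrite ltnNge (ltnW ij).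
Qed.

(** Induction that adds elements in decreasing order, so that x_(i |: A) is the
   product x_i x_A without sign. *)
Lemma set_min_ind (P : {set 'I_n} -> Prop) : P set0 ->
  (forall (i : 'I_n) A, (forall j, j \in A -> (i < j)%N) -> P A -> P (i |: A)) -> forall A, P A.
Proof.
move=> P0 PU A; have [k] := ubnP #|A|; elim: k A => // k IHk A Ak.
have [->//|[i0 i0A]] := set_0Vmem A.
case: (arg_minnP (fun i : 'I_n => val i) i0A) => i iA imin.
rewrite -(setD1K iA); apply: PU.
  move=> j; rewrite !inE => /andP[ji /imin]; rewrite leq_eqVlt => /orP[/eqP ij|//].
  by rewrite (val_inj ij) eqxx in ji.
apply: IHk; have := cardsD1 i A; rewrite (iA : i \in A) => E.
  by move: Ak; rewrite E ltnS.
Qed.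

Variable (u : 'I_n -> E).
Hypothesis u_anticomm : forall i j, u i * u j = - (u j * u i).
Hypothesis u_sqr : forall i, u i * u i = 0.

(** The image of x_A under the algebra map that sends x_i to u_i. *)
Definition ext_prod A : E := \prod_(i <- enum A) u i.

Lemma enum_setU1_min (i : 'I_n) A : (forall j, j \in A -> (i < j)%N) ->
  enum (i |: A) = i :: enum A.
Proof.
move=> iA; have sorted_enum B : sorted (relpre val ltn) (enum B).
  rewrite [enum B]/(filter _ _) sorted_filter //; first by move=> ? ? ?; exact: ltn_trans.
  by rewrite -sorted_map -enumT val_enum_ord iota_ltn_sorted.
apply: (@irr_sorted_eq _ (relpre val ltn)) => //.
- by move=> ? ? ?; exact: ltn_trans.
- by move=> j; rewrite /= ltnn.
- rewrite /= path_min_sorted //; apply/allP => j; rewrite mem_enum; exact: iA.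
- by move=> j; rewrite !(mem_enum, inE).
Qed.

Lemma ext_prodU1 (i : 'I_n) A : (forall j, j \in A -> (i < j)%N) ->
  ext_prod (i |: A) = u i * ext_prod A.
Proof. by move=> iA; rewrite /ext_prod enum_setU1_min // big_cons. Qed.

Lemma ext_prod_gen i A : u i * ext_prod A = ext_sign K [set i] A *: ext_prod (i |: A).
Proof.
elim/set_min_ind: A => [|j A jA IH].
  rewrite ext_sign0r setU0 scale1r -[in RHS](setU0 [set i]) ext_prodU1 //.
  by move=> j; rewrite inE.
have jnA : j \notin A by exact: min_notin.
have [ij|ji|/val_inj ->] := ltngtP i j.
- have iA k : k \in j |: A -> (i < k)%N.
    by rewrite !inE => /orP[/eqP->//|/jA]; exact: ltn_trans.
  by rewrite (ext_prodU1 iA) (ext_sign_min iA) scale1r.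
- rewrite ext_prodU1 // mulrA u_anticomm mulNr -mulrA IH -scalerAr.
  have jiA k : k \in i |: A -> (j < k)%N by rewrite !inE => /orP[/eqP->//|/jA].
  rewrite -ext_prodU1 // setUCA -scaleNr; congr (_ *: _).
  rewrite /ext_sign !disjoints1 !inE negb_or -val_eqE gtn_eqF //=.
  case: ifP => _; rewrite ?oppr0 // /ext_inv !big_set1 big_setU1 //= ji.
  by rewrite add1n exprS mulN1r.
- rewrite ext_prodU1 // mulrA u_sqr mul0r /ext_sign disjoints1 !inE eqxx /=.
  by rewrite scale0r.
Qed.

(** The universal property of the exterior algebra: anticommuting elements of
   square zero multiply with the signs of the monomials. *)
Lemma ext_prodM A B : ext_prod A * ext_prod B = ext_sign K A B *: ext_prod (A :|: B).
Proof.
elim/set_min_ind: A => [|i A iA IH].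
  by rewrite ext_sign0l set0U scale1r /ext_prod enum_set0 big_nil mul1r.
rewrite ext_prodU1 // -mulrA IH -scalerAr ext_prod_gen scalerA setUA; congr (_ *: _).
by rewrite mulrC -ext_signA ext_sign_min // mul1r.
Qed.

Definition ext_subst (v : E) : E := \sum_A ext_coef v A *: ext_prod A.

Lemma ext_subst_linear : linear ext_subst.
Proof.
move=> a v w; rewrite /ext_subst scaler_sumr -big_split; apply: eq_bigr => A _ /=.
by rewrite ext_coefD ext_coefZ scalerDl scalerA.
Qed.
HB.instance Definition _ := GRing.isLinear.Build K E E _ ext_subst ext_subst_linear.

Lemma ext_subst_monom A : ext_subst (X A) = ext_prod A.
Proof.
rewrite /ext_subst (bigD1 A) //= big1 ?addr0 => [|B /negPf BA].
  by rewrite ext_coef_monom eqxx scale1r.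
by rewrite ext_coef_monom BA scale0r.
Qed.

Lemma ext_substM v w : ext_subst (v * w) = ext_subst v * ext_subst w.
Proof.
rewrite {1}(ext_expand v) {1}(ext_expand w) mulr_suml linear_sum /= mulr_suml.
apply: eq_bigr => A _; rewrite mulr_sumr linear_sum /= mulr_sumr; apply: eq_bigr => B _.
have -> : ext_coef v A *: X A * (ext_coef w B *: X B) =
    (ext_coef v A * (ext_coef w B * ext_sign K A B)) *: X (A :|: B).
  by rewrite -scalerAl -scalerAr ext_monomM !scalerA mulrA.
rewrite [LHS]linearZ /= ext_subst_monom -scalerAl -scalerAr ext_prodM !scalerA.
by rewrite mulrA.
Qed.

Lemma ext_homogMs (s t : nat) (v w : E) :
  ext_homog s v -> ext_homog t w -> ext_homog (s + t) (v * w).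
Proof.
move=> /ext_homogP vs wt; apply/ext_homogP => A Ast.
rewrite ext_monom_expandl ext_coef_sum big1 // => B _; rewrite ext_coefZ.
have [Bs|/vs->] := eqVneq #|B| s; last by rewrite mul0r.
by rewrite (ext_homogP _ _ (ext_homogM B wt)) ?mulr0 // Bs.
Qed.

Lemma ext_prod_homog A : (forall i, ext_homog 1 (u i)) -> ext_homog #|A| (ext_prod A).
Proof.
move=> u1; elim/set_min_ind: A => [|i A iA IH].
  rewrite /ext_prod enum_set0 big_nil cards0; apply/ext_homogP => A A0.
  rewrite [LHS]ext_coef_monom; have [AE|//] := eqVneq A set0.
  by rewrite AE cards0 eqxx in A0.
by rewrite ext_prodU1 // cardsU1 min_notin //; exact: ext_homogMs.
Qed.

End Substitution.

Section LinearChange.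
Variables (K : numFieldType) (n : nat).
Implicit Types (A B C S : {set 'I_n}).
Local Notation E := (extalg K n).
Local Notation X := (@ext_monom K n).

Lemma ext_prod_gens A : ext_prod (@ext_gen K n) A = X A.
Proof.
elim/set_min_ind: A => [|i A iA IH]; first by rewrite /ext_prod enum_set0 big_nil.
by rewrite ext_prodU1 // IH /ext_gen ext_monomM ext_sign_min // scale1r.
Qed.

(** The index order is such that the matrix H of a quadratic form becomes P H P^T. *)
Definition lin_change (P : 'M[K]_n) (i : 'I_n) : E := \sum_j P j i *: ext_gen K j.

Lemma lin_change_anticomm P i j :
  lin_change P i * lin_change P j = - (lin_change P j * lin_change P i).
Proof.
rewrite /lin_change !mulr_suml -sumrN.
under [RHS]eq_bigr => k _ do rewrite mulr_sumr -sumrN.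
rewrite exchange_big; apply: eq_bigr => k _; rewrite mulr_sumr; apply: eq_bigr => l _.
rewrite -!scalerAl -!scalerAr !scalerA mulrC -scalerN; congr (_ *: _).
exact: ext_gen_mulN.
Qed.

Lemma lin_change_sqr P i : lin_change P i * lin_change P i = 0.
Proof.
have /eqP := lin_change_anticomm P i i.
by rewrite -addr_eq0 -mulr2n -scaler_nat scaler_eq0 pnatr_eq0 /= => /eqP.
Qed.

Lemma lin_change_homog P i : ext_homog 1 (lin_change P i).
Proof.
apply/ext_homogP => A A1; rewrite ext_coef_sum big1 // => j _.
rewrite ext_coefZ ext_coef_monom; have [AE|_] := eqVneq A [set j]; last exact: mulr0.
by rewrite AE cards1 eqxx in A1.
Qed.

(** A substitution that maps (f, g) to (f', g') pulls functionals back, and does so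
   injectively when it is surjective.  Surjectivity holds since the inverse
   matrix provides preimages of the generators. *)
Lemma ext_dual_change_le (P : 'M[K]_n) (f g f' g' : E) s : P \in unitmx ->
  ext_subst (lin_change P) f = f' -> ext_subst (lin_change P) g = g' ->
  (\dim (ext_dual f' g' s) <= \dim (ext_dual f g s))%N.
Proof.
move=> uP; set sub := ext_subst (lin_change P) => fE gE.
have subM v w : sub (v * w) = sub v * sub w.
  exact: (ext_substM (lin_change_anticomm P) (lin_change_sqr P)).
pose F (phi : {ffun {set 'I_n} -> K^o}) : {ffun {set 'I_n} -> K^o} :=
  [ffun A => ext_pair phi (ext_prod (lin_change P) A)].
have F_lin : linear F.
  move=> a phi psi; apply/ffunP=> A; rewrite !ffunE scaler_sumr -big_split.
  apply: eq_bigr => B _; rewrite !ffunE mulrDr; congr (_ + _); exact: mulrCA.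
pose FL := HB.pack F (GRing.isLinear.Build K _ _ _ F F_lin)
  : {linear {ffun {set 'I_n} -> K^o} -> {ffun {set 'I_n} -> K^o}}.
have pairF phi v : ext_pair (F phi) v = ext_pair phi (sub v).
  rewrite /sub /ext_subst linear_sum; apply: eq_bigr => A _.
  by rewrite linearZ ffunE.
apply: (dim_le_inj (f := FL)) => phi /ext_dualP[sup f0 g0].
  apply/ext_dualP; split=> [A As|h|h].
  - rewrite ffunE /ext_pair big1 // => B _.
    have /ext_homogP hA := ext_prod_homog A (lin_change_homog P).
    have [BA|/hA->] := eqVneq #|B| #|A|; last by rewrite mul0r.
    by rewrite sup ?mulr0 // BA.
  - by rewrite pairF subM fE.
  - by rewrite pairF subM gE.
move=> F0; have {}F0 : F phi = 0 := F0.
have phi_sub v : ext_pair phi (sub v) = 0.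
  by rewrite -pairF F0 /ext_pair big1 // => A _; rewrite ffunE mulr0.
pose Q := invmx P.
pose w j : E := \sum_i Q i j *: ext_gen K i.
have subw j : sub (w j) = ext_gen K j.
  rewrite /w /sub linear_sum /=.
  under eq_bigr => i _ do rewrite linearZ /= ext_subst_monom /ext_prod enum_set1 big_seq1.
  rewrite /lin_change; under eq_bigr => i _ do rewrite scaler_sumr.
  rewrite exchange_big /= (bigD1 j) //= [X in _ + X]big1 ?addr0 => [|k kj].
    under eq_bigr => i _ do rewrite scalerA mulrC.
    have /matrixP/(_ j j) := mulmxV uP; rewrite !mxE eqxx -scaler_suml => ->.
    by rewrite scale1r.
  under eq_bigr => i _ do rewrite scalerA mulrC.
  have /matrixP/(_ k j) := mulmxV uP; rewrite !mxE (negPf kj) -scaler_suml => ->.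
  by rewrite scale0r.
have sub_prod A : sub (ext_prod w A) = X A.
  rewrite -ext_prod_gens; elim/set_min_ind: A => [|i A iA IH].
    rewrite /ext_prod enum_set0 !big_nil; rewrite /sub ext_subst_monom.
    by rewrite /ext_prod enum_set0 big_nil.
  by rewrite !ext_prodU1 // subM subw IH.
apply/ffunP=> A; rewrite [RHS]ffunE -[RHS](phi_sub (ext_prod w A)) sub_prod.
rewrite /ext_pair (bigD1 A) //= big1 ?addr0 => [|B BA].
  by rewrite ext_coef_monom eqxx mul1r.
by rewrite ext_coef_monom (negPf BA) mul0r.
Qed.

End LinearChange.

(** * Pencils of alternating matrices *)

Section Pairs.
Variable m : nat.

Lemma left_subproof (i : 'I_m) : (i.*2 < m.*2)%N. Proof. by rewrite ltn_double. Qed.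
Lemma right_subproof (i : 'I_m) : (i.*2.+1 < m.*2)%N.
Proof. by have := ltn_ord i; lia. Qed.
Lemma pair_index_subproof (k : 'I_m.*2) : (k./2 < m)%N.
Proof. by have := ltn_ord k; lia. Qed.

(** The generators are grouped in pairs of consecutive ones. *)
Definition lft i : 'I_m.*2 := Ordinal (left_subproof i).
Definition rgt i : 'I_m.*2 := Ordinal (right_subproof i).
Definition pair_index k : 'I_m := Ordinal (pair_index_subproof k).

Variant pair_spec (k : 'I_m.*2) : 'I_m -> Prop :=
| PairLeft i of k = lft i : pair_spec k i
| PairRight i of k = rgt i : pair_spec k i.

Lemma pairP k : pair_spec k (pair_index k).
Proof.
have := odd_double_half k; case: (boolP (odd k)) => _ /= kE.
  by apply: PairRight; apply/val_inj; rewrite /= -{1}kE; lia.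
by apply: PairLeft; apply/val_inj; rewrite /= -{1}kE; lia.
Qed.

Lemma lftK i : pair_index (lft i) = i. Proof. by apply/val_inj; rewrite /=; lia. Qed.
Lemma rgtK i : pair_index (rgt i) = i. Proof. by apply/val_inj; rewrite /=; lia. Qed.
Lemma lft_inj : injective lft. Proof. exact: can_inj lftK. Qed.
Lemma rgt_inj : injective rgt. Proof. exact: can_inj rgtK. Qed.
Lemma lft_neq_rgt i j : lft i != rgt j.
Proof. by rewrite -val_eqE /=; apply/eqP; lia. Qed.

Lemma sum_pairs (V : nmodType) (F : 'I_m.*2 -> V) :
  \sum_k F k = \sum_i (F (lft i) + F (rgt i)).
Proof.
rewrite (partition_big pair_index predT) //=; apply: eq_bigr => i _.
rewrite (bigD1 (lft i)) ?lftK //= (bigD1 (rgt i)) /=; last first.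
  by rewrite rgtK eqxx eq_sym lft_neq_rgt.
rewrite big1 ?addr0 // => k /andP[/andP[]].
by case: (pairP k) => j -> /eqP ->; rewrite eqxx.
Qed.
End Pairs.

Section Skew.
Variable K : numFieldType.

Lemma skew_odd_det0 n (A : 'M[K]_n) : odd n -> A^T = - A -> \det A = 0.
Proof.
move=> on skew; have := det_tr A; rewrite skew -scaleN1r detZ -signr_odd on expr1.
by rewrite mulN1r => /eqP; rewrite eq_sym -addr_eq0 -mulr2n mulrn_eq0 /= => /eqP.
Qed.

(** Deleting a row and the matching column, at an index i where a kernel vector u
   is nonzero, leaves an alternating matrix of odd size, which is singular as
   well.  Its kernel vector extends by 0 to a kernel vector w, independent of u. *)
Lemma skew_even_corank n (A : 'M[K]_n) : ~~ odd n -> A^T = - A -> \det A = 0 ->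
  exists i (u w : 'rV[K]_n),
    [/\ u *m A = 0, w *m A = 0, u 0 i != 0, w 0 i = 0 & w != 0].
Proof.
move=> en skew /eqP/det0P[u /rV0Pn[i ui] uA].
case: n => [|n] in A u i en skew ui uA *; first by case: i {ui}.
pose B := row' i (col' i A).
have skewB : B^T = - B.
  by apply/matrixP=> k l; have /matrixP/(_ (lift i k) (lift i l)) := skew; rewrite !mxE.
have /eqP/det0P[w0 w0_neq0 w0B] : \det B = 0 by apply: skew_odd_det0 => //; move: en; rewrite /= negbK.
pose w : 'rV[K]_n.+1 := \row_j (if unlift i j is Some k then w0 0 k else 0).
have wl k : w 0 (lift i k) = w0 0 k by rewrite mxE liftK.
have wi : w 0 i = 0 by rewrite mxE unlift_none.
have wAl k : (w *m A) 0 (lift i k) = 0.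
  have /rowP/(_ k) := w0B; rewrite !mxE => E; rewrite -[RHS]E (bigD1_ord i) //=.
  by rewrite wi mul0r add0r; apply: eq_bigr => l _; rewrite wl !mxE.
have wA : w *m A = 0.
  apply/rowP=> j; rewrite [RHS]mxE; case: (unliftP i j) => [k ->|->]; first exact: wAl.
  have : (w *m A *m u^T) 0 0 = 0.
    have -> : w *m A *m u^T = - (w *m (u *m A)^T).
      by rewrite trmx_mul skew mulNmx mulmxN opprK mulmxA.
    by rewrite uA trmx0 mulmx0 oppr0 mxE.
  rewrite mxE (bigD1_ord i) //= big1 ?addr0 => [|k _]; last by rewrite wAl mul0r.
  by rewrite [u^T _ _]mxE => /eqP; rewrite mulf_eq0 (negPf ui) orbF => /eqP.
exists i, u, w; split=> //; have [k wk] := rV0Pn _ w0_neq0.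
by apply/rV0Pn; exists (lift i k); rewrite wl.
Qed.

Lemma eigenvectors_independent n m (T : 'M[K]_n) (mu : 'I_m -> K) (e : 'I_m -> 'rV[K]_n) :
  injective mu -> (forall i, e i *m T = mu i *: e i) -> \sum_i e i = 0 ->
  forall i, e i = 0.
Proof.
move=> mu_inj eT e0 i; have := @mxdirect_sum_eigenspace _ _ _ T xpredT mu (in2W mu_inj).
move=> /mxdirect_sumsP/(_ i isT) cap0; apply/eqP; rewrite -submx0 -cap0 sub_capmx.
apply/andP; split; first exact/eigenspaceP.
have -> : e i = - \sum_(j | j != i) e j.
  by apply/eqP; rewrite -addr_eq0; apply/eqP; rewrite -[RHS]e0 [RHS](bigD1 i).
by rewrite eqmx_opp summx_sub_sums // => j _; exact/eigenspaceP.
Qed.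

(** Eigenvectors of a pencil for distinct eigenvalues are orthogonal for both
   forms, by the usual symmetry argument. *)
Lemma eigen_form_orth n (F G : 'M[K]_n) (a b : K) (u v : 'rV[K]_n) :
  F^T = - F -> G^T = - G -> u *m G = a *: (u *m F) -> v *m G = b *: (v *m F) ->
  a != b -> u *m F *m v^T = 0 /\ u *m G *m v^T = 0.
Proof.
move=> skF skG uG vG ab.
have swap H : H^T = - H -> u *m H *m v^T = - (v *m H *m u^T)^T.
  by move=> skH; rewrite !trmx_mul trmxK skH mulNmx mulmxN opprK mulmxA.
have F0 : u *m F *m v^T = 0.
  have : a *: (u *m F *m v^T) = b *: (u *m F *m v^T).
    rewrite scalemxAl -uG (swap G) // vG -scalemxAl linearZ /= -scalerN; congr (_ *: _).
    by rewrite -swap.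
  move/eqP; rewrite -subr_eq0 -scalerBl scaler_eq0 subr_eq0 (negPf ab).
  by move/eqP.
by split; rewrite // uG -scalemxAl F0 scaler0.
Qed.

(** With m distinct eigenvalues, the planes of eigenvectors given by
   [skew_even_corank] span the space of dimension 2m. *)
Lemma skew_pair_block m (F G : 'M[K]_m.*2) (mu : 'I_m -> K) :
  F^T = - F -> G^T = - G -> F \in unitmx -> injective mu ->
  (forall i, \det (G - mu i *: F) = 0) ->
  exists2 P : 'M[K]_m.*2, P \in unitmx & forall k l, pair_index k != pair_index l ->
    (P *m F *m P^T) k l = 0 /\ (P *m G *m P^T) k l = 0.
Proof.
move=> skF skG uF mu_inj det0.
have /fin_all_exists[x] i : exists x : 'I_m.*2 * ('rV[K]_m.*2 * 'rV[K]_m.*2),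
    [/\ x.2.1 *m G = mu i *: (x.2.1 *m F), x.2.2 *m G = mu i *: (x.2.2 *m F),
        x.2.1 0 x.1 != 0, x.2.2 0 x.1 = 0 & x.2.2 != 0].
  have skA : (G - mu i *: F)^T = - (G - mu i *: F).
    by rewrite linearB linearZ /= skF skG scalerN opprB opprK addrC.
  have [|k [u [w [uA wA uk wk w0]]]] := skew_even_corank _ skA (det0 i).
    by rewrite odd_double.
  exists (k, (u, w)); split=> //; apply/eqP; rewrite -subr_eq0 scalemxAr -mulmxBr.
    by rewrite uA.
  by rewrite wA.
move=> xP.
(* The two eigenvectors for mu i become the rows lft i and rgt i of P. *)
pose r k := if odd (k : 'I_m.*2) then (x (pair_index k)).2.2 else (x (pair_index k)).2.1.
pose P := \matrix_k r k.
have rG k : r k *m G = mu (pair_index k) *: (r k *m F).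
  by rewrite /r; have [? ? _ _ _] := xP (pair_index k); case: ifP.
have rl i : r (lft i) = (x i).2.1 by rewrite /r lftK /= odd_double.
have rr i : r (rgt i) = (x i).2.2 by rewrite /r rgtK /= odd_double.
exists P.
  rewrite -row_free_unit -kermx_eq0; apply/eqP/row_matrixP => j; rewrite row0.
  set y := row j _; have : y *m P = 0 by apply/sub_kermxP; exact: row_sub.
  rewrite mulmx_sum_row sum_pairs.
  under eq_bigr => i _ do rewrite !rowK rl rr.
  set e := BIG_F => e0.
  have eT i : e i *m (G *m invmx F) = mu i *: e i.
    rewrite /e mulmxDl -!scalemxAl scalerDr !mulmxA.
    have [-> -> _ _ _] := xP i; rewrite -!scalemxAl !mulmxK //.
    by rewrite !scalerA !(mulrC (mu i)).
  have {}e0 := eigenvectors_independent mu_inj eT e0.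
  apply/rowP=> k; rewrite [RHS]mxE.
  have [_ _ u0 w0 wn0] := xP (pair_index k).
  have yl : y 0 (lft (pair_index k)) = 0.
    have /rowP/(_ (x (pair_index k)).1) := e0 (pair_index k).
    rewrite [RHS]mxE mxE [X in X + _]mxE [X in _ + X]mxE w0 mulr0 addr0.
    by move=> /eqP; rewrite mulf_eq0 (negPf u0) orbF => /eqP.
  have yr : y 0 (rgt (pair_index k)) = 0.
    have := e0 (pair_index k); rewrite /e yl scale0r add0r => /eqP.
    by rewrite scaler_eq0 (negPf wn0) orbF => /eqP.
  move: yl yr; case: (pairP k) => i ->; rewrite ?lftK ?rgtK //.
move=> k l kl; have PE (H : 'M[K]_m.*2) : (P *m H *m P^T) k l = (r k *m H *m (r l)^T) 0 0.
  rewrite !mxE; apply: eq_bigr => t _; rewrite !mxE; congr (_ * _).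
  by apply: eq_bigr => s _; rewrite !mxE.
have [|F0 G0] := eigen_form_orth skF skG (rG k) (rG l).
  by apply: contra kl => /eqP/mu_inj ->.
by rewrite !PE F0 G0 mxE.
Qed.

End Skew.

Section Hankel.
Variable K : numClosedFieldType.

(** All eigenvalues vanish, so the characteristic polynomial is a power of the
   variable. *)
Lemma nilpotent_trace0 n (N : 'M[K]_n.+1) k : N ^+ k = 0 -> \tr N = 0.
Proof.
move=> Nk; have [r] := closed_field_poly_normal (char_poly N).
rewrite (eqP (char_poly_monic N)) scale1r => rE.
have r0 z : z \in r -> z = 0.
  move=> zr; have /eigenvalueP[v vN v0] : eigenvalue N z.
    by rewrite eigenvalue_root_char rE root_prod_XsubC.
  have vNk j : v *m N ^+ j = z ^+ j *: v.
    elim: j => [|j IHj]; first by rewrite mulmx1 scale1r.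
    by rewrite exprSr mulmxA IHj -scalemxAl vN scalerA exprSr.
  have := vNk k; rewrite Nk mulmx0 => /esym/eqP; rewrite scaler_eq0 (negPf v0) orbF.
  by rewrite expf_eq0 => /andP[_ /eqP].
have cE : char_poly N = 'X^(n.+1).
  have sz : size r = n.+1.
    have := size_char_poly N; rewrite rE size_prod_XsubC => -[->] //.
  rewrite rE big_seq (eq_bigr (fun=> 'X)) => [|z /r0 ->]; last by rewrite subr0.
  by rewrite -big_seq big_const_seq count_predT iter_mulr_1 sz.
have := char_poly_trace N (ltn0Sn n); rewrite cE coefXn /= ltn_eqF //.
by move/eqP; rewrite eq_sym oppr_eq0 => /eqP.
Qed.

(** If T has fewer than m distinct eigenvalues, the polynomial q with these as
   simple roots has degree less than m; q(T) is nilpotent, so all traces of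
   q(T) T^i vanish and the coefficients of q are in the kernel of the Hankel
   matrix. *)
Lemma hankel_eigenvalues n m (T : 'M[K]_n.+1) :
  \det (\matrix_(i < m, j < m) \tr (T ^+ (i + j))) != 0 ->
  exists2 mu : 'I_m -> K, injective mu & forall i, eigenvalue T (mu i).
Proof.
move=> det_neq0; have [r] := closed_field_poly_normal (char_poly T).
rewrite (eqP (char_poly_monic T)) scale1r => rE.
have [mr|rm] := leqP m (size (undup r)).
  exists (fun i : 'I_m => (undup r)`_i) => [i j /eqP|i].
    rewrite nth_uniq ?undup_uniq ?(leq_trans (ltn_ord _)) // => /eqP.
    exact: val_inj.
  rewrite eigenvalue_root_char rE root_prod_XsubC -mem_undup.
  by rewrite mem_nth // (leq_trans (ltn_ord i)).
pose q := \prod_(z <- undup r) ('X - z%:P).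
have qnil : horner_mx T q ^+ size r = 0.
  rewrite -rmorphXn /=; suff /dvdpP[s ->] : char_poly T %| q ^+ size r.
    by rewrite rmorphM /= Cayley_Hamilton mulr0.
  have : all (mem (undup r)) r by apply/allP => z; rewrite /= mem_undup.
  rewrite rE; elim: {2 3 4}r => [|z s IHs] /=; first by rewrite big_nil dvd1p.
  move=> /andP[zr sr]; rewrite big_cons exprS dvdp_mul ?IHs //.
  by rewrite dvdp_XsubCl root_prod_XsubC.
case/negP: det_neq0; rewrite -det_tr; apply/det0P; exists (\row_(j < m) q`_j).
  have szq : size q = (size (undup r)).+1 by exact: size_prod_XsubC.
  apply/rV0Pn; exists (Ordinal rm); rewrite mxE /=.
  have -> : size (undup r) = (size q).-1 by rewrite szq.
  by rewrite -lead_coefE (eqP (monic_prod_XsubC _ _ _)) oner_neq0.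
apply/rowP=> i; rewrite mxE [RHS]mxE.
transitivity (\tr (horner_mx T (q * 'X^i))).
  have qE : q = \sum_(j < m) q`_j *: 'X^j.
    rewrite -poly_def; apply/polyP=> j; rewrite coef_poly.
    case: ltnP => // mj; rewrite nth_default // (leq_trans _ mj) //.
    by rewrite size_prod_XsubC.
  rewrite [in RHS]qE mulr_suml !raddf_sum /=; apply: eq_bigr => j _.
  by rewrite !mxE -scalerAl -exprD linearZ /= mxtraceZ rmorphXn /= horner_mx_X addnC.
apply: (@nilpotent_trace0 _ _ (size r)).
rewrite -rmorphXn /= exprMn rmorphM rmorphXn /= qnil; exact: mul0r.
Qed.

End Hankel.

Section SkewMatrix.

(** The alternating matrix with prescribed entries above the diagonal; coefficients of
   quadratic forms are indexed by sets with two elements. *)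
Definition skew_mx (A : zmodType) n (c : {set 'I_n} -> A) : 'M[A]_n :=
  \matrix_(i, j) if (i < j)%N then c [set i; j] else
                 if (j < i)%N then - c [set j; i] else 0.

(** When it is nonzero the pencil G - mu F has at least m distinct eigenvalues.
   The adjugate replaces the inverse of F to make this a polynomial in the entries. *)
Definition pencil_disc (A : comNzRingType) n m (F G : 'M[A]_n) : A :=
  \det F * \det (\matrix_(i < m, j < m) \tr ((G *m \adj F) ^+ (i + j))).

Lemma skew_mx_skew (A : zmodType) n (c : {set 'I_n} -> A) : (skew_mx c)^T = - skew_mx c.
Proof.
apply/matrixP=> i j; rewrite !mxE.
by case: ltngtP => _; rewrite ?opprK ?oppr0.
Qed.

Lemma map_skew_mx (A B : zmodType) (h : {additive A -> B}) n (c : {set 'I_n} -> A) :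
  map_mx h (skew_mx c) = skew_mx (h \o c).
Proof.
apply/matrixP=> i j; rewrite !mxE.
by case: ltngtP => _; rewrite ?raddfN ?raddf0.
Qed.

Lemma eq_skew_mx (A : zmodType) n (c d : {set 'I_n} -> A) :
  (forall S : {set 'I_n}, #|S| = 2 -> c S = d S) -> skew_mx c = skew_mx d.
Proof.
move=> cd; apply/matrixP=> i j; rewrite !mxE.
by case: ltngtP => // ij; rewrite cd // cards2 neq_ltn ij ?orbT.
Qed.

Lemma map_pencil_disc (A B : comNzRingType) (h : {rmorphism A -> B}) n m
    (F G : 'M[A]_n) :
  pencil_disc m (map_mx h F) (map_mx h G) = h (pencil_disc m F G).
Proof.
rewrite /pencil_disc rmorphM /= -!det_map_mx; congr (_ * \det _).
apply/matrixP=> i j; rewrite !mxE -map_mx_adj -map_mxM -trace_map_mx.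
congr (\tr _); elim: (i + j)%N => [|k IHk]; first by rewrite map_mx1.
by rewrite !exprS IHk; exact/esym/map_mxM.
Qed.

End SkewMatrix.

Section GenericPencil.
Variable K : numClosedFieldType.

Section Block.
Variable m : nat.
Implicit Types (d : 'I_m -> K) (i j : 'I_m) (k l : 'I_m.*2).

Definition block_coef d (S : {set 'I_m.*2}) : K :=
  \sum_i (S == [set lft i; rgt i])%:R * d i.

Lemma block_coefE d k l : (k < l)%N -> block_coef d [set k; l] =
  ((k == lft (pair_index k)) && (l == rgt (pair_index k)))%:R * d (pair_index k).
Proof.
move=> kl; have memP i : [set k; l] = [set lft i; rgt i] -> k = lft i /\ l = rgt i.
  move=> /setP E; have := E k; have := E l; rewrite !inE !eqxx orbT /=.
  move=> /esym/orP[]/eqP lE /esym/orP[]/eqP kE //; move: kl; rewrite lE kE /= ?ltnn //.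
  by rewrite ltnNge leqnSn.
rewrite /block_coef (bigD1 (pair_index k)) //= big1 ?addr0 => [|i ik].
  congr ((nat_of_bool _)%:R * _); apply/eqP/andP => [/memP[kE lE]|[/eqP kE /eqP lE]].
    by rewrite -kE -lE !eqxx.
  by rewrite -kE -lE.
case: eqP => [/memP[kE _]|_]; last by rewrite mul0r.
by rewrite kE lftK eqxx in ik.
Qed.

Lemma skew_block_lft d i l : skew_mx (block_coef d) (lft i) l = (l == rgt i)%:R * d i.
Proof.
rewrite mxE; case: ltngtP => [il|li|/val_inj <-]; last first.
- by rewrite (negPf (lft_neq_rgt _ _)) mul0r.
- rewrite block_coefE //.
  have -> : (l == rgt i) = false by apply/eqP => E; move: li; rewrite E /=; lia.
  rewrite (_ : _ && _ = false) ?mul0r ?oppr0 //.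
  by apply/negP => /andP[_]; rewrite (negPf (lft_neq_rgt _ _)).
- by rewrite block_coefE // lftK eqxx.
Qed.

Lemma skew_block_rgt d i l : skew_mx (block_coef d) (rgt i) l = - ((l == lft i)%:R * d i).
Proof.
rewrite -[LHS]opprK; have /matrixP/(_ l (rgt i)) := skew_mx_skew (block_coef d).
rewrite [LHS]mxE [RHS]mxE => ->; congr (- _); rewrite opprK.
case: (pairP l) => j ->.
  rewrite skew_block_lft (inj_eq (@rgt_inj m)) (inj_eq (@lft_inj m)) eq_sym.
  by case: eqP => [->|_]; rewrite ?mul0r.
rewrite mxE; case: ltngtP => [ji|ij|/val_inj/rgt_inj E].
- rewrite block_coefE // rgtK eq_sym (negPf (lft_neq_rgt _ _)) mul0r.
  by rewrite eq_sym (negPf (lft_neq_rgt _ _)) mul0r.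
- rewrite block_coefE // rgtK [rgt i == _]eq_sym (negPf (lft_neq_rgt _ _)) mul0r oppr0.
  by rewrite eq_sym (negPf (lft_neq_rgt _ _)) mul0r.
- by rewrite eq_sym (negPf (lft_neq_rgt _ _)) mul0r.
Qed.

(** A point where the polynomial does not vanish: on the forms with blocks 1 and
   d_i, the product of G and the adjugate of F is diagonal with each of the values
   det F d_i twice, and the Hankel matrix is twice the product of a Vandermonde
   matrix by its transpose. *)
Lemma pencil_disc_block (d : 'I_m -> K) : injective d ->
  pencil_disc m (skew_mx (block_coef (fun=> 1))) (skew_mx (block_coef d)) != 0.
Proof.
move=> d_inj; set F := skew_mx (block_coef (fun=> 1)); set G := skew_mx (block_coef d).
have Fl i l : F (lft i) l = (l == rgt i)%:R by rewrite skew_block_lft mulr1.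
have Fr i l : F (rgt i) l = - (l == lft i)%:R by rewrite skew_block_rgt mulr1.
have FF : F *m F = - 1%:M.
  apply/matrixP=> k l; rewrite !mxE; case: (pairP k) => i ->.
    rewrite (bigD1 (rgt i)) //= big1 ?addr0 => [|t /negPf ti].
      by rewrite Fl eqxx mul1r Fr eq_sym.
    by rewrite Fl ti mul0r.
  rewrite (bigD1 (lft i)) //= big1 ?addr0 => [|t /negPf ti].
    by rewrite Fr eqxx mulN1r Fl eq_sym.
  by rewrite Fr ti oppr0 mul0r.
have detF : \det F != 0.
  have : \det (F *m F) != 0.
    by rewrite FF -scaleN1r detZ det1 mulr1 expf_neq0 // oppr_eq0 oner_neq0.
  by rewrite det_mulmx mulf_eq0 negb_or => /andP[].
rewrite mulf_neq0 //; set del := \det F in detF *.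
pose a : 'rV[K]_m := \row_i (del * d i).
have GF : G *m \adj F = diag_mx (\row_k (del * d (pair_index k))).
  have -> : G = diag_mx (\row_k d (pair_index k)) *m F.
    apply/matrixP=> k l; rewrite mul_diag_mx [RHS]mxE [X in _ = X * _]mxE.
    case: (pairP k) => i ->.
      by rewrite skew_block_lft Fl ?lftK mulrC.
    by rewrite skew_block_rgt Fr ?rgtK mulrN mulrC.
  rewrite -mulmxA mul_mx_adj; apply/matrixP=> k l.
  by rewrite mul_diag_mx !mxE mulrnAr mulrC.
have -> : \matrix_(i < m, j < m) \tr ((G *m \adj F) ^+ (i + j)) =
    2%:R *: (Vandermonde m a *m (Vandermonde m a)^T).
  have powE (k : nat) : (G *m \adj F) ^+ k = diag_mx (\row_l (del * d (pair_index l)) ^+ k).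
    elim: k => [|k IHk].
      by rewrite expr0; apply/matrixP=> s t; rewrite !mxE expr0.
    rewrite exprS IHk GF [LHS]mulmx_diag; congr diag_mx; apply/rowP=> l.
    by rewrite !mxE exprS.
  apply/matrixP=> i j; rewrite mxE powE mxtrace_diag sum_pairs.
  rewrite [RHS]mxE [X in _ = _ * X]mxE mulr_sumr; apply: eq_bigr => k _.
  by rewrite !mxE lftK rgtK exprD -mulr2n mulr_natl.
rewrite detZ det_mulmx det_tr mulf_neq0 ?expf_neq0 ?pnatr_eq0 //.
have V0 : \det (Vandermonde m a) != 0.
  rewrite det_Vandermonde; apply/prodf_neq0 => i _; apply/prodf_neq0 => j ij.
  rewrite !mxE -mulrBr mulf_neq0 // subr_eq0; apply: contraTneq ij => /d_inj ->.
  by rewrite ltnn.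
by rewrite mulf_neq0.
Qed.

End Block.

(** The polynomial is nonzero because it is nonzero on the blocks d_i = i. *)
Lemma generic_pencil_disc m (f g : {set 'I_m.*2} -> K) :
  alg_indep_rat (fun k : bool * {A : {set 'I_m.*2} | #|A| == 2} =>
      (if k.1 then f else g) (val k.2)) ->
  pencil_disc m (skew_mx f) (skew_mx g) != 0.
Proof.
set I := (bool * _)%type; set c := (fun k => _) => indep.
pose X b S : {mpoly rat[#|{: I}|]} :=
  if insub S is Some s then 'X_(enum_rank ((b, s) : I)) else 0.
pose D := pencil_disc m (skew_mx (X true)) (skew_mx (X false)).
have DE (e : bool -> {set 'I_m.*2} -> K) :
    rat_eval (fun k : I => e k.1 (val k.2)) D = pencil_disc m (skew_mx (e true)) (skew_mx (e false)).
  rewrite -map_pencil_disc !map_skew_mx; congr pencil_disc; apply: eq_skew_mx => S S2 /=;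
    by rewrite /X insubT ?S2 // => S2'; rewrite rat_evalX.
have := DE (fun b => if b then f else g); rewrite /= => <-.
pose e (b : bool) := block_coef (if b then fun=> 1 else fun i : 'I_m => i%:R : K).
apply: (generic_neq0 (c' := fun k : I => e k.1 (val k.2))).
  by apply: eq_alg_indep indep.
rewrite DE; apply: (@pencil_disc_block m (fun i => i%:R)).
by move=> i j /eqP; rewrite eqr_nat => /eqP/val_inj.
Qed.

Lemma generic_pencil_block m (f g : {set 'I_m.*2} -> K) : (0 < m)%N ->
  alg_indep_rat (fun k : bool * {A : {set 'I_m.*2} | #|A| == 2} =>
      (if k.1 then f else g) (val k.2)) ->
  exists2 P : 'M[K]_m.*2, P \in unitmx & forall k l, pair_index k != pair_index l ->
    (P *m skew_mx f *m P^T) k l = 0 /\ (P *m skew_mx g *m P^T) k l = 0.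
Proof.
case: m f g => [//|m] f g _ /generic_pencil_disc.
set F := skew_mx f; set G := skew_mx g; rewrite mulf_eq0 negb_or => /andP[detF].
move=> /(@hankel_eigenvalues K _ m.+1)[mu mu_inj muE].
have uF : F \in unitmx by rewrite unitmxE unitfE.
apply: (@skew_pair_block K _ F G (fun i => mu i / \det F)); rewrite ?skew_mx_skew //.
  by move=> i j /(mulIf _)/mu_inj->; rewrite ?invr_eq0.
move=> i; have /eigenvalueP[v vT v0] := muE i; apply/eqP/det0P; exists v => //.
have {}vT : v *m (G *m \adj F) = mu i *: v := vT.
have vGF : \det F *: (v *m G) = mu i *: (v *m F).
  by rewrite [RHS]scalemxAl -vT -!mulmxA mul_adj_mx mul_mx_scalar -scalemxAr.
apply: (can_inj (scalerK detF)); rewrite scaler0 mulmxBr -scalemxAr scalerBr vGF.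
by rewrite scalerA mulrC divfK // subrr.
Qed.

End GenericPencil.

(** * Quadratic forms in block form *)

Section GenericQuadratic.
Variable K : numFieldType.

Lemma ratr_ext_sign n (A B : {set 'I_n}) : ratr (ext_sign rat A B) = ext_sign K A B.
Proof.
by rewrite /ext_sign; case: ifP => _; rewrite ?rmorph0 // rmorphXn rmorphN rmorph1.
Qed.

Lemma generic_ext_dual_le n (f g f' g' : extalg K n) s :
  generic_quadratic_pair f g -> ext_homog 2 f' -> ext_homog 2 g' ->
  (\dim (ext_dual f g s) <= \dim (ext_dual f' g' s))%N.
Proof.
move=> [f2 g2 indep] f2' g2'; pose I := (bool * {A : {set 'I_n} | #|A| == 2})%type.
pose w (q : bool * {set 'I_n}) (A : {set 'I_n}) (k : I) : rat :=
  ((k.1 == q.1) && (q.2 :|: val k.2 == A))%:R * ext_sign rat q.2 (val k.2).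
pose c (u v : extalg K n) (k : I) := ext_coef (if k.1 then u else v) (val k.2).
have E u v q A : ext_homog 2 u -> ext_homog 2 v ->
    ext_coef (ext_monom K q.2 * (if q.1 then u else v : extalg K n)) A =
    ratr 0 + \sum_k ratr (w q A k) * c u v k.
  move=> /ext_homogP u2 /ext_homogP v2; rewrite rmorph0 add0r ext_coef_monomM.
  rewrite -(pair_bigA _ (fun x y => ratr (w q A (x, y)) * c u v (x, y))) /=.
  rewrite (bigD1 q.1) //= [X in _ = _ + X]big1 ?addr0; last first.
    by move=> b /negPf bq; rewrite big1 // => y _; rewrite /w /= bq mul0r rmorph0 mul0r.
  rewrite (bigID (fun C : {set 'I_n} => #|C| == 2)) /= [X in _ + X]big1 ?addr0; last first.
    by move=> C /andP[_ C2]; case: q.1; rewrite ?u2 ?v2 ?mulr0.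
  under eq_bigl => C do rewrite andbC.
  rewrite big_mkcondr /= [LHS](big_sub (fun C : {set 'I_n} => #|C| == 2)).
  apply: eq_bigr => C _; rewrite /w /c /= eqxx rmorphM rmorph_nat /= ratr_ext_sign.
  by case: eqP => _; rewrite ?mul1r ?mul0r.
rewrite /ext_dual (eq_sol_space _ (fun q A => E f g q A f2 g2)).
rewrite (eq_sol_space _ (fun q A => E f' g' q A f2' g2')).
exact: (generic_affine_sol_space_le _ _ (fun _ _ => 0) w indep).
Qed.

End GenericQuadratic.

Section BlockForm.
Variables (K : fieldType) (m : nat).
Implicit Types (a b : 'I_m -> K) (A B : {set 'I_m.*2}) (D E S Z : {set 'I_m}).
Implicit Types (x : {set 'I_m} * {set 'I_m}).

(** A linear form in the even elements x_(2i) x_(2i+1). *)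
Definition block_form b : extalg K m.*2 := \sum_i b i *: ext_monom K [set lft i; rgt i].

Lemma block_form_homog b : ext_homog 2 (block_form b).
Proof.
apply/ext_homogP => A A2; rewrite ext_coef_sum big1 // => i _.
rewrite ext_coefZ ext_coef_monom; have [AE|_] := eqVneq A [set lft i; rgt i]; last exact: mulr0.
by rewrite AE cards2 lft_neq_rgt eqxx in A2.
Qed.

(** The two elements of a pair are consecutive, so that any third generator passes
   both of them or none. *)
Lemma ext_sign_pair B i : lft i \notin B -> rgt i \notin B ->
  ext_sign K B [set lft i; rgt i] = 1.
Proof.
move=> lB rB; rewrite /ext_sign; have -> : [disjoint B & [set lft i; rgt i]].
  rewrite disjoint_sym -setI_eq0; apply/eqP/setP => k; rewrite !inE.
  have [->|_] := eqVneq k (lft i); first by rewrite (negPf lB) andbF.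
  by have [->|_] := eqVneq k (rgt i); first by rewrite (negPf rB).
rewrite -signr_odd; suff -> : odd (ext_inv B [set lft i; rgt i]) = false by [].
rewrite /ext_inv (eq_bigr (fun k : 'I_m.*2 => 2 * (lft i < k)))%N => [|k kB].
  by rewrite -big_distrr oddM.
rewrite big_setU1 ?inE ?lft_neq_rgt // big_set1 [RHS]mul2n -[RHS]addnn; congr (_ + nat_of_bool _)%N.
have ki : k != lft i by apply: contraNneq lB => <-.
have kr : k != rgt i by apply: contraNneq rB => <-.
by move: ki kr; rewrite -!val_eqE /=; lia.
Qed.

Lemma ext_coef_block b B A : ext_coef (ext_monom K B * block_form b) A =
  \sum_(i | [&& lft i \notin B, rgt i \notin B & lft i |: (rgt i |: B) == A]) b i.
Proof.
rewrite mulr_sumr ext_coef_sum [RHS]big_mkcond; apply: eq_bigr => i _.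
rewrite -scalerAr ext_coefZ ext_monomM ext_coefZ ext_coef_monom.
have [lB|lB] /= := boolP (lft i \in B).
  rewrite /ext_sign disjoint_sym -setI_eq0; case: eqP => [/setP/(_ (lft i))|_].
    by rewrite !inE eqxx lB.
  by rewrite mul0r mulr0.
have [rB|rB] /= := boolP (rgt i \in B).
  rewrite /ext_sign disjoint_sym -setI_eq0; case: eqP => [/setP/(_ (rgt i))|_].
    by rewrite !inE eqxx rB orbT.
  by rewrite mul0r mulr0.
rewrite ext_sign_pair // mul1r [B :|: _]setUC -setUA eq_sym.
by case: eqP => _; rewrite ?mulr1 ?mulr0.
Qed.

(** The generators that a monomial takes without their partner, as sets of pair
   indices, first those on the left and then those on the right. *)
Definition single A : {set 'I_m} * {set 'I_m} :=
  ((@lft m @^-1: A) :\: (@rgt m @^-1: A), (@rgt m @^-1: A) :\: (@lft m @^-1: A)).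

Definition double_part A : {set 'I_m} := (@lft m @^-1: A) :&: (@rgt m @^-1: A).

Definition glue x D : {set 'I_m.*2} := (@lft m @: (x.1 :|: D)) :|: (@rgt m @: (x.2 :|: D)).

Lemma lft_glue x D i : (lft i \in glue x D) = (i \in x.1) || (i \in D).
Proof.
rewrite inE mem_imset ?inE; last exact: lft_inj.
rewrite orbC; case: imsetP => [[j _ /eqP]|//].
by rewrite (negPf (lft_neq_rgt _ _)).
Qed.

Lemma rgt_glue x D i : (rgt i \in glue x D) = (i \in x.2) || (i \in D).
Proof.
rewrite inE orbC mem_imset ?inE; last exact: rgt_inj.
rewrite orbC; case: imsetP => [[j _ /eqP]|//].
by rewrite eq_sym (negPf (lft_neq_rgt _ _)).
Qed.

Lemma pair_setP A B :
  (forall i, (lft i \in A) = (lft i \in B)) -> (forall i, (rgt i \in A) = (rgt i \in B)) -> A = B.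
Proof. by move=> l r; apply/setP=> k; case: (pairP k) => i ->. Qed.

Lemma in_double A i : (i \in double_part A) = (lft i \in A) && (rgt i \in A).
Proof. by rewrite !inE. Qed.

Lemma in_single1 A i : (i \in (single A).1) = (lft i \in A) && (rgt i \notin A).
Proof. by rewrite !inE andbC. Qed.

Lemma in_single2 A i : (i \in (single A).2) = (rgt i \in A) && (lft i \notin A).
Proof. by rewrite !inE andbC. Qed.

Lemma glueK A : glue (single A) (double_part A) = A.
Proof.
by apply: pair_setP => i; rewrite ?lft_glue ?rgt_glue !inE;
   case: (lft i \in A); case: (rgt i \in A).
Qed.

Lemma single_disjoint A : [disjoint (single A).1 & (single A).2].
Proof.
rewrite -setI_eq0; apply/eqP/setP => i; rewrite !inE.
by case: (lft i \in A); case: (rgt i \in A).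
Qed.

Lemma single_double A : double_part A \subset ~: ((single A).1 :|: (single A).2).
Proof.
apply/subsetP => i; rewrite !inE.
by case: (lft i \in A); case: (rgt i \in A).
Qed.

Lemma double_glue x D : [disjoint x.1 & x.2] -> double_part (glue x D) = D.
Proof.
rewrite -setI_eq0 => /eqP/setP x12; apply/setP => i.
rewrite in_double lft_glue rgt_glue; have := x12 i; rewrite !inE.
by case: (i \in x.1); case: (i \in x.2); case: (i \in D).
Qed.

Lemma single_glue x D : [disjoint x.1 & x.2] -> D \subset ~: (x.1 :|: x.2) ->
  single (glue x D) = x.
Proof.
rewrite -setI_eq0 => /eqP/setP x12 /subsetP Dx.
by rewrite [RHS]surjective_pairing; congr (_, _); apply/setP => i;
  rewrite ?in_single1 ?in_single2 lft_glue rgt_glue; have := x12 i; have := Dx i;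
  rewrite !inE;
  case: (i \in x.1); case: (i \in x.2); case: (i \in D) => // /(_ isT).
Qed.

Lemma card_glue x D : [disjoint x.1 & x.2] -> D \subset ~: (x.1 :|: x.2) ->
  #|glue x D| = (#|x.1 :|: x.2| + #|D|.*2)%N.
Proof.
move=> x12 Dx; have := Dx; rewrite subsetC -disjoints_subset => xD.
have x1D : [disjoint x.1 & D].
  exact: (disjointWl (subsetUl _ _) xD).
have x2D : [disjoint x.2 & D].
  exact: (disjointWl (subsetUr _ _) xD).
have lr : [disjoint (@lft m @: (x.1 :|: D)) & (@rgt m @: (x.2 :|: D))].
  rewrite -setI_eq0; apply/eqP/setP => k; rewrite !inE.
  apply/negbTE/negP => /andP[/imsetP[i _ ->] /imsetP[j _ /eqP]].
  by rewrite (negPf (lft_neq_rgt _ _)).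
rewrite /glue [LHS]cardsU (disjoint_setI0 lr) cards0 subn0 !card_imset;
  [|exact: rgt_inj|exact: lft_inj].
rewrite !cardsU (disjoint_setI0 x1D) (disjoint_setI0 x2D) (disjoint_setI0 x12).
by rewrite !cards0 !subn0 addnACA addnn.
Qed.

Lemma glueU1 x D i : lft i |: (rgt i |: glue x D) = glue x (i |: D).
Proof.
apply: pair_setP => j; rewrite !in_setU1 ?lft_glue ?rgt_glue !inE.
  rewrite (inj_eq (@lft_inj m)) (negPf (lft_neq_rgt _ _)) /=.
  by case: (j == i); rewrite ?orbT.
rewrite (inj_eq (@rgt_inj m)) eq_sym (negPf (lft_neq_rgt _ _)) /=.
by case: (j == i); rewrite ?orbT.
Qed.

(** Multiplication by x_(2i) x_(2i+1) adds a full pair, or gives zero when one of the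
   two generators is present.  So it preserves the single generators x, and for a
   given x it acts on the set of full pairs as multiplication by the variable y_i in
   the squarefree algebra on the pairs that x does not touch. *)
Lemma dim_ext_dual_block b a s :
  \dim (ext_dual (block_form b) (block_form a) s) =
  (\sum_(x : {set 'I_m} * {set 'I_m} | [disjoint x.1 & x.2])
     let j := #|x.1 :|: x.2| in
     if (j <= s) && ~~ odd (s - j) then
       \dim (sqfree_dual b a (~: (x.1 :|: x.2)) (s - j)./2) else 0)%N.
Proof.
pose c (q : bool) := if q then b else a.
have rowE (q : bool * {set 'I_m.*2}) A :
    ext_coef (ext_monom K q.2 * (if q.1 then block_form b else block_form a)) A =
    \sum_(i | [&& lft i \notin q.2, rgt i \notin q.2 & lft i |: (rgt i |: q.2) == A]) c q.1 i.
  by rewrite /c; case: q.1; exact: ext_coef_block.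
pose rows (q : bool * {set 'I_m.*2}) A :=
  \sum_(i | [&& lft i \notin q.2, rgt i \notin q.2 & lft i |: (rgt i |: q.2) == A]) c q.1 i.
have rows_single q A : rows q A != 0 -> single A = single q.2.
  apply: contraNeq => Aq; rewrite /rows big_pred0 // => i; apply/negbTE.
  apply: contra Aq => /and3P[lB rB /eqP <-].
  apply/eqP; rewrite -{1}(glueK q.2) glueU1 single_glue ?single_disjoint //.
  rewrite subUset single_double andbT sub1set !inE.
  by rewrite (negPf lB) (negPf rB).
rewrite /ext_dual.
have -> : sol_space [pred A : {set 'I_m.*2} | #|A| == s]
    (fun q A => ext_coef (ext_monom K q.2 * (if q.1 then block_form b else block_form a)) A)
    = sol_space [pred A : {set 'I_m.*2} | #|A| == s] rows.
  exact: eq_sol_space.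
rewrite (dim_sol_space_fibers _ rows_single) [RHS]big_mkcond /=; apply: eq_bigr => x _.
case: ifP => [x12|/negP x12]; last first.
  apply: dim_sol_space_empty => A /=; apply/negP => /andP[_ /eqP xA].
  by apply: x12; rewrite -xA single_disjoint.
have [/andP[js sj]|jsF] := ifPn; last first.
  apply: dim_sol_space_empty => A /=; apply/negP => /andP[/eqP As /eqP xA].
  case/negP: jsF; rewrite -As -(glueK A) xA card_glue //; last by rewrite -xA single_double.
  by rewrite leq_addr addKn odd_double.
(* For monomials with the same single generators the equations are those of the
   squarefree algebra. *)
have rows_glue q E D : E \subset ~: (x.1 :|: x.2) -> D \subset ~: (x.1 :|: x.2) ->
    rows (q, glue x E) (glue x D) = sqfree_mx b a (q, E) D.
  move=> Ex Dx; apply: eq_big => i; last by rewrite /c /=; case: q.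
  rewrite /= lft_glue rgt_glue glueU1.
  have -> : (glue x (i |: E) == glue x D) = (i |: E == D).
    apply/eqP/eqP => [/(congr1 double_part)|->//]; by rewrite !double_glue.
  rewrite !negb_or; case: eqP => [ED|_]; last by rewrite !andbF.
  have : i \in ~: (x.1 :|: x.2) by apply: (subsetP Dx); rewrite -ED setU11.
  by rewrite !inE negb_or => /andP[-> ->] /=; rewrite andbT andbb.
apply: (dim_sol_space_reindex (h := glue x) (h' := double_part)).
- move=> D /= /andP[Dx /eqP Dd]; rewrite card_glue // single_glue // eqxx double_glue //.
  by split=> //; rewrite andbT Dd halfK (negPf sj) subn0 subnKC.
- move=> A /= /andP[/eqP As /eqP xA].
  have gA : glue x (double_part A) = A by rewrite -xA glueK.
  have := single_double A; rewrite xA => Ax; rewrite Ax gA; split=> //=.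
  by rewrite -As -[in X in _ == X]gA card_glue // addKn doubleK.
- move=> [q B]; have [xB|xB] := eqVneq (single B) x; last first.
    left=> D /= /andP[Dx _]; apply/eqP; apply: contraNT xB => /rows_single.
    by rewrite single_glue // => <-.
  right; exists (q, double_part B) => D /= /andP[Dx _].
  by rewrite -rows_glue // -?xB ?single_double // glueK.
- move=> [q E]; have [Ex|Ex] := boolP (E \subset ~: (x.1 :|: x.2)); last first.
    left=> D /= /andP[Dx _]; apply: big_pred0 => i; apply/negbTE.
    apply: contra Ex => /andP[_ /eqP ED]; apply: subset_trans Dx; rewrite -ED.
    exact: subsetUr.
  by right; exists (q, glue x E) => D /= /andP[Dx _]; rewrite rows_glue.
Qed.

End BlockForm.

Section QuadraticMatrix.
Variable K : numFieldType.

Definition mx_quad n (H : 'M[K]_n) : extalg K n :=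
  \sum_i \sum_j H i j *: (ext_gen K i * ext_gen K j).

(** The matrix counts every monomial twice. *)
Lemma mx_quad_skew n (f : extalg K n) : ext_homog 2 f ->
  mx_quad (skew_mx (ext_coef f)) = 2%:R *: f.
Proof.
move=> /ext_homogP f2; apply: ext_coefP => A; rewrite ext_coefZ.
have E i j : ext_coef (skew_mx (ext_coef f) i j *: (ext_gen K i * ext_gen K j)) A =
    ((i != j) && (A == [set i; j]))%:R * ext_coef f A.
  rewrite ext_coefZ mxE; have [ij|ji|/val_inj ->] := ltngtP i j.
  - have -> : i != j by rewrite neq_ltn ij.
    rewrite ext_gen_mul // ext_coef_monom mulrC.
    by case: eqP => [->|_]; rewrite ?mul0r.
  - have -> : i != j by rewrite neq_ltn ji orbT.
    rewrite ext_gen_mulN ext_gen_mul // -scaleN1r ext_coefZ ext_coef_monom.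
    rewrite mulN1r mulrNN mulrC [in RHS]setUC.
    by case: eqP => [->|_]; rewrite ?mul0r.
  - by rewrite eqxx /= !mul0r.
rewrite ext_coef_sum; under eq_bigr => i _ do rewrite ext_coef_sum (eq_bigr _ (fun j _ => E i j)).
have [A2|/f2->] := eqVneq #|A| 2; last first.
  by rewrite mulr0 big1 // => i _; rewrite big1 // => j _; rewrite mulr0.
have /cards2P[k [l [kl AE]]] : #|A| == 2 by rewrite A2.
transitivity ((\sum_(i < n) \sum_(j < n) ((i != j) && (A == [set i; j]))%:R) * ext_coef f A).
  by rewrite mulr_suml; apply: eq_bigr => i _; rewrite mulr_suml.
congr (_ * _).
have row i : \sum_(j < n) ((i != j) && (A == [set i; j]))%:R =
    ((i == k) || (i == l))%:R :> K.
  have [->|ik] /= := eqVneq i k.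
    rewrite (bigD1 l) //= kl AE eqxx big1 ?addr0 // => j jl.
    rewrite (_ : (_ == [set k; j]) = false) ?andbF //; apply/eqP => /setP/(_ l).
    by rewrite !inE eqxx orbT eq_sym (negPf kl) eq_sym (negPf jl).
  have [->|il] /= := eqVneq i l.
    rewrite (bigD1 k) //= eq_sym kl AE setUC eqxx big1 ?addr0 // => j jk.
    rewrite (_ : (_ == [set l; j]) = false) ?andbF //; apply/eqP => /setP/(_ k).
    by rewrite !inE eqxx orbT (negPf kl) eq_sym (negPf jk).
  rewrite big1 // => j _; rewrite (_ : (A == _) = false) ?andbF //; apply/eqP => /setP/(_ i).
  by rewrite AE !inE eqxx (negPf ik) (negPf il).
rewrite (eq_bigr _ (fun i _ => row i)) (bigD1 k) //= eqxx (bigD1 l) 1?eq_sym //=.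
rewrite eqxx orbT big1 ?addr0 -?natrD // => i /andP[/negPf -> /negPf ->].
by [].
Qed.

Lemma mx_quad_subst n (P H : 'M[K]_n) :
  ext_subst (lin_change P) (mx_quad H) = mx_quad (P *m H *m P^T).
Proof.
rewrite linear_sum /= [LHS](_ : _ = \sum_i \sum_j H i j *: (lin_change P i * lin_change P j)).
  rewrite /mx_quad /lin_change.
  transitivity (\sum_i \sum_j \sum_k \sum_l
      (P k i * H i j * P l j) *: (ext_gen K k * ext_gen K l)).
    apply: eq_bigr => i _; apply: eq_bigr => j _; rewrite mulr_suml scaler_sumr.
    apply: eq_bigr => k _; rewrite mulr_sumr scaler_sumr; apply: eq_bigr => l _.
    rewrite -scalerAl -scalerAr !scalerA; congr (_ *: _).
    by ring.
  under eq_bigr => i _ do rewrite exchange_big.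
  rewrite exchange_big; apply: eq_bigr => k _ /=.
  under eq_bigr => i _ do rewrite exchange_big.
  rewrite exchange_big; apply: eq_bigr => l _ /=.
  rewrite mxE scaler_suml exchange_big; apply: eq_bigr => j _ /=.
  by rewrite !mxE mulr_suml scaler_suml; apply: eq_bigr => i _.
apply: eq_bigr => i _; rewrite linear_sum; apply: eq_bigr => j _; rewrite linearZ /=.
rewrite (ext_substM (lin_change_anticomm P) (lin_change_sqr P)) !ext_subst_monom.
by rewrite /ext_prod !enum_set1 !big_seq1.
Qed.

Lemma mx_quad_block m (H : 'M[K]_m.*2) : H^T = - H ->
  (forall k l, pair_index k != pair_index l -> H k l = 0) ->
  mx_quad H = 2%:R *: block_form (fun i => H (lft i) (rgt i)).
Proof.
move=> skH H0; rewrite /mx_quad sum_pairs scaler_sumr; apply: eq_bigr => i _.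
have row k : pair_index k = i -> \sum_l H k l *: (ext_gen K k * ext_gen K l) =
    H k (lft i) *: (ext_gen K k * ext_gen K (lft i)) +
    H k (rgt i) *: (ext_gen K k * ext_gen K (rgt i)).
  move=> ki; rewrite sum_pairs (bigD1 i) //= big1 ?addr0 // => j ji.
  by rewrite !H0 ?scale0r ?addr0 // ki ?lftK ?rgtK eq_sym.
rewrite (row (lft i)) ?lftK // (row (rgt i)) ?rgtK // !ext_gen_sqr !scaler0 add0r addr0.
have -> : H (rgt i) (lft i) = - H (lft i) (rgt i).
  by have /matrixP/(_ (lft i) (rgt i)) := skH; rewrite !mxE.
rewrite [ext_gen K (rgt i) * _]ext_gen_mulN scaleNr scalerN opprK -mulr2n -scaler_nat.
by rewrite ext_gen_mul.
Qed.

End QuadraticMatrix.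

(** Generic pencils are diagonalizable, so a substitution brings a generic pair to
   block form. *)
Lemma generic_pair_block_form (K : numClosedFieldType) m (f g : extalg K m.*2) : (0 < m)%N ->
  generic_quadratic_pair f g -> exists b a : 'I_m -> K, forall s,
    (\dim (ext_dual (block_form b) (block_form a) s) <= \dim (ext_dual f g s))%N.
Proof.
move=> m0 [f2 g2 indep].
have [P uP PB] : exists2 P : 'M[K]_m.*2, P \in unitmx &
    forall k l, pair_index k != pair_index l ->
    (P *m skew_mx (ext_coef f) *m P^T) k l = 0 /\ (P *m skew_mx (ext_coef g) *m P^T) k l = 0.
  apply: generic_pencil_block => //; apply: eq_alg_indep indep => k.
  by case: k.1.
pose c h i := (P *m skew_mx (ext_coef h) *m P^T) (lft i) (rgt i).
have sub h : ext_homog 2 h ->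
    (forall k l, pair_index k != pair_index l ->
      (P *m skew_mx (ext_coef h) *m P^T) k l = 0) ->
    ext_subst (lin_change P) h = block_form (c h).
  move=> h2 h0; have two0 : 2%:R != 0 :> K by rewrite pnatr_eq0.
  apply: (can_inj (scalerK two0)); rewrite -linearZ /= -mx_quad_skew // mx_quad_subst.
  apply: mx_quad_block => //.
  by rewrite !trmx_mul trmxK skew_mx_skew mulNmx mulmxN mulmxA.
exists (c f), (c g) => s; apply: (ext_dual_change_le _ uP).
  by apply: sub => // k l /PB[].
by apply: sub => // k l /PB[].
Qed.

(** * Lattice paths *)

Section Walks.
Local Open Scope nat_scope.

(** The condition of [lattice_path], for an arbitrary relation between consecutive
   points and arbitrary end points. *)
Definition walk_number (X : finType) (e : rel X) h (x0 x1 : X) : nat :=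
  #|[pred p : {ffun 'I_h.+1 -> X} | [&& p ord0 == x0, p ord_max == x1 &
    [forall y : 'I_h, e (p (widen_ord (leqnSn h) y)) (p (lift ord0 y))]]]|.

Lemma walk_number0 (X : finType) (e : rel X) x0 x1 :
  walk_number e 0 x0 x1 = (x0 == x1).
Proof.
rewrite /walk_number -sum1_card.
rewrite (eq_bigl (fun p => (p == [ffun=> x0]) && (x0 == x1))).
  case: (x0 == x1); last by rewrite big_pred0 // => p; rewrite andbF.
  by rewrite (big_pred1 [ffun=> x0]) // => p; rewrite andbT.
move=> p; have -> : ord_max = ord0 :> 'I_1 by apply/val_inj.
rewrite inE /= (_ : [forall y, _] = true) ?andbT; last by apply/forallP=> -[].
apply/andP/andP => [[/eqP <- ->]|[/eqP -> /eqP ->]].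
  by split=> //; apply/eqP/ffunP=> y; rewrite ffunE (ord1 y).
by rewrite ffunE eqxx.
Qed.

Lemma walk_numberS (X : finType) (e : rel X) h x0 x1 :
  walk_number e h.+1 x0 x1 = (\sum_(x | e x0 x) walk_number e h x x1)%N.
Proof.
pose tl (p : {ffun 'I_h.+2 -> X}) : {ffun 'I_h.+1 -> X} := [ffun y => p (lift ord0 y)].
pose cn (p : {ffun 'I_h.+1 -> X}) : {ffun 'I_h.+2 -> X} :=
  [ffun y => if unlift ord0 y is Some y' then p y' else x0].
have cn0 p : cn p ord0 = x0 by rewrite ffunE unlift_none.
have cnS p y : cn p (lift ord0 y) = p y by rewrite ffunE liftK.
rewrite /walk_number -sum1_card (reindex_onto cn tl) /=; last first.
  move=> p; rewrite inE => /andP[/eqP p0 _]; apply/ffunP=> y; rewrite ffunE.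
  by case: unliftP => [y' ->|->]; rewrite ?ffunE.
have maxE : ord_max = lift ord0 ord_max :> 'I_h.+2 by apply/val_inj.
transitivity (\sum_(p : {ffun 'I_h.+1 -> X} | [&& e x0 (p ord0), p ord_max == x1 &
    [forall y : 'I_h, e (p (widen_ord (leqnSn h) y)) (p (lift ord0 y))]]) 1)%N.
  apply: eq_bigl => p; rewrite inE /= cn0 eqxx maxE cnS /=.
  have -> : tl (cn p) = p by apply/ffunP=> y; rewrite ffunE cnS.
  rewrite eqxx andbT andbCA; congr (_ && _).
  apply/forallP/andP => [ep|[e0 /forallP ep] y].
    split; first by have := ep ord0; rewrite cnS (_ : widen_ord _ _ = ord0) ?cn0 //; apply/val_inj.
    apply/forallP=> y; have := ep (lift ord0 y); rewrite cnS.
    by rewrite (_ : widen_ord _ _ = lift ord0 (widen_ord (leqnSn h) y)) ?cnS //; apply/val_inj.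
  have [y' ->|->] := unliftP ord0 y; rewrite cnS.
    by rewrite (_ : widen_ord _ _ = lift ord0 (widen_ord (leqnSn h) y')) ?cnS //; apply/val_inj.
  by rewrite (_ : widen_ord _ _ = ord0) ?cn0 //; apply/val_inj.
rewrite (partition_big (fun p : {ffun 'I_h.+1 -> X} => p ord0) (e x0)) /=; last first.
  by move=> p /andP[].
apply: eq_bigr => x ex; rewrite sum1_card; apply: eq_card => p; rewrite !inE.
rewrite unfold_in; have [->|_] := eqVneq (p ord0) x; rewrite ?ex ?andbT ?andbF //.
Qed.

(** The end point w of the walk is also the upper end of the interval [0, w] that it
   may not leave; the recursion is on the first step. *)
Fixpoint walks w h x : nat :=
  if h is h'.+1 then
    (if 0 < x then walks w h' x.-1 else 0) + (if x < w then walks w h' x.+1 else 0)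
  else x == w.

Lemma card_lattice_path w h : #|@lattice_path w h| = walks w h 0.
Proof.
pose e (x x' : 'I_w.+1) := (x' == x.+1 :> nat) || (x == x'.+1 :> nat).
suff W x : walk_number e h x ord_max = walks w h x.
  by rewrite -(W ord0); apply: eq_card => p.
elim: h x => [|h IHh] x; first by rewrite walk_number0.
rewrite walk_numberS /= big_mkcond /=.
under eq_bigr => x' _ do rewrite IHh.
transitivity (\sum_(x' : 'I_w.+1) ((if x == x'.+1 :> nat then walks w h x' else 0) +
   (if x' == x.+1 :> nat then walks w h x' else 0))).
  apply: eq_bigr => x' _; rewrite /e.
  by case: eqP => [->|_]; case: eqP => //=; [lia | rewrite addn0].
rewrite big_split /=; congr (_ + _).
  have [x0|x0] := ltnP 0 x; last by rewrite big1 // => x' _; case: eqP => //; lia.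
  have xw : x.-1 < w.+1 by rewrite (leq_ltn_trans (leq_pred x)).
  rewrite (bigD1 (Ordinal xw)) //= prednK // eqxx big1 ?addn0 // => x' /eqP xx.
  by case: eqP => // xE; case: xx; apply/val_inj; rewrite /= xE.
have [xw|xw] := ltnP x w; last first.
  by rewrite big1 // => x' _; case: eqP => //; have := ltn_ord x'; lia.
rewrite (bigD1 (Ordinal (xw : x.+1 < w.+1))) //= eqxx big1 ?addn0 // => x' /eqP xx.
by case: eqP => // xE; case: xx; apply/val_inj; rewrite /= xE.
Qed.

Lemma walks_neq0 w h x : walks w h x != 0 -> (w <= x + h) /\ odd (x + h) = odd w.
Proof.
elim: h x => [|h IHh] x /=; first by have [->|//] := eqVneq x w; rewrite addn0.
rewrite addn_eq0 negb_and => /orP[].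
  by case: ltnP => // x0 /IHh[]; lia.
by case: ltnP => // xw /IHh[]; lia.
Qed.

Lemma walks_diag w : walks w w 0 = 1.
Proof.
suff W h x : x + h = w -> walks w h x = 1 by exact: W.
elim: h x => [|h IHh] x xw /=; first by rewrite -xw addn0 eqxx.
rewrite (IHh x.+1); last by lia.
have -> : x < w by lia.
case: ltnP => // x0; case: (walks w h x.-1 =P 0) => [->//|/eqP/walks_neq0[]]; lia.
Qed.

Definition binomial_sum m (f : nat -> nat) :=
  \sum_(j < m.+1) 'C(m, j) * 2 ^ j * f (m - j).

(** Pascal's rule; the sum is (2 + shift)^m applied to f. *)
Lemma binomial_sumS m f :
  binomial_sum m.+1 f = 2 * binomial_sum m f + binomial_sum m (fun k => f k.+1).
Proof.
rewrite /binomial_sum big_ord_recl /= bin0 mul1n expn0 mul1n subn0.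
under eq_bigr => i _ do rewrite /bump /= add1n binS subSS 2!mulnDl.
rewrite big_split /= addnA addnC; congr (_ + _).
  by rewrite big_distrr; apply: eq_bigr => i _; rewrite expnS /=; lia.
transitivity (\sum_(j < m.+2) 'C(m, j) * 2 ^ j * f (m.+1 - j)).
  by rewrite [RHS]big_ord_recl /= bin0 mul1n expn0 mul1n subn0.
rewrite big_ord_recr /= bin_small // !mul0n addn0; apply: eq_bigr => i _.
by rewrite subSn // -ltnS.
Qed.

(** A walk from end to end of [0, 2v + 2] visits the odd places at odd times.
   Between its first and last steps, which are forced, it makes m double steps on
   these v + 1 places: each is a move to a neighbour or, in two ways, a rest. *)
Lemma walks_double v m :
  walks v.*2.+2 m.*2.+2 0 = binomial_sum m (fun k => walks v k 0).
Proof.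
set w := v.*2.+2.
suff W x : x <= v -> walks w m.*2.+1 x.*2.+1 = binomial_sum m (fun k => walks v k x).
  by rewrite -(W 0) //= addn0.
have W2 n y : y <= v -> walks w n.+2 y.*2.+1 =
    2 * walks w n y.*2.+1 + ((if 0 < y then walks w n y.-1.*2.+1 else 0) +
      (if y < v then walks w n y.+1.*2.+1 else 0)).
  move=> yv; rewrite /= -/(walks w n).
  have -> : (y.*2.+1 < w) = true by rewrite /w; lia.
  have -> : (y.*2 < w) = true by rewrite /w; lia.
  have -> : (y.*2.+2 < w) = (y < v) by rewrite /w; lia.
  have -> : (0 < y.*2) = (0 < y) by lia.
  rewrite doubleS (_ : (if 0 < y then walks w n y.*2.-1 else 0) =
    (if 0 < y then walks w n y.-1.*2.+1 else 0)); first by lia.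
  by case: y {yv} => // y; rewrite doubleS.
elim: m x => [|m IHm] x xv.
  rewrite /binomial_sum big_ord1 /= mul1n.
  have -> : (x.*2.+1 < w) = true by rewrite /w; lia.
  by rewrite /w; lia.
have step : binomial_sum m (fun k => walks v k.+1 x) =
    (if 0 < x then binomial_sum m (fun k => walks v k x.-1) else 0) +
    (if x < v then binomial_sum m (fun k => walks v k x.+1) else 0).
  rewrite {1}/binomial_sum /=; under eq_bigr => j _ do rewrite mulnDr.
  by rewrite big_split; congr (_ + _); case: ifP => // _;
    rewrite big1 // => j _; rewrite muln0.
rewrite doubleS W2 // binomial_sumS IHm // step; congr (_ + (_ + _)); case: ifP => // x0.
  by rewrite IHm // (leq_trans (leq_pred x)).
by rewrite IHm.
Qed.

(** The number a(k - 2, d), the shift of the index being that of [dim_square_dual]. *)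
Definition walk_dim k d : nat := if d.*2 <= k then walks (k - d.*2) k 0 else 0.

Lemma path_numberE n s : path_number n s = walk_dim n.+2 s.
Proof. by rewrite /path_number /walk_dim; case: ifP => // _; rewrite card_lattice_path. Qed.

Lemma walk_dim0 k : walk_dim k 0 = 1.
Proof. by rewrite /walk_dim subn0 walks_diag. Qed.

Lemma walk_dim_small k d : k <= 2 -> walk_dim k d = (d == 0).
Proof.
case: d => [|d]; first by rewrite walk_dim0.
rewrite /walk_dim doubleS; case: k => [|[|[|//]]] //.
by case: d.
Qed.

Lemma walk_dim_double m s :
  walk_dim m.*2.+2 s = \sum_(j < m.+1) 'C(m, j) * 2 ^ j *
    (if (j <= s) && ~~ odd (s - j) then walk_dim (m - j) (s - j)./2 else 0).
Proof.
have [sm|sm] := leqP s m; last first.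
  rewrite /walk_dim big1 => [|j _].
    case: leqP => // s1; have -> : s = m.+1 by lia.
    have -> : m.*2.+2 - m.+1.*2 = 0 by lia.
    by rewrite /= addn0.
  have [/andP[js sj]|_] := boolP (_ && _); last by rewrite muln0.
  by have := ltn_ord j; case: (leqP _ (m - j)); rewrite ?muln0 //; lia.
have -> : walk_dim m.*2.+2 s = walks (m - s).*2.+2 m.*2.+2 0.
  rewrite /walk_dim; have -> : s.*2 <= m.*2.+2 by lia.
  by congr walks; lia.
rewrite walks_double; apply: eq_bigr => j _; congr (_ * _).
have jm := ltn_ord j.
have [/andP[js sj]|jsF] := ifPn.
  rewrite /walk_dim; have -> : (s - j)./2.*2 = s - j by lia.
  have -> : (s - j <= m - j) by lia.
  by congr walks; lia.
apply/eqP; apply: contraNT jsF => /walks_neq0[]; lia.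
Qed.

End Walks.

(** * The Hilbert series *)

(** A pair of disjoint sets is a set U together with a subset of U. *)
Lemma sum_disjoint_pairs m (G : nat -> nat) :
  (\sum_(x : {set 'I_m} * {set 'I_m} | [disjoint x.1 & x.2]) G #|x.1 :|: x.2| =
   \sum_(j < m.+1) 'C(m, j) * 2 ^ j * G j)%N.
Proof.
rewrite big_mkcond -(pair_bigA _ (fun S T : {set 'I_m} =>
  if [disjoint S & T] then G #|S :|: T| else 0%N)) /=.
transitivity (\sum_(S : {set 'I_m}) \sum_(U : {set 'I_m} | S \subset U) G #|U|)%N.
  apply: eq_bigr => S _; rewrite -big_mkcond /=.
  rewrite [RHS](reindex_onto (fun T => S :|: T) (fun U => U :\: S)) /=; last first.
    by move=> U SU; rewrite setDE setUIr setUCr setIT; apply/setUidPr.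
  apply: eq_big => [T|T _] //; rewrite subsetUl /= setDUl setDv set0U.
  by rewrite disjoint_sym; apply/setDidPl/eqP.
rewrite (exchange_big_dep predT) //=.
transitivity (\sum_(U : {set 'I_m}) 2 ^ #|U| * G #|U|)%N.
  apply: eq_bigr => U _; rewrite sum_nat_const -card_powerset; congr (_ * _)%N.
  by apply: eq_card => S; rewrite [RHS]powersetE.
rewrite (partition_big (fun U : {set 'I_m} => inord #|U| : 'I_m.+1) predT) //=.
apply: eq_bigr => j _.
have E (U : {set 'I_m}) : (inord #|U| == j) = (#|U| == j).
  by rewrite -val_eqE /= inordK // ltnS -[X in (_ <= X)%N]card_ord max_card.
rewrite (eq_bigl _ _ E) (eq_bigr (fun=> 2 ^ j * G j)%N) => [|U /eqP -> //].
rewrite sum_nat_const mulnA; congr (_ * _ * _)%N.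
have := card_draws 'I_m j; rewrite card_ord => <-; apply: eq_card => U.
by rewrite [RHS]inE.
Qed.

Section Generic.
Variables (K : numClosedFieldType) (ga gb : forall k, 'I_k -> K).
Hypothesis gen_indep : forall k, alg_indep_rat (coef_pair (@ga k) (@gb k)).

Definition binomial_dim (h : nat -> nat -> nat) m s : nat :=
  (\sum_(j < m.+1) 'C(m, j) * 2 ^ j *
     (if (j <= s) && ~~ odd (s - j) then h (m - j) (s - j)./2 else 0))%N.

(** The pair of block forms with generic coefficients gives the upper bound, and the
   block forms equivalent to (f, g) give the lower one. *)
Lemma dim_generic_ext_dual m (f g : extalg K m.*2) s : (0 < m)%N ->
  generic_quadratic_pair f g ->
  \dim (ext_dual f g s) = binomial_dim (generic_dim ga gb) m s.
Proof.
move=> m0 fg; rewrite /binomial_dim -(sum_disjoint_pairs m (fun j =>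
  if (j <= s)%N && ~~ odd (s - j) then generic_dim ga gb (m - j) (s - j)./2 else 0%N)).
have cardC (S : {set 'I_m}) : #|~: S| = (m - #|S|)%N by rewrite cardsCs setCK card_ord.
apply/eqP; rewrite eqn_leq; apply/andP; split.
  apply: (leq_trans (generic_ext_dual_le s fg (block_form_homog (@ga m)) (block_form_homog (@gb m)))).
  rewrite dim_ext_dual_block; apply: leq_sum => x _ /=; case: ifP => // _.
  by rewrite (generic_dimE gen_indep) // cardC.
have [b [a ba]] := generic_pair_block_form m0 fg.
apply: leq_trans (ba s); rewrite dim_ext_dual_block; apply: leq_sum => x _ /=.
case: ifP => // _; rewrite -cardC; exact: generic_dim_le.
Qed.

(** In degree s = 2d, the term j = 0 of the sum for m = k is h k d. *)
Lemma binomial_dim_inj (h h' : nat -> nat -> nat) :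
  (forall k d, (k <= 2)%N -> h k d = h' k d) ->
  (forall m s, (0 < m)%N -> binomial_dim h m s = binomial_dim h' m s) ->
  forall k d, h k d = h' k d.
Proof.
move=> small eqB; elim/ltn_ind => k IHk d.
have [/small //|k3] := leqP k 2.
have := eqB k d.*2 (ltn_trans (isT : 0 < 2)%N k3).
rewrite /binomial_dim !big_ord_recl /= !subn0 odd_double doubleK !muln1 bin0 !mul1n.
set S := BIG_F; rewrite [X in (_ + X)%N = _](eq_bigr (fun i : 'I_k => 'C(k, bump 0 i) * 2 ^ bump 0 i *
  (if (bump 0 i <= d.*2) && ~~ odd (d.*2 - bump 0 i) then h' (k - bump 0 i) (d.*2 - bump 0 i)./2
   else 0)))%N; first by move/addIn.
move=> i _; rewrite /S; congr (_ * _)%N; case: ifP => // _.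
by rewrite IHk // /bump /=; have := ltn_ord i; lia.
Qed.

End Generic.

Section Equivalence.
Variable K : numClosedFieldType.
Hypothesis exists_indep : forall I : finType, exists c : I -> K, alg_indep_rat c.

Lemma exists_quadratic_pair n : exists f g : extalg K n, generic_quadratic_pair f g.
Proof.
have [c indep] := exists_indep (bool * {A : {set 'I_n} | #|A| == 2})%type.
pose f b : extalg K n := [ffun A => if insub A is Some s then c (b, s) else 0].
have fE b s : ext_coef (f b) (val s) = c (b, s) by rewrite /ext_coef ffunE valK.
have fh b : ext_homog 2 (f b).
  by apply/ext_homogP => A A2; rewrite /ext_coef ffunE insubN.
exists (f true), (f false); split=> //.
by apply: eq_alg_indep indep => -[[] s] /=; rewrite fE.
Qed.

Lemma exists_linear_pair n : exists l1 l2 : {mpoly K[n]}, generic_linear_pair l1 l2.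
Proof.
have [c indep] := exists_indep (bool * 'I_n)%type.
pose l b : {mpoly K[n]} := \sum_i c (b, i) *: 'X_i.
have lh b : l b \is 1.-homog.
  by apply: rpred_sum => i _; rewrite dhomogZ // dhomogX /= mdeg1.
have lE b i : (l b)@_U_(i) = c (b, i).
  rewrite raddf_sum (bigD1 i) //= big1 ?addr0 => [|j /negPf ji].
    by rewrite mcoeffZ mcoeffX eqxx mulr1.
  by rewrite mcoeffZ mcoeffX eq_mnm1 ji mulr0.
exists (l true), (l false); split=> //.
by apply: eq_alg_indep indep => -[[] i] /=; rewrite lE.
Qed.

Definition exterior_series := forall n : nat, (0 < n)%N -> ~~ odd n ->
   forall f g : extalg K n, generic_quadratic_pair f g ->
   quotient_hilbert_series (@ext_homog K n) [:: f; g]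
     (fun s => (1 + \sum_(1 <= k < (uphalf n).+1)
                      (path_number n k)%:P * 'X^k : {poly nat})`_s).

Definition squares_series := forall n : nat, (0 < n)%N ->
   forall l1 l2 : {mpoly K[n]}, generic_linear_pair l1 l2 ->
   quotient_hilbert_series (fun s (p : {mpoly K[n]}) => p \is s.-homog)
     ([seq 'X_i ^+ 2 | i : 'I_n] ++ [:: l1 ^+ 2; l2 ^+ 2])
     (fun s => path_number n s).

(** This is why the series in (i) may stop at t^(n/2). *)
Lemma walk_dim_gt m s : (m < s)%N -> walk_dim m.*2.+2 s = 0%N.
Proof.
move=> ms; rewrite walk_dim_double big1 // => j _; case: ifP => [/andP[js sj]|]; last by rewrite muln0.
rewrite /walk_dim; case: ifP => [sm|]; rewrite ?muln0 //.
by have := ltn_ord j; move: sm; rewrite halfK (negPf sj); lia.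
Qed.

Lemma path_series_coef m s : (0 < m)%N ->
  (1 + \sum_(1 <= k < (uphalf m.*2).+1) (path_number m.*2 k)%:P * 'X^k : {poly nat})`_s
  = walk_dim m.*2.+2 s.
Proof.
move=> m0; rewrite uphalf_double coefD coef1 coef_sum.
under eq_bigr => k _ do rewrite coefCM coefXn path_numberE.
case: s => [|s].
  by rewrite walk_dim0 big_nat_cond big1 ?addr0 // => k /andP[/andP[k1 _] _]; rewrite ltn_eqF ?mulr0.
rewrite /= add0r; have [sm|sm] := ltnP s m.
  rewrite (bigD1_seq s.+1) ?iota_uniq ?mem_index_iota //= eqxx mulr1 big1 ?addr0 //.
  by move=> k /negPf ks; rewrite eq_sym ks mulr0.
rewrite walk_dim_gt ?ltnS // big_nat_cond big1 // => k /andP[/andP[_ km] _].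
by rewrite gtn_eqF ?mulr0 // (leq_trans km).
Qed.

Lemma hilbert_series_equivalence : exterior_series <-> squares_series.
Proof.
have [c cP] : exists c : forall k, bool * 'I_k -> K, forall k, alg_indep_rat (c k).
  by exists (fun k => projT1 (cid (exists_indep (bool * 'I_k)%type))) => k;
     exact: (projT2 (cid (exists_indep (bool * 'I_k)%type))).
pose ga k (i : 'I_k) := c k (true, i); pose gb k (i : 'I_k) := c k (false, i).
have gen_indep k : alg_indep_rat (coef_pair (@ga k) (@gb k)).
  by apply: eq_alg_indep (cP k) => -[[] i].
have extE : exterior_series <-> forall m s, (0 < m)%N ->
    binomial_dim (generic_dim ga gb) m s = walk_dim m.*2.+2 s.
  split=> [series m s m0|dimE n n0 en f g fg s].
    have [f [g fg]] := exists_quadratic_pair m.*2; have [f2 g2 _] := fg.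
    rewrite -(dim_generic_ext_dual gen_indep _ m0 fg).
    have := series m.*2; rewrite double_gt0 odd_double => /(_ m0 isT f g fg s).
    rewrite path_series_coef //; apply: quotient_dim_unique.
    - by apply/ext_homogP => A _; exact: ext_coef0.
    - exact: in_idealP.
    - exact: in_ideal0.
    - exact: quotient_dim_ext.
  have nE : n = n./2.*2 by rewrite halfK (negPf en) subn0.
  move: f g fg; rewrite nE in n0 *; rewrite double_gt0 in n0 => f g fg.
  have [f2 g2 _] := fg; rewrite path_series_coef // -dimE //.
  by rewrite -(dim_generic_ext_dual gen_indep _ n0 fg); exact: quotient_dim_ext.
have sqE : squares_series <-> forall n s, (0 < n)%N ->
    generic_dim ga gb n.+2 s = walk_dim n.+2 s.
  have dimE n (l1 l2 : {mpoly K[n]}) s : generic_linear_pair l1 l2 ->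
      quotient_dim (fun p : {mpoly K[n]} => p \is s.-homog)
        (in_ideal ([seq 'X_i ^+ 2 | i : 'I_n] ++ [:: l1 ^+ 2; l2 ^+ 2]))
        (generic_dim ga gb n.+2 s).
    case=> l1h l2h indep.
    have indep' : alg_indep_rat (coef_pair (fun i => l1@_U_(i)) (fun i => l2@_U_(i))).
      by apply: eq_alg_indep indep => -[[] i].
    have := dim_square_dual gen_indep s indep'; rewrite card_ord => <-.
    by apply: quotient_dim_sqfree => //; exact: linear_formE.
  split=> [series n s n0|gE n n0 l1 l2 l12 s].
    have [l1 [l2 l12]] := exists_linear_pair n.
    rewrite -path_numberE; have := series n n0 l1 l2 l12 s.
    move: (dimE n l1 l2 s l12); apply: quotient_dim_unique.
    - exact: dhomog0.
    - exact: in_idealP.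
    - exact: in_ideal0.
  by rewrite path_numberE -gE //; exact: dimE.
rewrite extE sqE; have small k d : (k <= 2)%N -> generic_dim ga gb k d = walk_dim k d.
  by move=> k2; rewrite generic_dim_small // walk_dim_small.
split=> [dimE n s n0|dimE m s m0].
  apply: (binomial_dim_inj small) => m t m0; rewrite dimE //.
  exact: walk_dim_double.
rewrite walk_dim_double; apply: eq_bigr => j _; case: ifP => // _; congr (_ * _)%N.
have [/small //|k3] := leqP (m - j) 2.
by case: (m - j)%N k3 => [|[|[|k]]] // _; exact: dimE.
Qed.

End Equivalence.

Theorem theorem1 (R : realType) :
  (forall n : nat, (0 < n)%N -> ~~ odd n ->
   forall f g : extalg R[i] n, generic_quadratic_pair f g ->
   quotient_hilbert_series (@ext_homog R[i] n) [:: f; g]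
     (fun s => (1 + \sum_(1 <= k < (uphalf n).+1)
                      (path_number n k)%:P * 'X^k : {poly nat})`_s))
  <->
  (forall n : nat, (0 < n)%N ->
   forall l1 l2 : {mpoly R[i][n]}, generic_linear_pair l1 l2 ->
   quotient_hilbert_series (fun s (p : {mpoly R[i][n]}) => p \is s.-homog)
     ([seq 'X_i ^+ 2 | i : 'I_n] ++ [:: l1 ^+ 2; l2 ^+ 2])
     (fun s => path_number n s)).
Proof. exact: (hilbert_series_equivalence (@complex_exists_alg_indep R)). Qed.
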